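(* Let $n\ge 2$ be an integer, $1<p<n$ and $\lambda\in\mathbb{R}$. There is a locally compact $n$-regular metric space that supports an Orlicz $(p,\lambda)$-Poincaré inequality but does not support an Orlicz $(p,\lambda-\epsilon)$-Poincaré inequality for any $\epsilon>0$.
   Context: A metric space $X$ is considered with its $n$-dimensional Hausdorff measure $\mu=H^n$; it is $n$-regular if there is a constant $C\ge1$ with $C^{-1}r^n\le\mu(B(x,r))\le Cr^n$ for all $x\in X$ and $0<r\le\operatorname{diam}X$ ($r<\infty$). For a real-valued function $u$ on $X$, a Borel function $g:X\to[0,\infty]$ is an upper gradient of $u$ if $|u(x)-u(y)|\le\int_\gamma g\,ds$ for all $x,y\in X$ and every rectifiable curve $\gamma$ joining $x$ and $y$ in $X$. Let $\Psi(t)=t^p\log^{\lambda}(e+t)$, with generalized inverse $\Psi^{-1}(t)=\inf\{s:\Psi(s)>t\}$ ($\inf\emptyset=\infty$). The space $X$ supports an Orlicz $(p,\lambda)$-Poincaré inequality (a $\Psi$-Poincaré inequality for this $\Psi$) if there are constants $C_\Psi>0$ and $\tau\ge1$ such that for every function $u$ on $X$ integrable on balls, every upper gradient $g$ of $u$, and every ball $B=B(x,r)$ of $X$, $$\frac{1}{\mu(B)}\int_B|u-u_B|\,d\mu\le C_\Psi\, r\,\Psi^{-1}\left(\frac{1}{\mu(\tau B)}\int_{\tau B}\Psi(g)\,d\mu\right),$$ where $u_B=\mu(B)^{-1}\int_B u\,d\mu$ and $\tau B=B(x,\tau r)$. *)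

(* Defs.v *)
From HB Require Import structures.
From mathcomp Require Import all_boot all_order all_algebra.
From mathcomp Require Import all_classical all_reals all_analysis.
From mathcomp Require Import measurable_realfun.

Set Implicit Arguments.
Unset Strict Implicit.
Unset Printing Implicit Defensive.
Import Order.TTheory GRing.Theory Num.Theory.
Import numFieldNormedType.Exports.
Local Open Scope classical_set_scope.
Local Open Scope ring_scope.
Local Open Scope ereal_scope.

(* The distinguished point carries no metric information: it is only there
   because the measurable structures below live on pointed types. *)
#[short(type="pmetricType")]
HB.structure Definition PointedMetric (R : numDomainType) :=
  {M of Metric R M & Pointed M}.

Section hausdorff.
Context {R : realType} (X : pmetricType R) (n : nat).
Implicit Types (A U : set X) (d : R).

(* The value on the empty set is 0 rather than -oo = ereal_sup set0. *)
Definition diam A : \bar R :=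
  maxe 0 (ereal_sup [set (mdist z.1 z.2)%:E | z in A `*` A]).

(* The case distinction only matters for n = 0, where (diam set0) ^+ 0 = 1. *)
Definition gauge U : \bar R := if U == set0 then 0 else diam U ^+ n.

Definition hausdorff_pre d A : \bar R :=
  ereal_inf [set \sum_(k <oo) gauge (U k) | U in
    [set U : (set X)^nat | (forall k, diam (U k) <= d%:E) /\
                           A `<=` \bigcup_k U k]].

(* Without the usual normalizing factor (the Lebesgue measure of a Euclidean
   ball of diameter 1): rescaling the measure affects neither n-regularity nor
   the averages in a Poincare inequality. *)
Definition hausdorff A : \bar R :=
  ereal_sup [set hausdorff_pre d A | d in [set d : R | (0 < d)%R]].

Lemma diam_ge0 A : 0 <= diam A.
Proof. by rewrite /diam le_max lexx. Qed.

Lemma diam0 : diam set0 = 0.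
Proof. by rewrite /diam setX0 image_set0 ereal_sup0 maxeNy. Qed.

Lemma gauge_ge0 U : 0 <= gauge U.
Proof. by rewrite /gauge; case: ifP => // _; rewrite expe_ge0 ?diam_ge0. Qed.

Definition gauge_le d (U : set (g_sigma_algebraType [set: set X])) : \bar R :=
  if diam U <= d%:E then gauge U else +oo.

Lemma gauge_le_ge0 d U : 0 <= gauge_le d U.
Proof. by rewrite /gauge_le; case: ifP => // _; exact: gauge_ge0. Qed.

Lemma gauge_le0 d : (0 < d)%R -> gauge_le d set0 = 0.
Proof.
by move=> d0; rewrite /gauge_le diam0 lee_fin (ltW d0) /gauge eqxx.
Qed.

Lemma hausdorff_preE d A : hausdorff_pre d A = mu_ext (gauge_le d) A.
Proof.
apply/eqP; rewrite eq_le; apply/andP; split.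
  apply: le_ereal_inf_tmp => _ [U [_ AU] <-].
  have [Ud|] := pselect (forall k, diam (U k) <= d%:E).
    apply: ereal_inf_lbound; exists U => //.
    by apply: eq_eseriesr => k _; rewrite /gauge_le Ud.
  move=> /existsNP[k /negP Uk].
  rewrite (@eseries_pinfty _ _ xpredT k) ?leey//.
    by move=> i _; rewrite -ltNye (lt_le_trans _ (gauge_le_ge0 _ _)).
  by rewrite /gauge_le (negbTE Uk).
apply: le_ereal_inf_tmp => _ [U [Ud AU] <-].
apply: ereal_inf_lbound; exists U.
  by split=> // k; exact: sub_sigma_algebra.
by apply: eq_eseriesr => k _; rewrite /gauge_le Ud.
Qed.

Lemma hausdorff0 : hausdorff set0 = 0.
Proof.
rewrite /hausdorff (_ : [set _ | _ in _] = [set 0]) ?ereal_sup1//.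
apply/seteqP; split=> [_ [d /= d0 <-]|_ ->].
  by rewrite hausdorff_preE mu_ext0//; [exact: gauge_le0|exact: gauge_le_ge0].
exists 1%R => /=; first exact: ltr01.
by rewrite hausdorff_preE mu_ext0//; [exact: gauge_le0|exact: gauge_le_ge0].
Qed.

Lemma hausdorff_ge0 A : 0 <= hausdorff A.
Proof.
apply: (@le_trans _ _ (hausdorff_pre 1 A)).
  by rewrite hausdorff_preE mu_ext_ge0//; exact: gauge_le_ge0.
by apply: ereal_sup_ubound; exists 1%R => //=; exact: ltr01.
Qed.

Lemma le_hausdorff : {homo hausdorff : A B / A `<=` B >-> A <= B}.
Proof.
move=> A B AB; apply: ge_ereal_sup => _ [d d0 <-].
apply: (@le_trans _ _ (hausdorff_pre d B)).
  by rewrite !hausdorff_preE; exact: le_mu_ext.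
by apply: ereal_sup_ubound; exists d.
Qed.

Lemma hausdorff_sigma_subadditive : sigma_subadditive hausdorff.
Proof.
move=> F; apply: ge_ereal_sup => _ [d d0 <-].
rewrite hausdorff_preE.
apply: (@le_trans _ _ (\sum_(i <oo) mu_ext (gauge_le d) (F i))).
  by apply: mu_ext_sigma_subadditive => U; exact: gauge_le_ge0.
apply: lee_nneseries => i _; first by rewrite mu_ext_ge0//; exact: gauge_le_ge0.
by rewrite -hausdorff_preE; apply: ereal_sup_ubound; exists d.
Qed.

HB.instance Definition _ := isOuterMeasure.Build R X hausdorff
  hausdorff0 hausdorff_ge0 le_hausdorff hausdorff_sigma_subadditive.

Definition hausdorff_outer : {outer_measure set X -> \bar R} := hausdorff.

(* H^n on its Caratheodory-measurable sets, which include the Borel sets. *)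
Definition hausdorff_measure :
    {measure set (caratheodory_type hausdorff_outer) -> \bar R} :=
  [the measure _ _ of
    (hausdorff_outer : set (caratheodory_type hausdorff_outer) -> \bar R)].

End hausdorff.

Section curves.
Context {R : realType} (X : pmetricType R).
Implicit Types (c : R -> X) (a b t : R) (g : X -> \bar R).

Definition curve_length c a b : \bar R :=
  ereal_sup [set (\sum_(0 <= i < size s)
     mdist (c (nth b (a :: s) i)) (c (nth b (a :: s) i.+1)))%:E
   | s in itv_partition a b].

Definition rectifiable_curve c a b : Prop :=
  [/\ (a <= b)%R, {within `[a, b], continuous c} & curve_length c a b < +oo].

(* Point of the curve at arc length t from c a; it does not depend on the
   parameter chosen, as c is constant where its length function is. *)
Definition arc_length_param c a b t : X :=
  c (xget a [set s | s \in `[a, b]%R /\ curve_length c a s = t%:E]).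

Definition curve_integral c a b g : \bar R :=
  \int[lebesgue_measure]_(t in `[0%R, fine (curve_length c a b)])
    g (arc_length_param c a b t).

Definition borel_function g : Prop :=
  measurable_fun [set: g_sigma_algebraType (@open X)]
    (g : g_sigma_algebraType (@open X) -> \bar R).

Definition upper_gradient (u : X -> R) g : Prop :=
  [/\ borel_function g, (forall x, 0 <= g x) &
      forall c a b, rectifiable_curve c a b ->
        `|u (c a) - u (c b)|%:E <= curve_integral c a b g].

End curves.

Section orlicz.
Context {R : realType}.
Implicit Types (p lam t : R).

Definition Psi p lam t : R := (t `^ p * ln (expR 1 + t) `^ lam)%R.

Definition Psi_ext p lam (t : \bar R) : \bar R :=
  if t is t%:E then (Psi p lam t)%:E else t.

Definition Psi_inv p lam (t : \bar R) : \bar R :=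
  ereal_inf [set s%:E | s in [set s : R | (0 <= s)%R /\ t < (Psi p lam s)%:E]].

End orlicz.

Section spaces.
Context {R : realType} (X : pmetricType R) (n : nat).

Local Notation mu := (hausdorff_measure X n).

Definition regular_space_of_dim : Prop :=
  exists C : R, (1 <= C)%R /\
    forall (x : X) (r : R), (0 < r)%R -> r%:E <= diam [set: X] ->
      (C^-1 * r ^+ n)%:E <= mu (ball x r) /\ mu (ball x r) <= (C * r ^+ n)%:E.

Definition integrable_on_balls (u : X -> R) : Prop :=
  forall (x : X) (r : R), (0 < r)%R ->
    mu.-integrable (ball x r)
      (EFin \o u : caratheodory_type (hausdorff_outer X n) -> \bar R).

Definition average (f : X -> \bar R) (A : set X) : \bar R :=
  (\int[mu]_(y in A) f y) / mu A.

Definition supports_orlicz_poincare (p lam : R) : Prop :=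
  exists C tau : R, [/\ (0 < C)%R, (1 <= tau)%R &
    forall (u : X -> R) (g : X -> \bar R),
      integrable_on_balls u -> upper_gradient u g ->
      forall (x : X) (r : R), (0 < r)%R ->
        let B := ball x r in
        let uB := fine (average (EFin \o u) B) in
        average (fun y => `|u y - uB|%:E) B
        <= (C * r)%:E *
           Psi_inv p lam (average (Psi_ext p lam \o g) (ball x (tau * r)))].

End spaces.

(* Main.v *)
Require Import Defs.
From HB Require Import structures.
From mathcomp Require Import all_boot all_order all_algebra.
From mathcomp Require Import all_classical all_reals all_analysis.
From mathcomp Require Import measurable_realfun ring lra.
Set Implicit Arguments.
Unset Strict Implicit.
Unset Printing Implicit Defensive.
Import Order.TTheory GRing.Theory Num.Theory.
Import numFieldNormedType.Exports.
Local Open Scope classical_set_scope.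
Local Open Scope ring_scope.

(** Write n = d + 1 and Psi(t) = t^p log^lam(e + t). The space is R^d x R with the sup norm, from
    which a perforated wall is removed: of the hyperplane t = 0 there remain only the holes, balls
    of radius e_i around the points of an r_i-separated net, for all levels i = 0, 1, 2, ... The
    radii are tied by r_i^d = e_i^(d+1) Psi(1/e_i). Heuristically e^(d+1) Psi(1/e) is the
    Psi-capacity of one hole and r^(-d) the number of holes per unit of area, so the holes of each
    level have capacity of order 1 per unit of area. Replacing lam by lam - eps multiplies this
    density by log(e + 1/e_i)^(-eps), and e_i is taken so small that the factor is at most 2^(-i
    eps). The space is open in R^n with a null complement, hence locally compact, and its Hausdorff
    measure is a multiple of Lebesgue measure ([hausdorff_box], [hausdorff_restr]), which gives
    regularity.

    The Poincare inequality holds because the wall is invisible to a function whose upper gradient g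
    has locally finite Psi-energy. Above and below a base point x the wall can be crossed at level i
    by a curve that narrows inside a double cone, passes through a hole and widens back. A Young
    inequality adapted to the choice of r_i ([Psi_young]) bounds g on the cones by A times the
    Jacobian times Psi(g), plus B times an integrable tail, where B is as small as desired.
    Integrated over x, the crossing therefore costs at most A times the energy in the slab |t| <= 7
    r_i, plus a multiple of B ([cone_sum_bound]). The slab energies tend to 0, so by Fatou's lemma
    the lower limit of the costs vanishes for almost every x ([cone_liminf_null]). On almost every
    vertical line the oscillation of u is then bounded by the integral of g along the line, even
    across the wall ([ug_fiber]). Joining points by a horizontal segment and a vertical one gives an
    estimate of the mean oscillation by the integral of g ([deviation_integral]), and the
    superlinear growth of Psi, in place of Jensen's inequality, turns it into the Orlicz inequality
    ([slit_poincare]).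

    With lam - eps the inequality fails for a function that is 0 below the wall and 1 above it away
    from the holes, with upper gradient 1/e_i on the balls of radius 2 e_i around the centres of
    level i ([step_upper_gradient]). The net of level i keeps a distance r_i from the origin, and
    r_K is much smaller than r_i for i < K; so near the origin at scale r_K only the levels i >= K
    contribute, and the mean energy is at most D 2^(-K eps/2) / r_K ([step_average_energy]). The
    oscillation at that scale stays at least 1/4 ([step_deviation]), whereas for large K the
    right-hand side of the inequality is at most 1/8 ([slit_no_poincare]). *)

(** * Growth bounds for powers of the logarithm and for Psi *)

Section growth.
Context {R : realType}.
Implicit Types (a h l p t x y : R).

Lemma powR_ge1 x p : 1 <= x -> 0 <= p -> 1 <= x `^ p.
Proof.
move=> x1 p0; have := @ge0_ler_powR _ p p0 1 x.
by rewrite powR1; apply; rewrite ?nnegrE// (le_trans _ x1).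
Qed.

Lemma powR_le1 x p : 0 <= x <= 1 -> 0 <= p -> x `^ p <= 1.
Proof.
move=> /andP[x0 x1] p0; have := @ge0_ler_powR _ p p0 x 1.
by rewrite powR1; apply; rewrite ?nnegrE.
Qed.

Lemma powR_invr x p : 0 < x -> x^-1 `^ p = (x `^ p)^-1.
Proof. by move=> x0; rewrite -powRN -powR_inv1 ?ltW// -powRrM mulN1r. Qed.

Definition lne1D a : R := ln (expR 1 + a).

Lemma lne1D_ge1 a : 0 <= a -> 1 <= lne1D a.
Proof.
move=> a0; rewrite -{1}(expRK 1) /lne1D ler_ln ?posrE ?expR_gt0//.
  by rewrite lerDl.
by rewrite ltr_wpDr// expR_gt0.
Qed.

Lemma lne1D_gt0 a : 0 <= a -> 0 < lne1D a.
Proof. by move=> /lne1D_ge1; exact: lt_le_trans. Qed.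

Lemma le_lne1D a h : 0 <= h -> h <= a -> lne1D h <= lne1D a.
Proof.
move=> h0 ha; have e0 := expR_gt0 (1 : R).
rewrite /lne1D ler_ln ?posrE; first by rewrite lerD2l.
- by rewrite ltr_wpDr.
- by rewrite ltr_wpDr// (le_trans h0).
Qed.

(** With q = a / h >= 1 one has [expR 1 + a] <= q ([expR 1 + h]), so the logarithm increases by at
    most ln q <= q^e / e, which is absorbed because [lne1D h] is at least 1. *)
Lemma lne1D_growth (e : R) : 0 < e -> exists2 C, 1 <= C &
  forall a h, 0 < h -> h <= a -> lne1D a <= C * (a / h) `^ e * lne1D h.
Proof.
move=> e0; exists (1 + e^-1); first by rewrite lerDl invr_ge0 ltW.
move=> a h h0 ha.
have E0 := expR_gt0 (1 : R).
set q := a / h.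
have q1 : 1 <= q by rewrite /q ler_pdivlMr// mul1r.
have q0 : 0 < q by rewrite (lt_le_trans _ q1).
have aE : a = q * h by rewrite /q divfK// gt_eqF.
have L1 : 1 <= lne1D h by exact/lne1D_ge1/ltW.
apply: (@le_trans _ _ (ln q + lne1D h)).
  rewrite /lne1D -lnM ?posrE//; last by rewrite addr_gt0.
  rewrite ler_ln ?posrE; last 2 first.
  - by rewrite addr_gt0// (lt_le_trans h0).
  - by rewrite mulr_gt0// addr_gt0.
  by rewrite mulrDr -aE lerD2r ler_peMl// ltW.
have lnq : ln q <= e^-1 * q `^ e.
  rewrite -ler_pdivrMl ?invr_gt0// invrK -ln_powR.
  by rewrite ltW// ln_sublinear// powR_gt0.
have qe1 : 1 <= q `^ e by rewrite powR_ge1// ltW.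
rewrite mulrDl mul1r mulrDl addrC lerD//.
  by rewrite ler_peMl// ltW// lne1D_gt0// ltW.
apply: (le_trans lnq); rewrite ler_peMr//.
by rewrite mulr_ge0 ?invr_ge0 ?powR_ge0// ltW.
Qed.

Lemma lne1D_powR_growth (e l : R) : 0 < e -> 0 <= l -> exists2 C, 1 <= C &
  forall a h, 0 < h -> h <= a ->
    lne1D a `^ l <= C * (a / h) `^ e * lne1D h `^ l.
Proof.
move=> e0 l0; have [->|l1] := eqVneq l 0.
  exists 1 => // a h h0 ha; rewrite !powRr0 !mul1r mulr1.
  by rewrite powR_ge1// ?(ltW e0)// ler_pdivlMr// mul1r.
have lp : 0 < l by rewrite lt_neqAle eq_sym l1.
have [C C1 H] := @lne1D_growth (e / l) (divr_gt0 e0 lp).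
have C0 : 0 <= C by rewrite (le_trans _ C1).
exists (C `^ l).
  by rewrite powR_ge1.
move=> a h h0 ha.
have -> : (a / h) `^ e = ((a / h) `^ (e / l)) `^ l.
  by rewrite -powRrM divfK// gt_eqF.
have L0 x : 0 < x -> 0 <= lne1D x by move=> x0; rewrite ltW// lne1D_gt0// ltW.
rewrite -!powRM ?mulr_ge0 ?powR_ge0//; last exact: L0.
rewrite ge0_ler_powR// ?nnegrE ?H//.
- by apply: L0; rewrite (lt_le_trans h0).
- by rewrite ?mulr_ge0 ?powR_ge0//; exact: L0.
Qed.

(* Potter's bound for the slowly varying function [lne1D _ `^ l]. *)
Lemma potter (e l : R) : 0 < e -> exists2 c, 0 < c & forall a h, 0 < a -> 0 < h ->
  c * Num.min ((a / h) `^ e) ((a / h) `^ (- e)) * lne1D h `^ l <= lne1D a `^ l.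
Proof.
move=> e0; have [C C1 H] := @lne1D_powR_growth e `|l| e0 (normr_ge0 l).
have C0 : 0 < C by rewrite (lt_le_trans _ C1).
exists C^-1; first by rewrite invr_gt0.
have Ci : C^-1 <= 1 by rewrite invf_le1.
move=> a h a0 h0.
have La : 0 < lne1D a by rewrite lne1D_gt0// ltW.
have Lh : 0 < lne1D h by rewrite lne1D_gt0// ltW.
have ah0 : 0 < a / h by rewrite divr_gt0.
have m0 : 0 <= Num.min ((a / h) `^ e) ((a / h) `^ (- e)).
  by rewrite le_min !powR_ge0.
have m1 : Num.min ((a / h) `^ e) ((a / h) `^ (- e)) <= 1.
  have [ah1|/ltW ah1] := leP (a / h) 1.
    by rewrite ge_min powR_le1 ?orTb ?(ltW ah0) ?ah1 ?(ltW e0).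
  by rewrite ge_min (powRN _ e) invf_le1 ?powR_gt0// powR_ge1 ?orbT// ltW.
have triv : lne1D h `^ l <= lne1D a `^ l ->
    C^-1 * Num.min ((a / h) `^ e) ((a / h) `^ (- e)) * lne1D h `^ l
    <= lne1D a `^ l.
  apply: le_trans; rewrite ler_piMl ?powR_ge0//.
  by rewrite mulr_ile1// invr_ge0 ltW.
have [l0|l0] := leP 0 l.
  have [ah|/ltW ha] := leP h a.
    apply: triv; rewrite ge0_ler_powR// ?nnegrE ?(ltW La) ?(ltW Lh)//.
    by rewrite le_lne1D// ltW.
  have := H h a a0 ha; rewrite ger0_norm// => Hha.
  rewrite -mulrA ler_pdivrMl//.
  apply: (@le_trans _ _ ((a / h) `^ e * lne1D h `^ l)).
    by rewrite ler_wpM2r ?powR_ge0// ge_min lexx.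
  rewrite -[a / h]invf_div powR_invr ?divr_gt0// ler_pdivrMl ?powR_gt0 ?divr_gt0//.
  by rewrite mulrCA mulrA.
have [ah|/ltW ha] := leP h a; last first.
  apply: triv; rewrite -[l]opprK !(powRN _ (- l)) lef_pV2 ?posrE ?powR_gt0//.
  rewrite ge0_ler_powR// ?nnegrE ?(ltW La) ?(ltW Lh)//; first lra.
  by rewrite le_lne1D// ltW.
have := H a h h0 ah; rewrite ltr0_norm// => Hha.
rewrite -mulrA ler_pdivrMl//.
apply: (@le_trans _ _ ((a / h) `^ (- e) * lne1D h `^ l)).
  by rewrite ler_wpM2r ?powR_ge0// ge_min lexx orbT.
rewrite (powRN _ e) -[l]opprK !(powRN _ (- l)).
have P0 := powR_gt0 e ah0; have Q0 := powR_gt0 (- l) Lh.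
have S0 := powR_gt0 (- l) La.
rewrite -invfM -ler_pdivrMr ?invr_gt0// invrK mulrC ler_pdivrMr ?mulr_gt0//.
by rewrite mulrA.
Qed.

End growth.

Section psi_growth.
Context {R : realType}.
Implicit Types (a h l p t x y d e : R).

Lemma Psi_ge0 p l a : 0 <= Psi p l a.
Proof. by rewrite mulr_ge0 ?powR_ge0. Qed.

Lemma Psi_gt0 p l a : 0 < a -> 0 < Psi p l a.
Proof. by move=> a0; rewrite mulr_gt0 ?powR_gt0// lne1D_gt0// ltW. Qed.

Lemma Psi0 p l : p != 0 -> Psi p l 0 = 0.
Proof. by move=> p0; rewrite /Psi powR0// mul0r. Qed.

Lemma Psi_potter p l e : 0 < e -> exists2 c, 0 < c & forall a h, 0 < a -> 0 < h ->
  c * Num.min ((a / h) `^ e) ((a / h) `^ (- e)) * (a / h) `^ p * Psi p l h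
  <= Psi p l a.
Proof.
move=> e0; have [c c0 H] := @potter R e l e0.
exists c => // a h a0 h0; have := H a h a0 h0.
rewrite /Psi -/(lne1D a) -/(lne1D h) => H1.
have -> : a `^ p = (a / h) `^ p * h `^ p.
  by rewrite -powRM ?divfK ?gt_eqF ?divr_ge0// ltW.
have Q0 : 0 <= (a / h) `^ p * h `^ p by rewrite mulr_ge0 ?powR_ge0.
move: (ler_wpM2l Q0 H1) => {}H1.
by apply: le_trans (le_trans H1 _); rewrite le_eqVlt; apply/orP; left; apply/eqP; ring.
Qed.

Lemma Psi_ge_powR p l e : 0 < e -> exists2 c, 0 < c & forall a h, 0 < h -> h <= a ->
  c * (a / h) `^ (p - e) * Psi p l h <= Psi p l a.
Proof.
move=> e0; have [c c0 H] := Psi_potter p l e0.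
exists c => // a h h0 ha; have a0 := lt_le_trans h0 ha.
have ah1 : 1 <= a / h by rewrite ler_pdivlMr// mul1r.
apply: le_trans (H a h a0 h0).
rewrite ler_wpM2r ?Psi_ge0// -mulrA ler_wpM2l ?(ltW c0)//.
rewrite addrC powRD; last by rewrite [_ == 0 :> R in X in _ ==> X]gt_eqF ?implybT// (lt_le_trans _ ah1).
rewrite ler_wpM2r ?powR_ge0// le_min lexx andbT ler_powR//.
by rewrite ge0_cp// ltW.
Qed.

(** [Psi_potter] only bounds from below; exchanging its two arguments gives this upper bound. *)
Lemma Psi_le_powR p l e : 0 < e -> exists2 C, 0 < C & forall a h, 0 < h -> h <= a ->
  Psi p l a <= C * (a / h) `^ (p + e) * Psi p l h.
Proof.
move=> e0; have [c c0 H] := Psi_potter p l e0.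
exists c^-1; first by rewrite invr_gt0.
move=> a h h0 ha; have a0 := lt_le_trans h0 ha.
have ah1 : 1 <= a / h by rewrite ler_pdivlMr// mul1r.
have ah0 : 0 < a / h by exact: lt_le_trans ah1.
have inv x : (h / a) `^ x = (a / h) `^ (- x).
  by rewrite -[h / a]invf_div powR_invr// powRN.
have := H h a h0 a0.
rewrite !inv opprK min_l; last by rewrite ler_powR// ge0_cp// ltW.
rewrite !powRN => H1.
rewrite powRD ?(gt_eqF ah0) ?implybT// -!mulrA ler_pdivlMl//.
have P0 := powR_gt0 p ah0; have E0 := powR_gt0 e ah0.
rewrite mulrA -ler_pdivrMl ?mulr_gt0//; apply: le_trans H1.
by rewrite le_eqVlt; apply/orP; left; apply/eqP; field; rewrite !gt_eqF.
Qed.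

Lemma powR_large e K : 0 < e -> exists2 a0, 1 <= a0 & forall a, a0 <= a -> K <= a `^ e.
Proof.
move=> e0; exists (Num.max 1 (Num.max 0 K `^ e^-1)); first by rewrite le_max lexx.
move=> a; rewrite ge_max => /andP[a1 aK].
have a0 : 0 <= a by exact: le_trans a1.
apply: (@le_trans _ _ (Num.max 0 K)); first by rewrite le_max lexx orbT.
rewrite -[leLHS]powRr1 ?le_max ?lexx//.
rewrite -(@mulVf _ e) ?gt_eqF// powRrM ge0_ler_powR ?nnegrE ?powR_ge0//.
exact: ltW.
Qed.

(* Replaces Jensen's inequality, [Psi p l] being only comparable to a convex function. *)
Lemma Psi_linear_bound p l : 1 < p -> exists2 C, 0 < C & forall a s, 0 <= a -> 0 < s ->
  a <= s + C * s * (Psi p l a / Psi p l s).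
Proof.
move=> p1; have e0 : 0 < p - 1 by lra.
have [c c0 H] := Psi_ge_powR p l e0.
exists c^-1; first by rewrite invr_gt0.
move=> a s a0 s0; have [sa|/ltW as_] := leP s a; last first.
  by rewrite ler_wpDr// mulr_ge0 ?divr_ge0 ?Psi_ge0 ?mulr_ge0 ?invr_ge0// ltW.
rewrite ler_wpDl ?(ltW s0)//.
have := H a s s0 sa; rewrite opprB addrCA subrr addr0 powRr1 ?divr_ge0 ?(ltW s0)// => H1.
rewrite mulrA ler_pdivlMr ?Psi_gt0// -mulrA ler_pdivlMl//.
rewrite -ler_pdivrMl//; apply: le_trans H1.
rewrite le_eqVlt; apply/orP; left; apply/eqP; field.
by rewrite gt_eqF.
Qed.

Lemma Psi_superlinear p l K : 1 < p -> exists2 a0, 0 < a0 & forall a, a0 <= a ->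
  K * a < Psi p l a.
Proof.
move=> p1; pose e := (p - 1) / 2; have e0 : 0 < e by rewrite /e; lra.
have [c c0 H] := Psi_ge_powR p l e0.
have P1 := @Psi_gt0 p l 1 ltr01.
have [a0 a01 Ha] := @powR_large e ((K + 1) / (c * Psi p l 1)) e0.
exists a0; first exact: lt_le_trans a01.
move=> a a0a; have a1 := le_trans a01 a0a; have ap : 0 < a by exact: lt_le_trans a1.
apply: (@lt_le_trans _ _ ((K + 1) * a)); first by rewrite ltr_pM2r// ltrDl.
apply: le_trans (H a 1 ltr01 a1); rewrite divr1.
have -> : p - e = 1 + e by rewrite /e; field.
rewrite powRD; last by rewrite (gt_eqF ap) implybT.
rewrite powRr1 ?(ltW ap)//.
rewrite (_ : c * _ * _ = (c * Psi p l 1 * a `^ e) * a); last ring.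
rewrite ler_wpM2r ?(ltW ap)//.
by have := Ha a a0a; rewrite ler_pdivrMr ?(mulr_gt0 c0 P1)// (mulrC (a `^ e)).
Qed.

(** Young's inequality on a cone of level (e, r). There v e is max(|t|, e/2) at height t, so (v e /
    r)^d is the Jacobian of the cone up to a constant, and the last term has an integral in t of
    order B because b > 1. The gain is that B may be arbitrarily small, while A depends on B but not
    on e and r. *)
Lemma Psi_young (d : nat) p l : 1 < p -> p < d.+1%:R ->
  exists2 b, 1 < b & forall B, 0 < B <= 1 -> exists2 A, 0 < A &
  forall e r, 0 < e -> 0 < r -> r ^+ d = e ^+ d.+1 * Psi p l e^-1 ->
  forall v a, 2^-1 <= v -> 0 <= a ->
  a <= A * (v * e / r) ^+ d * Psi p l a + B / e * v `^ (- b).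
Proof.
move=> p1 pd; rewrite -natr1 in pd.
pose h := Num.min ((p - 1) / 2) ((d%:R + 1 - p) / 2).
have h0 : 0 < h by rewrite lt_min; apply/andP; split; lra.
have h1 : h <= (p - 1) / 2 by rewrite ge_min lexx.
have h2 : h <= (d%:R + 1 - p) / 2 by rewrite ge_min lexx orbT.
have q0 : 0 < p - 1 + h by lra.
have [c c0 H] := Psi_potter p l h0.
(* The exponent makes v^(-b) to the power p - 1 + h equal to v^(-d), the inverse of the factor v^d;
   it exceeds 1 because p - 1 + h < d. *)
exists (d%:R / (p - 1 + h)); first by rewrite ltr_pdivlMr// mul1r; lra.
set b := d%:R / _.
move=> B /andP[B0 B1].
have K0 : 0 < 2^-1 ^+ d * B `^ (p - 1 + h) * c :> R.
  by rewrite !mulr_gt0 ?powR_gt0// exprn_gt0.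
exists (2^-1 ^+ d * B `^ (p - 1 + h) * c)^-1; first by rewrite invr_gt0.
move=> e r e0 r0 re v a v2 a0.
have v0 : 0 < v by lra.
have [aB|aB] := leP a (B / e * v `^ (- b)).
  rewrite ler_wpDl// mulr_ge0 ?Psi_ge0// mulr_ge0 ?invr_ge0 ?(ltW K0)//.
  by rewrite exprn_ge0// divr_ge0 ?mulr_ge0// ltW.
have Bv0 : 0 < B * v `^ (- b) by rewrite mulr_gt0 ?powR_gt0.
have Bve : 0 < B / e * v `^ (- b) by rewrite mulrAC divr_gt0.
have {}a0 : 0 < a by exact: lt_trans aB.
have ei : 0 < e^-1 by rewrite invr_gt0.
apply: ler_wpDr; first exact: ltW.
have := H a e^-1 a0 ei; rewrite invrK.
set y := a * e => Hy.
have y0 : 0 < y by rewrite mulr_gt0.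
have By : B * v `^ (- b) < y by move: aB; rewrite mulrAC ltr_pdivrMr.
have P0 := @Psi_gt0 p l _ ei.
have BP1 : B `^ (p - 1 + h) <= 1 by rewrite powR_le1 ?(ltW B0) ?B1 ?ltW.
have vd : 2^-1 ^+ d <= v ^+ d by rewrite lerXn2r ?nnegrE ?invr_ge0 ?(ltW v0)//.
have i2d : 2^-1 ^+ d <= 1 :> R by rewrite exprn_ile1//; lra.
(* In the remaining case y = a e exceeds B v^(-b). For y <= 1 the powers of v cancel; for y >= 1 the
   power of y is at least 1 and v^d >= 2^(-d). *)
have key : 2^-1 ^+ d * B `^ (p - 1 + h) <=
    v ^+ d * (Num.min (y `^ h) (y `^ (- h)) * y `^ (p - 1)).
  have [y1|/ltW y1] := leP y 1.
    rewrite min_l; last first.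
      apply: (@le_trans _ _ 1); first by rewrite powR_le1 ?(ltW y0)// ltW.
      by rewrite powRN invf_ge1 ?powR_gt0// powR_le1 ?(ltW y0)// ltW.
    rewrite -powRD; last by rewrite (gt_eqF y0) implybT.
    apply: (@le_trans _ _ (B `^ (p - 1 + h))).
      by rewrite ler_piMl// powR_ge0.
    rewrite (addrC h).
    apply: (@le_trans _ _ (v ^+ d * (B * v `^ (- b)) `^ (p - 1 + h))); last first.
      by rewrite ler_wpM2l ?exprn_ge0 ?(ltW v0)// ge0_ler_powR ?nnegrE ?ltW.
    rewrite powRM ?powR_ge0 ?(ltW B0)// -powRrM mulNr divfK ?gt_eqF//.
    by rewrite powRN powR_mulrn ?(ltW v0)// mulrCA divff ?mulr1 ?gt_eqF ?exprn_gt0.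
  rewrite min_r; last first.
    apply: (@le_trans _ _ 1); last by rewrite powR_ge1// ltW.
    by rewrite powRN invf_le1 ?powR_gt0// powR_ge1// ltW.
  rewrite -powRD; last by rewrite (gt_eqF y0) implybT.
  apply: (@le_trans _ _ (v ^+ d)); last first.
    by rewrite ler_peMr ?exprn_ge0 ?(ltW v0)// powR_ge1//; lra.
  apply: le_trans vd; rewrite ler_piMr// exprn_ge0//; lra.
have rE : (v * e / r) ^+ d = v ^+ d * (e * Psi p l e^-1)^-1.
  rewrite !exprMn exprVn re exprSr.
  field; rewrite ?gt_eqF ?exprn_gt0//.
have step : c * Num.min (y `^ h) (y `^ (- h)) * y `^ p * Psi p l e^-1 *
    ((v * e / r) ^+ d) <= (v * e / r) ^+ d * Psi p l a.
  by rewrite mulrC ler_wpM2l// exprn_ge0// divr_ge0 ?mulr_ge0 ?(ltW v0) ?(ltW e0) ?(ltW r0).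
rewrite -mulrA ler_pdivlMl//.
apply: le_trans step; rewrite rE.
have yp : y `^ p = y * y `^ (p - 1) by rewrite mulr_powRB1 ?(ltW y0)//; lra.
rewrite yp.
have -> : c * Num.min (y `^ h) (y `^ (- h)) * (y * y `^ (p - 1)) * Psi p l e^-1 *
    (v ^+ d * (e * Psi p l e^-1)^-1) =
    (v ^+ d * (Num.min (y `^ h) (y `^ (- h)) * y `^ (p - 1))) * (c * a).
  rewrite /y; field; rewrite ?gt_eqF//.
by rewrite -[leLHS]mulrA ler_wpM2r// mulr_ge0 ?ltW.
Qed.

(** Put e = 1/a with a large and solve the equation for r. Then r tends to 0 because p < d + 1, and
    (r/e)^d = Psi(a)/a tends to infinity because p > 1; the spare exponents [h1] and [h2] absorb the
    logarithm. *)
Lemma Psi_levels (d : nat) p l (rho N : R) : (0 < d)%N -> 1 < p -> p < d.+1%:R ->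
  0 < rho -> exists e r, [/\ 0 < e, 0 < r, r ^+ d = e ^+ d.+1 * Psi p l e^-1,
    N <= lne1D e^-1 & r <= rho /\ 8 * e <= r].
Proof.
move=> d0 p1 pd rho0; rewrite -natr1 in pd.
pose h1 := (d%:R + 1 - p) / 2; have h10 : 0 < h1 by rewrite /h1; lra.
pose h2 := (p - 1) / 2; have h20 : 0 < h2 by rewrite /h2; lra.
have [C C0 HC] := Psi_le_powR p l h10.
have [c c0 Hc] := Psi_ge_powR p l h20.
have P1 := @Psi_gt0 p l 1 ltr01.
have [a1 a11 H1] := @powR_large h1 (C * Psi p l 1 / rho ^+ d) h10.
have [a2 a21 H2] := @powR_large h2 (8 ^+ d / (c * Psi p l 1)) h20.
pose a := Num.max (Num.max a1 a2) (expR N).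
have aa1 : a1 <= a by rewrite /a !le_max lexx.
have aa2 : a2 <= a by rewrite /a !le_max lexx orbT.
have aN : expR N <= a by rewrite /a le_max lexx orbT.
have a_ge1 : 1 <= a := le_trans a11 aa1.
have a0 : 0 < a := lt_le_trans ltr01 a_ge1.
have Pa := Psi_gt0 p l a0.
have rd0 : 0 < a^-1 ^+ d.+1 * Psi p l a by rewrite mulr_gt0// exprn_gt0// invr_gt0.
pose r := (a^-1 ^+ d.+1 * Psi p l a) `^ (d%:R^-1).
have r0 : 0 < r by rewrite powR_gt0.
have rE : r ^+ d = a^-1 ^+ d.+1 * Psi p l a.
  by rewrite /r -powR_mulrn ?powR_ge0// -powRrM mulVf ?pnatr_eq0 -?lt0n// powRr1 ?ltW.
have aXn : a ^+ d.+1 = a `^ (d%:R + 1) by rewrite natr1 powR_mulrn// ltW.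
exists a^-1, r; split => //.
- by rewrite invr_gt0.
- by rewrite invrK.
- rewrite invrK -[leLHS]expRK /lne1D ler_ln ?posrE ?expR_gt0//; last first.
    by rewrite addr_gt0// expR_gt0.
  by rewrite (le_trans aN)// lerDr expR_ge0.
split.
- rewrite -(@ler_pXn2r _ d) ?nnegrE ?(ltW r0) ?(ltW rho0)// rE exprVn ler_pdivrMl ?exprn_gt0//.
  apply: le_trans (HC a 1 ltr01 a_ge1) _; rewrite divr1.
  have := H1 a aa1; rewrite ler_pdivrMr ?exprn_gt0// => H1'.
  rewrite aXn (_ : d%:R + 1 = h1 + (p + h1)); last by rewrite /h1; field.
  rewrite (@powRD _ a h1 (p + h1)) ?(gt_eqF a0) ?implybT//.
  rewrite (_ : C * _ * _ = C * Psi p l 1 * a `^ (p + h1)); last ring.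
  by rewrite [leRHS]mulrAC ler_wpM2r ?powR_ge0.
- rewrite -(@ler_pXn2r _ d) ?nnegrE ?mulr_ge0 ?invr_ge0 ?(ltW r0) ?(ltW a0)//.
  rewrite rE exprMn exprSr mulrC -mulrA.
  rewrite ler_wpM2l ?exprn_ge0 ?invr_ge0 ?(ltW a0)//.
  rewrite ler_pdivlMl//.
  apply: le_trans (Hc a 1 ltr01 a_ge1); rewrite divr1.
  have := H2 a aa2; rewrite ler_pdivrMr ?(mulr_gt0 c0 P1)// => H2'.
  rewrite (_ : p - h2 = 1 + h2); last by rewrite /h2; field.
  rewrite powRD ?(gt_eqF a0) ?implybT// powRr1 ?(ltW a0)//.
  rewrite (_ : c * _ * _ = a `^ h2 * (c * Psi p l 1) * a); last ring.
  by rewrite mulrC ler_wpM2r// ltW.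
Qed.

End psi_growth.
Local Open Scope ereal_scope.

(** * Open sets are Caratheodory measurable for the Hausdorff outer measure *)

Section metric_outer.
Context {R : realType} (X : pmetricType R) (n : nat).
Implicit Types (A B U : set X).
Local Notation H := (@hausdorff R X n).

Lemma hausdorff_pre_ge0 (e : R) A : 0 <= hausdorff_pre n e A.
Proof.
apply: le_ereal_inf_tmp => _ [U _ <-].
by apply: nneseries_ge0 => k _ _; exact: gauge_ge0.
Qed.

Lemma hausdorff_pre_anti (d e : R) A : (d <= e)%R ->
  hausdorff_pre n e A <= hausdorff_pre n d A.
Proof.
move=> de; apply: le_ereal_inf_tmp => _ [U [Ud AU] <-].
apply: ereal_inf_lbound; exists U => //; split => // k.
by rewrite (le_trans (Ud k))// lee_fin.
Qed.

Lemma diam_mdist A x y : A x -> A y -> (mdist x y)%:E <= diam A.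
Proof.
move=> Ax Ay; rewrite /diam le_max; apply/orP; right.
by apply: ereal_sup_ubound; exists (x, y).
Qed.

Lemma diam_le A (e : R) : (0 <= e)%R -> (forall x y, A x -> A y -> (mdist x y <= e)%R) ->
  diam A <= e%:E.
Proof.
move=> e0 Ae; rewrite /diam ge_max lee_fin e0 /=.
by apply: ge_ereal_sup => _ [[x y] [/= Ax Ay] <-]; rewrite lee_fin Ae.
Qed.

Lemma gauge_set0 : gauge n (set0 : set X) = 0.
Proof. by rewrite /gauge eqxx. Qed.

(** A covering set of diameter at most e cannot meet both A and B, so each cover of the union splits
    into a cover of A and one of B; discarded sets become [set0], whose gauge is 0. *)
Lemma hausdorff_pre_separated (e : R) A B : (0 < e)%R ->
  (forall x y, A x -> B y -> (e < mdist x y)%R) ->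
  hausdorff_pre n e A + hausdorff_pre n e B <= hausdorff_pre n e (A `|` B).
Proof.
move=> e0 AB; apply: le_ereal_inf_tmp => _ [U [Ue ABU] <-].
pose r A k := if `[< U k `&` A !=set0 >] then U k else set0.
have rP C : C `<=` \bigcup_k U k -> hausdorff_pre n e C <= \sum_(k <oo) gauge n (r C k).
  move=> CU; apply: ereal_inf_lbound; exists (r C) => //; split.
    by move=> k; rewrite /r; case: ifPn => // _; rewrite diam0 lee_fin ltW.
  move=> x Cx; have [k _ Ukx] := CU x Cx; exists k => //; rewrite /r.
  by case: asboolP => // -[]; exists x.
apply: (@le_trans _ _ (\sum_(k <oo) gauge n (r A k) + \sum_(k <oo) gauge n (r B k))).
  by apply: leeD; apply: rP => x ?; apply: ABU; [left|right].
rewrite -nneseriesD; try by move=> *; exact: gauge_ge0.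
apply: lee_nneseries => k _; first by move=> _; rewrite adde_ge0 ?gauge_ge0.
rewrite /r; case: asboolP => [[x [Ux Ax]]|nA]; case: asboolP => [[y [Uy By]]|nB].
- exfalso; have := le_trans (diam_mdist Ux Uy) (Ue k).
  by rewrite lee_fin leNgt AB.
- by rewrite gauge_set0 adde0.
- by rewrite gauge_set0 add0e.
- by rewrite gauge_set0 add0e gauge_ge0.
Qed.

Lemma hausdorff_separated (e : R) A B : (0 < e)%R ->
  (forall x y, A x -> B y -> (e <= mdist x y)%R) -> H A + H B <= H (A `|` B).
Proof.
move=> e0 AB; have [->|] := eqVneq (H (A `|` B)) +oo; first exact: leey.
rewrite -ltey => fin.
have finW C : C `<=` A `|` B -> H C \is a fin_num.
  move=> CAB; rewrite ge0_fin_numE ?hausdorff_ge0//.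
  exact: le_lt_trans (le_hausdorff _ CAB) fin.
have finA := finW A (@subsetUl _ _ _); have finB := finW B (@subsetUr _ _ _).
have key (a b : R) : (0 < a)%R -> (0 < b)%R ->
    hausdorff_pre n a A + hausdorff_pre n b B <= H (A `|` B).
  (* One scale finer than both a and b serves both sides; [e / 2] turns the weak separation by e
     into the strict one required at scale c. *)
  move=> a0 b0; pose c := Num.min (Num.min a b) (e / 2)%R.
  have c0 : (0 < c)%R by rewrite !lt_min a0 b0 divr_gt0.
  apply: (@le_trans _ _ (hausdorff_pre n c (A `|` B))); last first.
    by apply: ereal_sup_ubound; exists c.
  apply: (le_trans _ (hausdorff_pre_separated c0 _)).
    by apply: leeD; apply: hausdorff_pre_anti; rewrite !ge_min lexx ?orbT.
  move=> x y Ax By; apply: (lt_le_trans _ (AB x y Ax By)).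
  rewrite gt_min; apply/orP; right.
  by rewrite ltr_pdivrMr// ltr_pMr// ltr1n.
rewrite -leeBrDr//; apply: ge_ereal_sup => _ [a /= a0 <-].
rewrite leeBrDr// addeC -leeBrDr; last first.
  rewrite ge0_fin_numE ?hausdorff_pre_ge0//.
  apply: (@le_lt_trans _ _ (H A)); first by apply: ereal_sup_ubound; exists a.
  by rewrite -ge0_fin_numE// hausdorff_ge0.
apply: ge_ereal_sup => _ [b /= b0 <-].
rewrite leeBrDr; first by rewrite addeC key.
rewrite ge0_fin_numE ?hausdorff_pre_ge0//.
apply: (@le_lt_trans _ _ (H A)); first by apply: ereal_sup_ubound; exists a.
by rewrite -ge0_fin_numE// hausdorff_ge0.
Qed.

(* Caratheodory's criterion: rings around [~` U] with every other one removed
   are at positive distance from each other, so their measures are summable. *)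
Lemma open_caratheodory U : open U -> (hausdorff_outer X n).-caratheodory U.
Proof.
move=> oU; apply: le_caratheodory_measurable => A.
change (H (A `&` U) + H (A `&` ~` U) <= H A).
have [->|] := eqVneq (H A) +oo; first exact: leey.
rewrite -ltey => finA.
pose P k : set X := A `&` [set x | ball x k.+1%:R^-1%R `<=` U].
have PS k : P k `<=` P k.+1.
  move=> x [Ax bU]; split => //; apply: subset_trans bU; apply: le_ball.
  by rewrite lef_pV2 ?posrE// ler_nat.
have Pmono j k : (j <= k)%N -> P j `<=` P k.
  elim: k => [|k ih]; first by rewrite leqn0 => /eqP ->.
  rewrite leq_eqVlt => /orP[/eqP -> //|]; rewrite ltnS => /ih.
  by move=> /subset_trans; apply.
have sep k x y : P k x -> ~ P k.+1 y -> A y ->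
    (k.+1%:R^-1 - k.+2%:R^-1 <= mdist x y)%R.
  move=> [Ax xU] Py Ay; rewrite leNgt; apply/negP => xy; apply: Py; split => // z.
  rewrite ballEmdist/= => yz; apply: xU; rewrite ballEmdist/=.
  by rewrite (le_lt_trans (metric_triangle _ y _))// -(subrK k.+2%:R^-1%R k.+1%:R^-1%R) ltrD.
have gap0 k : (0 < k.+1%:R^-1 - k.+2%:R^-1 :> R)%R.
  by rewrite subr_gt0 ltf_pV2 ?posrE// ltr_nat.
have PU k : P k `<=` A `&` U.
  by move=> x [Ax bU]; split => //; apply: bU; exact: ballxx.
have UP x : A x -> U x -> exists k, P k x.
  move=> Ax Ux; have /nbhs_ballP[e /= e0 eU] : nbhs x U by exact: open_nbhs_nbhs.
  have [k ke] := ltr_add_invr (@e0 : 0 < e)%R.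
  exists k; split => //; apply: subset_trans eU; apply: le_ball.
  by rewrite add0r in ke; exact: ltW.
pose D k := P k.+1 `\` P k.
have sumD i N : \sum_(j < N) H (D (i + j.*2).+1) <= H (P (i + N.*2)%N).
  elim: N => [|N ih]; first by rewrite big_ord0 hausdorff_ge0.
  rewrite big_ord_recr/= (le_trans (leeD2r _ ih))//.
  apply: (le_trans (hausdorff_separated (gap0 (i + N.*2)%N) _)).
    move=> x y Px [Py nPy]; apply: sep => //; by have [] := Py.
  apply: le_hausdorff => x [|[+ _]].
    by apply: Pmono; rewrite leq_add2l doubleS ltnW.
  by rewrite doubleS !addnS.
have PA k : H (P k) <= H A by apply: le_hausdorff => x [].
(* Splitting the rings by parity bounds the full sum, so its tails vanish; these tails are the error
   made when [A]&[U] is replaced by [P k.+1]. *)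
have sumDA N : \sum_(k < N.*2) H (D k.+1) <= H A + H A.
  have -> : \sum_(k < N.*2) H (D k.+1) =
      \sum_(j < N) H (D (0 + j.*2).+1) + \sum_(j < N) H (D (1 + j.*2).+1).
    elim: N => [|N ih]; first by rewrite !big_ord0 adde0.
    rewrite doubleS !big_ord_recr/= ih -!addeA; congr (_ + _).
    by rewrite addeCA.
  by apply: leeD; apply: (le_trans (sumD _ _)); exact: PA.
have sumD_fin : \sum_(k <oo) H (D k.+1) < +oo.
  apply: (@le_lt_trans _ _ (H A + H A)); last by rewrite lte_add_pinfty.
  apply: lime_le; first by apply: is_cvg_nneseries => k _ _; exact: hausdorff_ge0.
  apply: nearW => N; rewrite big_mkord (le_trans _ (sumDA N))//.
  rewrite -(big_mkord xpredT (fun k => H (D k.+1))).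
  rewrite -(big_mkord xpredT (fun k => H (D k.+1))).
  by apply: lee_sum_nneg_natr => [k _ _|]; [exact: hausdorff_ge0|rewrite -addnn leq_addr].
have tail0 := nneseries_tail_cvg sumD_fin (fun k _ => hausdorff_ge0 n (D k.+1)).
have AUP k : A `&` U `<=` P k.+1 `|` \bigcup_(j in ~` `I_k) D j.+1.
  move=> x [Ax Ux]; have [m Pm] := UP x Ax Ux.
  have [|nPk] := pselect (P k.+1 x); [by left|right].
  have /= := @ex_minnP (fun j => `[< P j x >]) _.
  case; first by exists m; apply/asboolP.
  move=> j /asboolP Pj jmin.
  have kj : (k.+1 < j)%N by rewrite ltnNge; apply/negP => /Pmono /(_ x Pj).
  case: j kj Pj jmin => [//|[//|j]] kj Pj jmin; exists j => /=; first by apply/negP; rewrite -leqNgt.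
  split => // Pj1; have /jmin : `[< P j.+1 x >] by apply/asboolP.
  by rewrite ltnn.
have main k : H (A `&` U) + H (A `&` ~` U) <= H A + \sum_(k <= j <oo) H (D j.+1).
  apply: (@le_trans _ _ (H (P k.+1) + \sum_(k <= j <oo) H (D j.+1) + H (A `&` ~` U))).
    apply: leeD2r; apply: (le_trans (le_hausdorff _ (AUP k))).
    apply: (le_trans (outer_measureU2 (hausdorff_outer X n) _ _)); apply: leeD2l.
    exact: outer_measure_sigma_subadditive_tail.
  rewrite addeAC leeD2r//.
  have e0 : (0 < k.+2%:R^-1 :> R)%R by rewrite invr_gt0.
  apply: (le_trans (hausdorff_separated e0 _)).
    move=> x y [Ax bU] [Ay Uy]; rewrite leNgt; apply/negP => xy.
    by apply: Uy; apply: bU; rewrite ballEmdist.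
  by apply: le_hausdorff => x [[]|[]].
have := @cvgeD _ _ _ _ (fun=> H A) (fun k => \sum_(k <= j <oo) H (D j.+1)) (H A) 0.
rewrite fin_num_adde_defl// => /(_ _ _ isT (cvg_cst _) tail0); rewrite adde0 => hcv.
rewrite -(cvg_lim _ hcv)//; apply: lime_ge; first by apply/cvg_ex; exists (H A).
by apply: nearW => k; exact: main.
Qed.

End metric_outer.

Local Close Scope ereal_scope.

Notation borel V := (g_sigma_algebraType (@open V)).

(** * Borel sets of products of separable normed spaces *)

Section borel_product.
Context {R : realType}.

Definition dense_seq (V : normedModType R) (q : nat -> V) :=
  forall x (e : R), 0 < e -> exists k, `|x - q k| < e.

Lemma dense_seqR : exists q : nat -> R, dense_seq q.
Proof.
exists (fun k => if unpickle k is Some r then ratr (r : rat) else 0) => x e e0.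
have /rat_in_itvoo[r] : x - e < x + e by rewrite ltrBlDr -addrA ltrDl addr_gt0.
rewrite in_itv/= => /andP[r1 r2]; exists (pickle r); rewrite pickleK.
by rewrite distrC ltr_distl r1 r2.
Qed.

Lemma dense_seq_prod (V U : normedModType R) (q : nat -> V) (q' : nat -> U) :
  dense_seq q -> dense_seq q' -> exists q2 : nat -> (V * U)%type, dense_seq q2.
Proof.
move=> dq dq'.
exists (fun k => if unpickle k is Some (i, j) then (q i, q' j) else 0).
move=> [x y] e e0; have [i xi] := dq x e e0; have [j yj] := dq' y e e0.
by exists (pickle (i, j)); rewrite pickleK prod_normE gt_max xi yj.
Qed.

Lemma borel_open (V : normedModType R) (A : set (borel V)) :
  open (A : set V) -> measurable A.
Proof. by move=> oA; apply: sub_sigma_algebra. Qed.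

Lemma measurable_fun_borel d (T : measurableType d) (V : normedModType R)
    (f : T -> borel V) :
  (forall A : set V, open A -> measurable (f @^-1` A)) -> measurable_fun setT f.
Proof.
move=> H; apply: (@measurability _ _ T (borel V) setT f (@open V)) => //.
by move=> _ [A oA <-]; rewrite setTI; exact: H.
Qed.

Lemma ball_measurable (V : normedModType R) (x : V) r :
  measurable (ball x r : set (borel V)).
Proof. by apply: borel_open; exact: ball_open. Qed.

(** The union is countable thanks to the dense sequences, so open sets of a product belong to the
    product sigma-algebra. This is what makes Fubini available for Borel functions. *)
Lemma open_prod_rect (V U : normedModType R) (q : nat -> V) (q' : nat -> U)
    (A : set (V * U)) : dense_seq q -> dense_seq q' -> open A ->
  A = \bigcup_(i in [set i : nat * nat * nat |
     ball (q i.1.1) i.2.+1%:R^-1 `*` ball (q' i.1.2) i.2.+1%:R^-1 `<=` A])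
     (ball (q i.1.1) i.2.+1%:R^-1 `*` ball (q' i.1.2) i.2.+1%:R^-1).
Proof.
move=> dq dq' oA; apply/seteqP; split; last by move=> w [i /= iA] /iA.
move=> [x y] Axy; have /nbhs_ballP[e /= e0 eA] : nbhs (x, y) A.
  exact: open_nbhs_nbhs.
have [m me] := ltr_add_invr (divr_gt0 e0 (@ltr0n R 2)); rewrite add0r in me.
have m0 : 0 < m.+1%:R^-1 :> R by rewrite invr_gt0.
have [i xi] := dq x _ m0; have [j yj] := dq' y _ m0.
have ti (W : normedModType R) (a b c : W) : `|a - b| < m.+1%:R^-1 ->
    ball b m.+1%:R^-1 c -> ball a e c.
  rewrite -!ball_normE/= => ab bc.
  rewrite -(subrKA b) (le_lt_trans (ler_normD _ _))// [ltRHS]splitr.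
  by rewrite ltrD// (lt_trans _ me).
exists ((i, j), m) => /=; last by split; rewrite -ball_normE/= distrC.
by move=> [x' y'] [/= bx by_]; apply: eA; split; [exact: ti xi bx|exact: ti yj by_].
Qed.

Lemma open_prod_measurable (V U : normedModType R) (q : nat -> V) (q' : nat -> U)
    (A : set (borel V * borel U)) :
  dense_seq q -> dense_seq q' -> open (A : set (V * U)) -> measurable A.
Proof.
move=> dq dq' oA; rewrite (open_prod_rect dq dq' oA) bigcup_mkcond.
apply: countable_bigcupT_measurable; first exact: countableP.
move=> i; case: ifPn => // _; apply: measurableX; exact: ball_measurable.
Qed.

Lemma open_prodR_measurable (V : normedModType R) (q : nat -> V)
    (A : set (borel V * measurableTypeR R)) :
  dense_seq q -> open (A : set (V * R)) -> measurable A.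
Proof.
have [q' dq'] := dense_seqR.
move=> dq oA; rewrite (open_prod_rect dq dq' oA) bigcup_mkcond.
apply: countable_bigcupT_measurable; first exact: countableP.
move=> i; case: ifPn => // _; apply: measurableX; first exact: ball_measurable.
by apply: open_measurable; exact: ball_open.
Qed.

End borel_product.

(** * Uniqueness of translation-invariant measures *)

Section haar.
Context {R : realType} (V : normedModType R) (q : nat -> V) (dq : dense_seq q).
Local Notation T := (borel V).
Local Notation B01 := (ball (0%R : V) 1%R).

Lemma measurable_fun_lin2 (a b : R) :
  measurable_fun setT (fun z : T * T => (a *: (z.1 : V) + b *: (z.2 : V) : T)).
Proof.
apply: measurable_fun_borel => A oA; apply: (open_prod_measurable dq dq).
apply: (@open_comp (V * V)%type V (fun z => a *: z.1 + b *: z.2)) => // z _.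
by apply: (@cvgD _ _ _ _ _ (fun z : V * V => a *: z.1) (fun z => b *: z.2));
  apply: cvgZ; [exact: cvg_cst|exact: cvg_fst|exact: cvg_cst|exact: cvg_snd].
Qed.

(** The sets [E1] = {x in A, x - y in B01} and [E2] = {x + y in A, x in B01} have y-sections that
    are translates of each other, so they have the same product measure. Computed by x-sections,
    that measure is mu(A) nu(B01) for [E1] and mu(B01) nu(A) for [E2]. *)
Lemma haar_unique (mu nu : {sigma_finite_measure set T -> \bar R}) :
  (forall (a : V) (A : set T), measurable A -> mu ((fun x => (x + a)%R : V) @^-1` A) = mu A) ->
  (forall (a : V) (A : set T), measurable A -> nu ((fun x => (x + a)%R : V) @^-1` A) = nu A) ->
  forall A : set T, measurable A -> (mu A * nu B01 = mu B01 * nu A)%E.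
Proof.
move=> mut nut A mA.
have mB x r : measurable (ball x r : set T).
  exact: ball_measurable.
pose E1 : set (T * T) := [set z | A z.1 /\ B01  ((z.1 : V) - (z.2 : V))].
pose E2 : set (T * T) := [set z | A ((z.1 : V) + (z.2 : V)) /\ B01  z.1].
have mE1 : measurable E1.
  apply: measurableI; first by rewrite -[X in measurable X]setTI; exact: measurable_fst.
  have := measurable_fun_lin2 1 (-1) measurableT (mB 0 1).
  rewrite setTI; congr measurable; apply/seteqP.
  by split=> z /=; rewrite scale1r scaleN1r.
have mE2 : measurable E2.
  apply: measurableI.
    have := measurable_fun_lin2 1 1 measurableT mA.
    rewrite setTI; congr measurable; apply/seteqP.
    by split=> z /=; rewrite !scale1r.
  by rewrite -[X in measurable X]setTI; exact: measurable_fst.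
have swap E : measurable E -> (\int[mu]_x nu (xsection E x) = \int[nu]_y mu (ysection E y))%E.
  move=> mE; transitivity ((mu \x nu) E)%E => //.
  by rewrite (product_measure_unique (m' := (mu \x^ nu)%E))// => B C mB' mC'; exact: product_measure2E.
have ballt (x : V) : nu (ball x 1) = nu B01.
  rewrite -(nut (- x) B01)//; congr (nu _); apply/seteqP.
  by split=> y /=; rewrite -!ball_normE/= sub0r opprB.
have i1 : (\int[mu]_x nu (xsection E1 x) = mu A * nu B01)%E.
  transitivity (\int[mu]_x (nu B01 * (\1_A x)%:E))%E.
    apply: eq_integral => x _; rewrite indicE.
    have [/set_mem Ax|/negP nAx] := boolP (x \in A).
      rewrite mule1 -(ballt x); congr (nu _).
      apply/seteqP; split=> y; rewrite xsectionP /E1/= -!ball_normE/= sub0r normrN.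
        by case.
      by split.
    rewrite mule0 [X in nu X](_ : _ = set0) ?measure0//.
    by apply/seteqP; split=> y //; rewrite xsectionP => -[/= /mem_set].
  rewrite ge0_integralZl ?integral_indic ?setIT 1?muleC//.
  exact: measurableT_comp.
have i2 : (\int[mu]_x nu (xsection E2 x) = mu B01 * nu A)%E.
  transitivity (\int[mu]_x (nu A * (\1_B01 x)%:E))%E.
    apply: eq_integral => x _; rewrite indicE.
    have [/set_mem Bx|/negP nBx] := boolP (x \in _).
      rewrite mule1 -(nut x A mA); congr (nu _).
      apply/seteqP; split=> y; rewrite xsectionP /E2/= addrC//.
      by case.
    rewrite mule0 [X in nu X](_ : _ = set0) ?measure0//.
    by apply/seteqP; split=> y //; rewrite xsectionP => -[/= _ /mem_set].
  rewrite ge0_integralZl ?integral_indic ?setIT 1?muleC//.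
  exact: measurableT_comp.
rewrite -i1 -i2 (swap _ mE1) (swap _ mE2); apply: eq_integral => y _.
have mS : measurable (A `&` ball (y : V) 1 : set T) by exact: measurableI.
transitivity (mu (A `&` ball (y : V) 1)).
  congr (mu _); apply/seteqP; split=> x; rewrite ysectionP /E1/= -!ball_normE/= sub0r normrN distrC.
    by case.
  by case.
rewrite -(mut y _ mS); congr (mu _).
apply/seteqP; split=> x; rewrite ysectionP /E2/= -!ball_normE/= sub0r normrN opprD addrCA subrr addr0 normrN.
  by case.
by case.
Qed.

End haar.

Definition push_measure d d' (T1 : measurableType d) (T2 : measurableType d')
    (R : realFieldType) (mu : {measure set T1 -> \bar R}) (f : T1 -> T2)
    (mf : measurable_fun setT f) : {measure set T2 -> \bar R} :=
  measure_function_pushforward__canonical__measure_function_Measure mu mf.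

Section sigma_finite_bundle.
Context d (T : measurableType d) (R : realType) (mu : {measure set T -> \bar R}).
Hypothesis sf : sigma_finite setT mu.

(** The proof of sigma-finiteness is an argument of the alias, so that the bundled structure can be
    attached to it. *)
Definition sigma_finite_of & sigma_finite setT mu : set T -> \bar R := mu.

HB.instance Definition _ := Measure.on (sigma_finite_of sf).
HB.instance Definition _ := Measure_isSigmaFinite.Build d T R (sigma_finite_of sf) sf.

Lemma sigma_finite_bundle :
  exists nu : {sigma_finite_measure set T -> \bar R}, forall A, nu A = mu A.
Proof. by exists (sigma_finite_of sf). Qed.

End sigma_finite_bundle.

(** * R^d with the sup norm and Lebesgue measure *)

Section box_space.
Context {R : realType}.
Local Notation lam := (@lebesgue_measure R).

(** The features of R^d with the sup norm and Lebesgue measure on which the proof relies. Stated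
    abstractly, they serve both for the wall [V] and for the whole space [V * R], an iterated
    product of lines. *)
Record box_space (d : nat) (V : normedModType R)
    (m : {sigma_finite_measure set (borel V) -> \bar R}) : Prop := BoxSpace {
  box_dense : exists q : nat -> V, dense_seq q;
  box_compact : forall (x : V) (r : R), compact [set y : V | `|x - y| <= r];
  box_volume : forall r : R, 0 < r -> m (ball (0 : V) r) = ((2 * r) ^+ d)%:E;
  box_affine : forall (a : V) (s : R) (A : set (borel V)), 0 < s -> measurable A ->
    m ((fun x : V => a + s *: x) @^-1` A) = ((s^-1 ^+ d)%:E * m A)%E;
  box_unit : exists v : V, `|v| = 1 }.

Lemma lebesgue_affine (a s : R) (A : set (measurableTypeR R)) : 0 < s -> measurable A ->
  lam ((fun x => a + s * x) @^-1` A) = (s^-1%:E * lam A)%E.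
Proof.
move=> s0 mA.
have mf : measurable_fun setT (fun x : measurableTypeR R => a + s * x : measurableTypeR R).
  by apply: measurable_funD => //; apply: measurable_funM.
have E : lam A = (s%:E * lam ((fun x => a + s * x)%R @^-1` A))%E.
  rewrite (@lebesgue_measure_unique _ (mscale (NngNum (ltW s0)) (push_measure lam mf))) => //.
  move=> _ [[x y] _ <-]; rewrite /= /mscale/= /pushforward/=.
  rewrite (_ : _ @^-1` _ = `](x - a) / s, (y - a) / s]%classic); last first.
    apply/seteqP; split=> z /=; rewrite !in_itv/= ltr_pdivrMr// ler_pdivlMr// ltrBlDl lerBrDl mulrC//.
  rewrite !lebesgue_measure_itv/= !lte_fin ltr_pM2r ?invr_gt0// ltrD2r.
  case: ifPn => _; last by rewrite mule0.
  by rewrite -!EFinB -EFinM; congr EFin; field; rewrite gt_eqF.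
by rewrite E muleA -EFinM mulVf ?gt_eqF// mul1e.
Qed.

Lemma box_space_line : exists m : {sigma_finite_measure set (borel R) -> \bar R},
  box_space 1 m.
Proof.
have mid : measurable_fun setT (id : measurableTypeR R -> borel R).
  by apply: measurable_fun_borel => A oA; exact: open_measurable.
have mB (A : set (borel R)) : measurable A -> measurable (A : set (measurableTypeR R)).
  by move=> mA; have := mid measurableT A mA; rewrite setTI.
have ballE (x r : R) : 0 < r -> lam (ball x r) = ((2 * r) ^+ 1)%:E.
  by move=> r0; rewrite lebesgue_measure_ball ?ltW// expr1 mulr_natl.
have sf : sigma_finite setT (push_measure lam mid).
  exists (fun k => ball (0 : R) k.+1%:R : set (borel R)).
    apply/seteqP; split => // x _; exists (Num.truncn `|x|) => //.
    by rewrite /= -ball_normE/= sub0r normrN truncnS_gt.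
  move=> k; split; first by apply: borel_open; exact: ball_open.
  by have := ltry ((2 * k.+1%:R) ^+ 1 : R)%R; rewrite -(ballE 0).
have [m mE] := @sigma_finite_bundle _ _ _ (push_measure lam mid) sf.
exists m; split.
- exact: dense_seqR.
- move=> x r; rewrite (_ : [set _ | _] = `[x - r, x + r]%classic); first exact: segment_compact.
  by apply/seteqP; split=> y /=; rewrite distrC ler_distl in_itv.
- by move=> r r0; rewrite mE; exact: ballE.
- by move=> a s A s0 mA; rewrite !mE expr1; apply: lebesgue_affine => //; exact: mB.
- by exists 1; rewrite normr1.
Qed.

(** The measure [m'] is the product measure read on the Borel sigma-algebra of [V * R]. Keeping the
    equality with the product allows Fubini to be used on [V * R] later. *)
Lemma box_space_step d (V : normedModType R) (m : {sigma_finite_measure set (borel V) -> \bar R}) :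
  box_space d m ->
  exists2 m' : {sigma_finite_measure set (borel (V * R)%type) -> \bar R},
    box_space d.+1 m' & forall A, m' A = (m \x lam)%E A.
Proof.
move=> [[q dq] cpt vol aff [v v1]].
pose T := (borel V * measurableTypeR R)%type.
pose M : {measure set T -> \bar R} := (m \x lam)%E.
have mid : measurable_fun setT (id : T -> borel (V * R)%type).
  by apply: measurable_fun_borel => A oA; exact: (open_prodR_measurable dq).
have mB (A : set (borel (V * R)%type)) : measurable A -> measurable (A : set T).
  by move=> mA; have := mid measurableT A mA; rewrite setTI.
have ballE r : 0 < r -> M (ball (0 : V * R) r) = ((2 * r) ^+ d.+1)%:E.
  move=> r0; transitivity (M (ball (0 : V) r `*` ball (0 : R) r)).
    by congr (M _); apply/seteqP; split=> -[].
  rewrite /M/= product_measure1E//; last 2 first.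
  - exact: ball_measurable.
  - by apply: open_measurable; exact: ball_open.
  transitivity (((2 * r) ^+ d)%:E * (2 * r)%:E)%E; last by rewrite -EFinM exprSr.
  congr (_ * _)%E; first exact: vol.
  by have := @lebesgue_measure_ball R 0 r (ltW r0); rewrite mulr_natl.
have sf : sigma_finite setT (push_measure M mid).
  exists (fun k => ball (0 : V * R) k.+1%:R : set (borel (V * R)%type)).
    apply/seteqP; split => // x _; exists (Num.truncn `|x|) => //.
    by rewrite /= -ball_normE/= sub0r normrN truncnS_gt.
  move=> k; split; first by apply: borel_open; exact: ball_open.
  by have := ltry ((2 * k.+1%:R) ^+ d.+1 : R)%R; rewrite -ballE.
have [m' mE] := @sigma_finite_bundle _ _ _ (push_measure M mid) sf.
exists m' => //; split.
- by have [q' dq'] := @dense_seqR R; exact: dense_seq_prod dq dq'.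
- move=> [x t] r; rewrite (_ : [set _ | _] =
    [set y : V | `|x - y| <= r] `*` `[t - r, t + r]%classic).
    by apply: compact_setX => //; exact: segment_compact.
  apply/seteqP; split=> -[y s] /=; rewrite prod_normE ge_max/= in_itv/= -[t - r <= s <= _]ler_distl (distrC s).
    by move=> /andP.
  by move=> /andP.
- by move=> r r0; rewrite mE; exact: ballE.
- move=> [a t] s A s0 mA; rewrite !mE /pushforward/=.
  pose f : T -> T := fun x => ((a, t) + s *: (x : V * R)) : V * R.
  have mf : measurable_fun setT f.
    apply/measurable_fun_pairP; split.
      rewrite (_ : _ \o _ = (fun x : borel V => (a + s *: (x : V) : borel V)) \o fst)//.
      apply: measurableT_comp => //; apply: measurable_fun_borel => B oB.
      apply: borel_open; apply: (@open_comp V V (fun x => a + s *: x)) => // x _.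
      by apply: (@cvgD _ _ _ _ _ (cst a) (fun x : V => s *: x)); [exact: cvg_cst|apply: cvgZ; [exact: cvg_cst|]].
    rewrite (_ : _ \o _ = fun x : T => t + s * x.2)//.
    by apply: measurable_funD => //; apply: measurable_funM.
  have sd : 0 <= s ^+ d.+1 by rewrite exprn_ge0// ltW.
  have E : (M A = (s ^+ d.+1)%:E * M (f @^-1` A))%E.
    rewrite {1}/M/= (@product_measure_unique _ _ _ _ _ _ _ (mscale (NngNum sd) (push_measure M mf)))//; last exact: mB.
    move=> B C mB' mC; rewrite /mscale/= /pushforward/=.
    pose pB : set (borel V) := (fun x : V => a + s *: x) @^-1` B.
    pose pC : set (measurableTypeR R) := (fun x : R => t + s * x) @^-1` C.
    have fE : f @^-1` (B `*` C) = pB `*` pC by apply/seteqP; split=> -[].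
    have mB2 : measurable pB.
      have : measurable_fun setT (fun x : borel V => (a + s *: (x : V) : borel V)).
        apply: measurable_fun_borel => D oD.
        apply: borel_open; apply: (@open_comp V V (fun x => a + s *: x)) => // x _.
        by apply: (@cvgD _ _ _ _ _ (cst a) (fun x : V => s *: x)); [exact: cvg_cst|apply: cvgZ; [exact: cvg_cst|]].
      by move=> /(_ measurableT B mB'); rewrite setTI.
    have mC2 : measurable pC.
      have : measurable_fun setT (fun x : measurableTypeR R => t + s * x : measurableTypeR R).
        by apply: measurable_funD => //; apply: measurable_funM.
      by move=> /(_ measurableT C mC); rewrite setTI.
    transitivity ((s ^+ d.+1)%:E * M (pB `*` pC))%E; first by rewrite -fE.
    rewrite /M/= product_measure1E//.
    transitivity ((s ^+ d.+1)%:E * (((s^-1 ^+ d)%:E * m B) * (s^-1%:E * lam C)))%E.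
      by congr (_ * (_ * _))%E; [exact: aff|exact: lebesgue_affine].
    transitivity (((s ^+ d.+1) * ((s^-1 ^+ d) * s^-1))%:E * (m B * lam C))%E.
      by rewrite 2!EFinM muleACA !muleA.
    by rewrite -exprSr -exprMn divff ?gt_eqF// expr1n mul1e.
  transitivity (((s^-1 ^+ d.+1) * (s ^+ d.+1))%:E * M (f @^-1` A))%E.
    by rewrite -exprMn mulVf ?gt_eqF// expr1n mul1e.
  by rewrite EFinM -muleA -E.
- by exists (v, 0); rewrite prod_normE v1 normr0 max_l.
Qed.

Lemma box_space_exists d : exists (V : normedModType R)
  (m : {sigma_finite_measure set (borel V) -> \bar R}), box_space d.+1 m.
Proof.
elim: d => [|d [V [m /box_space_step[m' bm' _]]]].
  by have [m bm] := box_space_line; exists R, m.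
by exists (V * R)%type, m'.
Qed.

End box_space.

(** * Separated nets avoiding the origin *)

Section net.
Context {R : realType} (V : normedModType R) (q : nat -> V) (r : R).

(** Greedy selection along the sequence q of points that are r-apart. The extra condition that they
    also stay r away from 0 leaves a region without coarse holes around the origin, where the
    Poincare inequality will be refuted. *)
Fixpoint net_upto (k : nat) : seq nat :=
  if k is j.+1 then
    if (r <= `|q j|) && all (fun i => r <= `|q j - q i|) (net_upto j)
    then j :: net_upto j else net_upto j
  else [::].

Definition net k := (r <= `|q k|) && all (fun i => r <= `|q k - q i|) (net_upto k).

Lemma mem_net_upto j k : (j \in net_upto k) = (j < k)%N && net j.
Proof.
elim: k => [|k ih] //=; rewrite -/(net k); case: ifPn => nk.
  by rewrite inE ih (ltnS j) [(j <= k)%N]leq_eqVlt; case: eqVneq => [->|]//=; rewrite nk.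
rewrite ih (ltnS j) [(j <= k)%N]leq_eqVlt; case: eqVneq => [->|]//=.
by rewrite (negbTE nk) andbF.
Qed.

Lemma net_norm k : net k -> r <= `|q k|.
Proof. by move=> /andP[]. Qed.

Lemma net_separated j k : net j -> net k -> j != k -> r <= `|q j - q k|.
Proof.
wlog jk : j k / (j < k)%N => [H nj nk jk|nj /andP[_ /allP nk] _].
  have [?|?|E] := ltngtP j k; [exact: H|by rewrite distrC H// eq_sym|].
  by rewrite E eqxx in jk.
by rewrite distrC nk// mem_net_upto jk.
Qed.

(** A point of norm at least 2 r is within 2 r of the net, by maximality. A point near the origin is
    at distance less than 5 r from the auxiliary point 3 r v, whence 7 = 5 + 2. *)
Lemma net_dense x : 0 < r -> dense_seq q -> (exists v : V, `|v| = 1) ->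
  exists2 k, net k & `|x - q k| < 7 * r.
Proof.
move=> r0 dq unitV.
have far y : 2 * r <= `|y| -> exists2 k, net k & `|y - q k| < 2 * r.
  move=> ry; have r2 : 0 < r / 2 by lra.
  have [k yk] := dq y (r / 2) r2.
  have qk : r <= `|q k|.
    have := ler_normD (q k) (y - q k); rewrite [q k + _]addrC subrK => ?; lra.
  have [nk|] := boolP (net k); first by exists k => //; lra.
  rewrite /net qk/= => /allPn[i]; rewrite mem_net_upto => /andP[_ ni].
  rewrite -ltNge => ki; exists i => //.
  have := ler_normD (y - q k) (q k - q i); rewrite addrA subrK => ?; lra.
have [rx|xr] := leP (2 * r) `|x|.
  by have [k nk xk] := far x rx; exists k => //; lra.
have [v v1] := unitV.
have y3 : `|(3 * r) *: v| = 3 * r by rewrite normrZ v1 mulr1 gtr0_norm//; lra.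
have [|k nk yk] := far ((3 * r) *: v); first by rewrite y3; lra.
exists k => //.
have := ler_normD (x - (3 * r) *: v) ((3 * r) *: v - q k).
rewrite addrA subrK; have := ler_normB x ((3 * r) *: v); rewrite y3 => ? ?; lra.
Qed.

End net.

(** * Hausdorff measure of a box space *)

Definition metric_of {R : realType} (V : normedModType R) : Type := V.

Section metric_of.
Context {R : realType} (V : normedModType R).
HB.instance Definition _ := NormedModule.copy (metric_of V) V.

Let dist (x y : metric_of V) := `|x - y|.
Let dist_ge0 x y : 0 <= dist x y. Proof. exact: normr_ge0. Qed.
Let dist_positivity x y : dist x y = 0 -> x = y.
Proof. by move/normr0_eq0/eqP; rewrite subr_eq0 => /eqP. Qed.
Let ballEdist (x : metric_of V) (e : R) : ball x e = [set y | dist x y < e].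
Proof. by rewrite -ball_normE. Qed.
HB.instance Definition _ :=
  @PseudoMetric_isMetric.Build R (metric_of V) dist dist_ge0 dist_positivity ballEdist.

Lemma mdist_norm (x y : metric_of V) : mdist x y = `|x - y|. Proof. by []. Qed.

End metric_of.

Section box_space_theory.
Context {R : realType} (n : nat) (V : normedModType R)
  (m : {sigma_finite_measure set (borel V) -> \bar R}) (bm : box_space n m).
Local Open Scope ereal_scope.

Lemma box_ball (x : V) (r : R) : (0 < r)%R -> m (ball x r) = ((2 * r) ^+ n)%:E.
Proof.
move=> r0; rewrite -(box_volume bm r0).
have := box_affine bm (- x)%R (@ltr01 R) (ball_measurable (0%R : V) r).
rewrite invr1 expr1n mul1e => <-; congr (m _); apply/seteqP.
by split=> y /=; rewrite -!ball_normE/= scale1r sub0r opprD opprK.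
Qed.

Lemma box_translate (a : V) (A : set (borel V)) : measurable A ->
  m ((fun x : V => x + a)%R @^-1` A) = m A.
Proof.
move=> mA; have := box_affine bm a (@ltr01 R) mA.
rewrite invr1 expr1n mul1e => <-; congr (m _); apply/seteqP.
by split=> y /=; rewrite scale1r addrC.
Qed.

(** Volume count: the balls of radius r/2 around the points are disjoint, have volume r^n each, and
    lie in the ball of radius rho + r/2 around x. The number of points is kept implicit in the sum
    of these volumes. *)
Lemma separated_count (q : nat -> V) (P : pred nat) (r rho : R) (x : V) :
  (0 < r)%R -> (0 < rho)%R ->
  (forall j k, P j -> P k -> j != k -> (r <= `|q j - q k|)%R) ->
  \sum_(k <oo | P k && (`|x - q k| < rho)%R) (r ^+ n)%:E <= ((2 * rho + r) ^+ n)%:E.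
Proof.
move=> r0 rho0 sep.
pose F k : set (borel V) :=
  if P k && (`|x - q k| < rho)%R then ball (q k) (r / 2) else set0.
have mF k : measurable (F k).
  by rewrite /F; case: ifPn => _ //; exact: ball_measurable.
have r2 : (0 < r / 2)%R by lra.
have tF : trivIset setT F.
  apply/trivIsetP => j k _ _ jk; rewrite /F.
  case: ifPn => [/andP[Pj _]|_]; last by rewrite set0I.
  case: ifPn => [/andP[Pk _]|_]; last by rewrite setI0.
  apply/seteqP; split => // y [/=]; rewrite -!ball_normE/= => jy ky.
  have := sep j k Pj Pk jk; have := ler_normD (q j - y)%R (y - q k)%R.
  by rewrite addrA subrK (distrC y); lra.
rewrite eseries_mkcond (eq_eseriesr (g := fun k => m (F k))); last first.
  move=> k _; rewrite /F; case: ifPn => _; last by rewrite measure0.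
  by rewrite box_ball// mulrC divfK.
rewrite -measure_semi_bigcup//; last exact: bigcup_measurable.
rewrite (_ : 2 * rho + r = 2 * (rho + r / 2))%R; last by field.
rewrite -(@box_ball x); last lra.
apply: le_measure; rewrite ?inE; [exact: bigcup_measurable|exact: ball_measurable|].
move=> y [k _]; rewrite /F; case: ifPn => // /andP[_ xk].
rewrite -!ball_normE/= => ky; have := ler_normD (x - q k)%R (q k - y)%R.
by rewrite addrA subrK; lra.
Qed.

Hypothesis n0 : (0 < n)%N.

Local Notation H := (@hausdorff R (metric_of V) n).

Lemma measurable_closed_ball_ (x : V) (d : R) :
  measurable (closed_ball_ Num.norm x d : set (borel V)).
Proof.
rewrite -[X in measurable X]setCK; apply: measurableC; apply: borel_open.
by rewrite openC; exact: closed_closed_ball_.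
Qed.

Lemma box_closed_ball (x : V) (d : R) : (0 <= d)%R ->
  m (closed_ball_ Num.norm x d) <= ((4 * d) ^+ n)%:E.
Proof.
have sub e (e0 : (0 < e)%R) (de : (d < e)%R) :
    m (closed_ball_ Num.norm x d) <= ((2 * e) ^+ n)%:E.
  rewrite -(box_ball x e0); apply: le_measure; rewrite ?inE.
  - exact: measurable_closed_ball_.
  - exact: ball_measurable.
  - by move=> y /=; rewrite -ball_normE/= => /le_lt_trans; apply.
rewrite le_eqVlt => /predU1P[d0|d0]; last first.
  have dd : (d < 2 * d)%R by lra.
  by have := sub (2 * d)%R (lt_trans d0 dd) dd; rewrite mulrA -natrM.
(* For d = 0 the set is a point; it is null because it lies in balls of arbitrarily small volume, n
   being positive. *)
apply/lee_addgt0Pr => e e0; subst d; rewrite mulr0 expr0n (gtn_eqF n0) add0e.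
have e1 : (0 < Num.min 1 e :> R)%R by rewrite lt_min ltr01.
have e2 : (0 < Num.min 1 e / 2 :> R)%R by rewrite divr_gt0.
apply: (le_trans (sub (Num.min 1 e / 2)%R e2 e2)).
rewrite mulrC divfK// lee_fin.
case: (n) n0 => // k _; rewrite exprS (le_trans (ler_piMr _ _))//.
- exact: ltW.
- by rewrite exprn_ile1 ?(ltW e1)// ge_min lexx.
- by rewrite ge_min lexx orbT.
Qed.

Lemma gauge_fin (U : set (metric_of V)) (d : R) : diam U = d%:E -> U !=set0 ->
  gauge n U = (d ^+ n)%:E.
Proof.
by move=> Ud U0; rewrite /gauge ifF ?Ud ?EFin_expe//; apply/negbTE/set0P.
Qed.

(** Each set of a cover lies in a closed ball centred at one of its points with radius its diameter,
    whose volume is at most 4^n times the gauge. This gives positivity of the Hausdorff measure. *)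
Lemma box_le_hausdorff (A : set V) : measurable (A : set (borel V)) ->
  m A <= (4 ^+ n)%:E * H A.
Proof.
move=> mA; have n4 : (0 < 4 ^+ n :> R)%R by rewrite exprn_gt0.
apply: (@le_trans _ _ ((4 ^+ n)%:E * hausdorff_pre n 1%R (A : set (metric_of V)))); last first.
  rewrite lee_pmul2l// ?lte_fin//; apply: ereal_sup_ubound; exists 1%R => //=.
rewrite -lee_pdivrMl//; apply: le_ereal_inf_tmp => _ [U [Ud AU] <-].
rewrite lee_pdivrMl// -nneseriesZl; last by move=> *; exact: gauge_ge0.
pose F k : set (borel V) := if pselect (U k !=set0) is left h then
  closed_ball_ Num.norm (projT1 (cid h) : V) (fine (diam (U k))) else set0.
have dfin k : diam (U k) = (fine (diam (U k)))%:E.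
  by rewrite fineK// ge0_fin_numE ?diam_ge0// (le_lt_trans (Ud k))// ltry.
have mF k : measurable (F k).
  by rewrite /F; case: pselect => // h; exact: measurable_closed_ball_.
apply: (@le_trans _ _ (\sum_(k <oo) m (F k))).
  apply: measure_sigma_subadditive => //.
  move=> x /AU[k _ Ukx]; exists k => //; rewrite /F; case: pselect => [h|[]]; last by exists x.
  case: cid => y Uy; rewrite /closed_ball_/= -lee_fin -dfin; exact: (@diam_mdist _ (metric_of V)).
apply: lee_nneseries => k _; first by move=> _; exact: measure_ge0.
rewrite /F; case: pselect => [h|h]; last by rewrite measure0 mule_ge0 ?gauge_ge0// lee_fin ltW.
apply: le_trans (box_closed_ball _ _) _; first by rewrite -lee_fin -dfin diam_ge0.
by rewrite (gauge_fin (dfin k) h) -EFinM exprMn.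
Qed.

(** At each scale the balls of radius 7 e around an e-net cover, and [separated_count] bounds the
    sum of their gauges independently of e. *)
Lemma hausdorff_ball_fin (x : V) (r : R) : (0 < r)%R -> H (ball x r) < +oo.
Proof.
move=> r0; have [q dq] := box_dense bm.
apply: (@le_lt_trans _ _ ((14 ^+ n)%:E * ((2 * (r + 1) + 1) ^+ n)%:E)); last by rewrite -EFinM ltry.
apply: ge_ereal_sup => _ [d /= d0 <-].
(* The covering balls then have diameter at most 14 e <= d, and the cap at 1 makes the net points
   within r + 1 of x sufficient. *)
pose e : R := (Num.min 1 d / 14)%R.
have m0 : (0 < Num.min 1 d)%R by rewrite lt_min ltr01.
have m1 : (Num.min 1 d <= 1)%R by rewrite ge_min lexx.
have md : (Num.min 1 d <= d)%R by rewrite ge_min lexx orbT.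
have e0 : (0 < e)%R by rewrite /e divr_gt0.
have e14 : (14 * e = Num.min 1 d)%R by rewrite /e mulrC divfK.
pose P k := net q e k && (`|x - q k| < r + 1)%R.
pose U k : set (metric_of V) := if P k then ball (q k) (7 * e)%R else set0.
have Ud k : diam (U k) <= (14 * e)%:E.
  apply: diam_le; first by rewrite mulr_ge0// ltW.
  move=> y z; rewrite /U; case: ifPn => // _.
  rewrite mdist_norm -!ball_normE/= => qy qz.
  by have := ler_normD (y - q k)%R (q k - z)%R; rewrite addrA subrK (distrC y (q k)); lra.
apply: (@le_trans _ _ (\sum_(k <oo) gauge n (U k))).
  apply: ereal_inf_lbound; exists U => //; split.
    by move=> k; rewrite (le_trans (Ud k))// lee_fin e14.
  move=> y; rewrite -ball_normE/= => xy.
  have [k nk yk] := net_dense (y : V) e0 dq (box_unit bm).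
  exists k => //; rewrite /U /P nk/= ifT; last first.
    by have := ler_normD (x - y)%R (y - q k)%R; rewrite addrA subrK; lra.
  by rewrite -ball_normE/= distrC.
apply: (@le_trans _ _ ((14 ^+ n)%:E * \sum_(k <oo | P k) (e ^+ n)%:E)).
  rewrite -nneseriesZl; last by move=> *; rewrite lee_fin exprn_ge0// ltW.
  rewrite [leRHS]eseries_mkcond; apply: lee_nneseries => k _; first by move=> _; exact: gauge_ge0.
  case: ifPn => Pk; last by rewrite /U (negbTE Pk) gauge_set0.
  have U0 : U k !=set0 by exists (q k); rewrite /U Pk; apply: ballxx; rewrite mulr_gt0.
  have dfin : diam (U k) = (fine (diam (U k)))%:E.
    by rewrite fineK// ge0_fin_numE ?diam_ge0// (le_lt_trans (Ud k))// ltry.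
  rewrite (gauge_fin dfin U0) -EFinM -exprMn lee_fin lerXn2r ?nnegrE//.
  - by rewrite fine_ge0// diam_ge0.
  - by rewrite mulr_ge0// ltW.
  - by rewrite -lee_fin -dfin.
apply: lee_wpmul2l; first by rewrite lee_fin.
have r1 : (0 < r + 1)%R by rewrite addr_gt0.
apply: (le_trans (separated_count x e0 r1 (@net_separated _ _ q e))).
rewrite lee_fin lerXn2r ?nnegrE; lra.
Qed.

End box_space_theory.

(** * Isometry invariance of the Hausdorff measure *)

Section isometry.
Context {R : realType} (X Y : pmetricType R) (f : X -> Y) (n : nat).
Hypothesis fi : forall x y, mdist (f x) (f y) = mdist x y.
Local Open Scope ereal_scope.

Lemma isometry_diam (A : set X) : diam (f @` A) = diam A.
Proof.
rewrite /diam; congr (maxe 0 (ereal_sup _)); apply/seteqP; split.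
  move=> _ [[_ _] [/= [x Ax <-] [y Ay <-]] <-]; exists (x, y) => //=.
  by rewrite fi.
by move=> _ [[x y] [/= Ax Ay] <-]; exists (f x, f y); [split; [exists x|exists y]|rewrite /= fi].
Qed.

Lemma le_expe (x y : \bar R) : 0 <= x -> x <= y -> x ^+ n <= y ^+ n.
Proof.
move=> x0 xy; elim: n => [|k ih]; first by rewrite !expe0.
by rewrite !expeS; apply: lee_pmul => //; exact: expe_ge0.
Qed.

Lemma le_gauge (Z Z' : pmetricType R) (A : set Z) (B : set Z') :
  (A !=set0 -> B !=set0) -> diam A <= diam B -> gauge n A <= gauge n B.
Proof.
move=> AB dAB; rewrite /gauge; case: ifPn => A0; first by case: ifPn => // _; rewrite expe_ge0 ?diam_ge0.
rewrite ifF; last by apply/negbTE/set0P/AB/set0P.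
by apply: le_expe; rewrite ?diam_ge0.
Qed.

(** Covers may consist of arbitrary sets, so they can be pushed forward and pulled back along f; the
    image of f need not be all of Y, hence a pulled-back set may only have a smaller diameter. *)
Lemma isometry_hausdorff (A : set X) : hausdorff n (f @` A) = hausdorff n A.
Proof.
rewrite /hausdorff; congr ereal_sup; apply: eq_imagel => d /= d0.
apply/eqP; rewrite eq_le; apply/andP; split; apply: le_ereal_inf_tmp => _ [U [Ud AU] <-].
  apply: ereal_inf_lbound; exists (fun k => f @` U k).
    split; first by move=> k; rewrite isometry_diam.
    by move=> _ [x /AU[k _ Ux] <-]; exists k => //; exists x.
  apply: eq_eseriesr => k _; apply/eqP; rewrite eq_le; apply/andP.
  by split; apply: le_gauge; rewrite ?isometry_diam// => -[x]; [case=> y Uy _; exists y|exists (f x), x].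
have sub k : diam (f @^-1` U k) <= diam (U k).
  rewrite -isometry_diam /diam ge_max !le_max lexx/=; apply/orP; right.
  apply: ereal_sup_le => _ [[_ _] [/= [x Ux <-] [y Uy <-]] <-].
  by exists (f x, f y).
apply: (@le_trans _ _ (\sum_(k <oo) gauge n (f @^-1` U k))).
  apply: ereal_inf_lbound; exists (fun k => f @^-1` U k) => //; split.
    by move=> k; exact: le_trans (sub k) (Ud k).
  by move=> x Ax; have [k _ ?] := AU (f x) (ex_intro2 _ _ x Ax erefl); exists k.
apply: lee_nneseries => k _; first by move=> _; exact: gauge_ge0.
by apply: le_gauge => // -[x]; exists (f x).
Qed.

End isometry.

(** * Open subsets of a normed space as pointed metric spaces *)

(** The proof of [S w] is an argument because it provides the base point. The distance put on this
    type is that of the ambient norm, not a path distance. *)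
Definition restr {R : realType} (W : normedModType R) (S : set W) (w : W) of S w : Type :=
  {x : W | x \in S}.

Section restr_metric.
Context {R : realType} (W : normedModType R) (S : set W) (w : W) (Sw : S w).
Local Notation X := (restr Sw).

HB.instance Definition _ := Choice.copy (restr Sw) {x : W | x \in S}.
HB.instance Definition _ := isPointed.Build (restr Sw) (exist _ w (mem_set Sw)).

Definition emb (x : restr Sw) : metric_of W := sval x.

Lemma embS x : S (emb x). Proof. by case: x => x xS; exact: set_mem. Qed.

Lemma emb_inj : injective emb. Proof. exact: val_inj. Qed.

Lemma emb_surj y : S y -> exists x, emb x = y.
Proof. by move=> Sy; exists (exist _ y (mem_set Sy)). Qed.

Let dist (x y : X) : R := `|emb x - emb y|.
Let distxx x : dist x x = 0. Proof. by rewrite /dist subrr normr0. Qed.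
Let dist_pos x y : dist x y = 0 -> x = y.
Proof. by move/normr0_eq0/eqP; rewrite subr_eq0 => /eqP /emb_inj. Qed.
Let dist_sym x y : dist x y = dist y x. Proof. exact: distrC. Qed.
Let dist_tri y x z : dist x z <= dist x y + dist y z.
Proof. by rewrite /dist -(subrKA (emb y)) ler_normD. Qed.

HB.instance Definition _ := isMetric.Build R (restr Sw) distxx dist_pos dist_sym dist_tri.

Lemma mdist_restr (x y : X) : mdist x y = `|emb x - emb y|. Proof. by []. Qed.

Lemma mdist_emb (x y : X) : mdist (emb x) (emb y) = mdist x y. Proof. by []. Qed.

Lemma ball_restr (x : X) r : ball x r = emb @^-1` (ball (emb x : W) r).
Proof. by apply/seteqP; split=> y; rewrite ballEmdist/= -ball_normE. Qed.

Lemma open_restr (A : set W) : open A -> open (emb @^-1` A).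
Proof.
move=> oA; rewrite openE => x /= Ax; have /nbhs_ballP[e /= e0 eA] := open_nbhs_nbhs (conj oA Ax).
by apply/nbhs_ballP; exists e => //; rewrite ball_restr => y /eA.
Qed.

Hypothesis oS : open S.

Lemma open_emb (A : set X) : open A -> open (emb @` A : set W).
Proof.
move=> oA; rewrite openE => _ [x Ax <-].
have /nbhs_ballP[e /= e0 eA] := open_nbhs_nbhs (conj oA Ax).
have /nbhs_ballP[e' /= e0' eS] := open_nbhs_nbhs (conj oS (embS x)).
apply/nbhs_ballP; exists (Num.min e e'); first by rewrite /= lt_min e0.
move=> y xy; have [z zy] : exists z, emb z = y.
  by apply/emb_surj/eS; apply: le_ball xy; rewrite ge_min lexx orbT.
exists z => //; apply: eA; rewrite ball_restr /= zy.
by apply: le_ball xy; rewrite ge_min lexx.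
Qed.

Lemma locally_compact_restr :
  (forall (x : W) (r : R), compact [set y : W | `|x - y| <= r]) ->
  locally_compact [set: X].
Proof.
move=> cpt x _.
have /nbhs_ballP[e /= e0 eS] := open_nbhs_nbhs (conj oS (embS x)).
pose K : set W := closed_ball_ Num.norm (emb x : W) (e / 2).
have KS : K `<=` S.
  move=> y; rewrite /K /closed_ball_/= => xy; apply: eS; rewrite -ball_normE/=.
  by rewrite (le_lt_trans xy)// ltr_pdivrMr// ltr_pMr// ltr1n.
exists (emb @^-1` K).
  apply/nbhs_ballP; exists (e / 2); first by rewrite /= divr_gt0.
  by move=> y; rewrite ball_restr /= -ball_normE/= /K /closed_ball_/= => /ltW.
split; last first.
  rewrite -[X in closed X]setCK closedC; apply: (@open_restr (~` K)).
  by rewrite openC; exact: closed_closed_ball_.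
move=> F PF FK.
have PG : ProperFilter (emb @ F) by exact: fmap_proper_filter.
have [p [Kp clp]] := cpt (emb x) (e / 2) (emb @ F) PG FK.
have [y yp] := emb_surj (KS p Kp); exists y; split; first by rewrite /= yp.
move=> A B FA /nbhs_ballP[r /= r0 rB].
have [_ [[z Az <-] pz]] := clp (emb @` A) (ball (p : W) r) (filterS (@preimage_image _ _ emb A) FA) (nbhsx_ballx _ _ r0).
by exists z; split => //; apply: rB; rewrite ball_restr/= yp.
Qed.

(** As S is open, images of open sets are open, and the sets with a Borel image form a
    sigma-algebra. It follows that an upper gradient extended by 0 to W is still Borel. *)
Lemma borel_emb (A : set (g_sigma_algebraType (@open X))) : measurable A ->
  measurable (emb @` A : set (borel W)).
Proof.
move: A; suff : <<s @open X >> `<=` [set A | measurable (emb @` A : set (borel W))] by [].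
apply: smallest_sub; last by move=> B oB; apply: borel_open; exact: open_emb.
split.
- by rewrite /= image_set0.
- move=> B mB; rewrite /= (_ : emb @` _ = S `\` emb @` B).
    by apply: measurableD => //; exact: borel_open.
  apply/seteqP; split.
    by move=> _ [y [_ nBy] <-]; split; [exact: embS|move=> [z Bz /emb_inj zy]; apply: nBy; rewrite -zy].
  by move=> y [Sy nBy]; have [x xy] := emb_surj Sy; exists x => //; split => // Bx; apply: nBy; exists x.
- by move=> F mF; rewrite /= image_bigcup; apply: bigcupT_measurable.
Qed.

Definition extend_by0 (g : X -> \bar R) (y : W) : \bar R :=
  if pselect (S y) is left Sy then g (exist _ y (mem_set Sy)) else 0%E.

Lemma extend_by0E (g : X -> \bar R) x : extend_by0 g (emb x) = g x.
Proof.
rewrite /extend_by0; case: pselect => [Sx|]; last by case; exact: embS.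
by congr g; apply: emb_inj.
Qed.

Lemma extend_by0_out (g : X -> \bar R) y : ~ S y -> extend_by0 g y = 0%E.
Proof. by rewrite /extend_by0; case: pselect. Qed.

Lemma extend_by0_ge0 (g : X -> \bar R) : (forall x, (0 <= g x)%E) ->
  forall y, (0 <= extend_by0 g y)%E.
Proof. by move=> g0 y; rewrite /extend_by0; case: pselect. Qed.

Lemma measurable_extend_by0 (g : X -> \bar R) : borel_function g ->
  measurable_fun setT (extend_by0 g : borel W -> \bar R).
Proof.
move=> mg _ B mB; rewrite setTI.
rewrite (_ : _ @^-1` B = emb @` (g @^-1` B) `|` (~` S `&` [set _ | B 0%E])).
  apply: measurableU.
    by apply: borel_emb; rewrite -[X in measurable X]setTI; exact: mg.
  apply: measurableI; first by apply: measurableC; exact: borel_open.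
  have [B0|B0] := pselect (B 0%E).
    by rewrite [X in measurable X](_ : _ = setT)//; apply/seteqP; split.
  by rewrite [X in measurable X](_ : _ = set0)//; apply/seteqP; split.
apply/seteqP; split.
  move=> y /=; have [Sy|nSy] := pselect (S y); last by rewrite extend_by0_out//; right.
  by have [x <-] := emb_surj Sy; rewrite extend_by0E; left; exists x.
move=> y [[x Bx <-]|[nSy B0]] /=; first by rewrite extend_by0E.
by rewrite extend_by0_out.
Qed.

End restr_metric.
Arguments emb {R W S w Sw} x.

(** * Hausdorff measure as a multiple of Lebesgue measure *)

Section restr_measure.
Context {R : realType} (n : nat) (W : normedModType R)
  (m : {sigma_finite_measure set (borel W) -> \bar R}) (bm : box_space n m).
Hypothesis n0 : (0 < n)%N.
Local Open Scope ereal_scope.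
Local Notation H := (@hausdorff R (metric_of W) n).

(** The Hausdorff measure is translation invariant and finite on balls, so [haar_unique] makes it a
    multiple of m; [box_le_hausdorff] makes the multiple positive. *)
Lemma hausdorff_box : exists2 k : R, (0 < k)%R &
  forall A : set W, measurable (A : set (borel W)) -> H A = k%:E * m A.
Proof.
have [q dq] := box_dense bm.
pose cT := caratheodory_type (hausdorff_outer (metric_of W) n).
have mid : measurable_fun setT (id : cT -> borel W).
  by apply: measurable_fun_borel => A oA; exact: (@open_caratheodory _ (metric_of W)).
pose h0 : {measure set (borel W) -> \bar R} := push_measure (hausdorff_measure (metric_of W) n) mid.
have sf : sigma_finite setT h0.
  exists (fun k => ball (0%R : W) k.+1%:R : set (borel W)).
    apply/seteqP; split => // x _; exists (Num.truncn `|x|) => //.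
    by rewrite /= -ball_normE/= sub0r normrN truncnS_gt.
  by move=> k; split; [exact: ball_measurable|exact: hausdorff_ball_fin bm _ _ _].
have [h hE] := sigma_finite_bundle sf.
have hH A : h A = H A by rewrite hE.
have B0 : (0 < m (ball (0%R : W) 1%R)) by rewrite (box_ball bm)// lte_fin exprn_gt0// mulr_gt0.
have HB0 : 0 < H (ball (0%R : W) 1%R).
  rewrite lt_neqAle hausdorff_ge0 andbT; apply/eqP => HB.
  have := box_le_hausdorff bm n0 (ball_measurable (0%R : W) 1%R).
  by rewrite -HB mule0 leNgt B0.
have HBfin : H (ball (0%R : W) 1%R) \is a fin_num.
  by rewrite ge0_fin_numE ?hausdorff_ge0//; exact: hausdorff_ball_fin bm _ _ _.
exists (fine (H (ball (0%R : W) 1%R)) / 2 ^+ n)%R.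
  by rewrite divr_gt0 ?exprn_gt0// fine_gt0// HB0 -ge0_fin_numE ?hausdorff_ge0.
move=> A mA.
have := @haar_unique R W q dq m h (box_translate bm) _ A mA.
rewrite !hH (box_ball bm)// mulr1 => E.
rewrite EFinM fineK// muleC muleA E; last first.
  move=> a B mB; rewrite !hH.
  have := @isometry_hausdorff _ (metric_of W) (metric_of W) (fun x => x + a)%R n _ ((fun x : W => x + a)%R @^-1` B).
  rewrite image_preimage// => [->//|].
    by move=> x y; rewrite !mdist_norm opprD addrACA subrr addr0.
  by apply/seteqP; split => // y _; exists (y - a)%R => //; rewrite subrK.
by rewrite muleAC -EFinM divff ?mul1e// expf_neq0.
Qed.

Context (S : set W) (w : W) (Sw : S w).
Hypotheses (oS : open S) (mS : m (~` S) = 0).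
Local Notation X := (restr Sw).

Lemma measurable_emb : measurable_fun setT
  (@emb _ _ _ _ Sw : caratheodory_type (hausdorff_outer X n) -> borel W).
Proof.
apply: measurable_fun_borel => A oA; apply: (@open_caratheodory _ X).
exact: open_restr.
Qed.

(** The Hausdorff measure depends on the metric alone, so the inclusion preserves it, and the part
    of A outside S is null. *)
Lemma hausdorff_restr : exists2 k : R, (0 < k)%R &
  forall A : set W, measurable (A : set (borel W)) -> 
    hausdorff_measure X n ((@emb _ _ _ _ Sw) @^-1` A) = k%:E * m A.
Proof.
have [k k0 kE] := hausdorff_box; exists k => // A mA.
have mS' : measurable (S : set (borel W)) by exact: borel_open.
transitivity (H (A `&` S)).
  have := @isometry_hausdorff _ X (metric_of W) (@emb _ _ _ _ Sw) n (@mdist_emb _ _ _ _ Sw) ((@emb _ _ _ _ Sw) @^-1` A).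
  move=> E; rewrite [LHS](_ : _ = hausdorff n ((@emb _ _ _ _ Sw) @^-1` A))// -E; congr hausdorff.
  apply/seteqP; split; first by move=> _ [x Ax <-]; split => //; exact: embS.
  by move=> y [Ay Sy]; have [x xy] := emb_surj Sw Sy; exists x => //; rewrite -xy in Ay.
rewrite kE; last exact: measurableI.
congr (_ * _); rewrite [RHS](measureDI m mA mS').
suff AS0 : m (A `\` S) = 0 by rewrite -[LHS]add0e; congr (_ + _); exact: (esym AS0).
apply/eqP; rewrite eq_le measure_ge0 andbT -mS le_measure// inE.
- exact: measurableD.
- exact: measurableC.
Qed.

Lemma restr_integral : exists2 k : R, (0 < k)%R &
  (forall A : set W, measurable (A : set (borel W)) -> 
    hausdorff_measure X n ((@emb _ _ _ _ Sw) @^-1` A) = k%:E * m A) /\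
  forall (D : set (borel W)) (f : borel W -> \bar R), measurable D ->
    measurable_fun setT f -> (forall y, 0 <= f y) ->
  \int[hausdorff_measure X n]_(x in (@emb _ _ _ _ Sw) @^-1` D) f (@emb _ _ _ _ Sw x) =
  k%:E * \int[m]_(y in D) f y.
Proof.
have [k k0 kE] := hausdorff_restr; exists k => //; split => // D f mD mf f0.
have := @ge0_integral_pushforward _ _ _ _ R _ measurable_emb (hausdorff_measure X n) D f mD _ _.
rewrite /= => <-; last 2 first.
- exact: measurable_funS mf.
- by move=> y _.
rewrite (@eq_measure_integral _ _ _ D (mscale (NngNum (ltW k0)) m) (push_measure (hausdorff_measure X n) measurable_emb)).
  rewrite ge0_integral_mscale//; exact: measurable_funS mf.
by move=> A mA _; exact: kE.
Qed.

End restr_measure.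

(** * Length of curves and arc-length parametrization *)

Section polygonal_length.
Context {R : realType} (X : pmetricType R).
Implicit Types (c : R -> X) (a b t x : R) (s : seq R).

(** Recursive form of the polygonal sum in [curve_length], suited to inductions on partitions. *)
Fixpoint plen c x s : R := if s is y :: s' then mdist (c x) (c y) + plen c y s' else 0.

Lemma plenE c b x s :
  \sum_(0 <= i < size s) mdist (c (nth b (x :: s) i)) (c (nth b (x :: s) i.+1)) = plen c x s.
Proof.
elim: s x => [x|y s ih x]; first by rewrite big_nil.
by rewrite big_nat_recl//= -ih.
Qed.

Lemma plen_ge0 c x s : 0 <= plen c x s.
Proof. by elim: s x => //= y s ih x; rewrite addr_ge0// mdist_ge0. Qed.

Lemma plen_cat c x s s' : plen c x (s ++ s') = plen c x s + plen c (last x s) s'.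
Proof. by elim: s x => [|y s ih] x /=; rewrite ?add0r// ih addrA. Qed.

Lemma curve_lengthE c a b :
  curve_length c a b = ereal_sup [set (plen c a s)%:E | s in itv_partition a b].
Proof. by rewrite /curve_length; congr ereal_sup; apply: eq_imagel => s _; rewrite plenE. Qed.

Lemma plen_le_length c a b s : itv_partition a b s -> ((plen c a s)%:E <= curve_length c a b)%E.
Proof. by move=> sab; rewrite curve_lengthE; apply: ereal_sup_ubound; exists s. Qed.

Lemma le_length c a b (M : \bar R) :
  (forall s, itv_partition a b s -> ((plen c a s)%:E <= M)%E) -> (curve_length c a b <= M)%E.
Proof. by move=> H; rewrite curve_lengthE; apply: ge_ereal_sup => _ [s sab <-]; exact: H. Qed.

Lemma itv_partition_exists a b : a <= b -> exists s, itv_partition a b s.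
Proof.
rewrite le_eqVlt => /predU1P[->|ab]; first by exists [::]; split => /=.
by exists [:: b]; exact: itv_partition1.
Qed.

Lemma length_ge0 c a b : a <= b -> (0 <= curve_length c a b)%E.
Proof.
move=> /itv_partition_exists[s sab]; apply: le_trans (plen_le_length c sab).
by rewrite lee_fin plen_ge0.
Qed.

Lemma mdist_le_length c a b : a <= b -> ((mdist (c a) (c b))%:E <= curve_length c a b)%E.
Proof.
rewrite le_eqVlt => /predU1P[->|ab]; first by rewrite mdistxx length_ge0.
by apply: le_trans (plen_le_length c (itv_partition1 ab)); rewrite /= addr0.
Qed.

Lemma plen_split c a b x s : itv_partition a b s -> a <= x -> x <= b ->
  exists s1 s2, [/\ itv_partition a x s1, itv_partition x b s2 &
                    plen c a s <= plen c a s1 + plen c x s2].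
Proof.
elim: s a => [a /itv_partition_nil <- ax xa|y s ih a abs ax xb].
  have -> : x = a by apply/eqP; rewrite eq_le ax xa.
  by exists [::], [::]; split => //=; rewrite addr0.
have [yx|xy] := leP y x.
  have [s1 [s2 [p1 p2 H]]] := ih y (itv_partition_cons abs) yx xb.
  exists (y :: s1), s2; split => //; last by rewrite /= -addrA lerD2l.
  have [/= /andP[ay _] _] := abs; have [P1 P2] := p1.
  by split => //=; rewrite ay.
move: ax; rewrite le_eqVlt => /predU1P[<-|ax].
  by exists [::], (y :: s); split => //=; rewrite add0r.
exists [:: x], (y :: s); split; first exact: itv_partition1.
  have [/= /andP[ay p1] p2] := abs.
  by split => //=; rewrite xy.
by rewrite /= addr0 addrA lerD2r metric_triangle.
Qed.

Lemma lengthD c a b x : a <= x -> x <= b ->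
  (curve_length c a b = curve_length c a x + curve_length c x b)%E.
Proof.
move=> ax xb; apply/eqP; rewrite eq_le; apply/andP; split.
  apply: le_length => s sab; have [s1 [s2 [p1 p2 H]]] := plen_split c sab ax xb.
  apply: (@le_trans _ _ ((plen c a s1)%:E + (plen c x s2)%:E)%E); first by rewrite -EFinD lee_fin.
  by apply: leeD; exact: plen_le_length.
have [->|] := eqVneq (curve_length c a b) +oo%E; first exact: leey.
rewrite -ltey => fin.
have key s1 s2 : itv_partition a x s1 -> itv_partition x b s2 ->
    ((plen c a s1)%:E + (plen c x s2)%:E <= curve_length c a b)%E.
  move=> p1 p2; rewrite -EFinD; apply: le_trans (plen_le_length c (itv_partition_cat p1 p2)).
  by rewrite lee_fin plen_cat; case: p1 => _ /eqP ->.
have finx : curve_length c x b \is a fin_num.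
  rewrite ge0_fin_numE ?length_ge0//; apply: le_lt_trans fin.
  have [s1 p1] := itv_partition_exists ax.
  apply: le_length => s2 p2; apply: le_trans (key _ _ p1 p2).
  by rewrite leeDr// lee_fin plen_ge0.
rewrite -leeBrDr//; apply: le_length => s1 p1.
rewrite leeBrDr// addeC -leeBrDr//; apply: le_length => s2 p2.
by rewrite leeBrDr// addeC key.
Qed.

End polygonal_length.

Section isometric_curve.
Context {R : realType} (X : pmetricType R) (c : R -> X) (a b : R).
Hypothesis ab : a <= b.
Hypothesis ci : forall x y, a <= x <= b -> a <= y <= b -> mdist (c x) (c y) = `|x - y|.

Lemma isometric_plen x s : a <= x -> path <%O x s -> last x s <= b ->
  plen c x s = last x s - x.
Proof.
elim: s x => [x ax _ xb|y s ih x ax /= /andP[xy pys] lb]; first by rewrite /= subrr.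
have yl : y <= last y s by apply: (@itv_partition_le _ _ _ _ s); split.
rewrite ih//; last by rewrite (le_trans ax)// ltW.
have yb := le_trans yl lb; have xb := le_trans (ltW xy) yb.
rewrite ci ?ax ?xb ?yb ?(le_trans ax (ltW xy))//.
rewrite ltr0_norm ?subr_lt0// opprB; ring.
Qed.

Lemma isometric_length x : a <= x <= b -> curve_length c a x = (x - a)%:E.
Proof.
move=> /andP[ax xb].
have E s : itv_partition a x s -> plen c a s = x - a.
  by move=> [ps /eqP ls]; rewrite isometric_plen// ls.
apply/eqP; rewrite eq_le; apply/andP; split.
  by apply: le_length => s /E ->.
have [s ps] := itv_partition_exists ax.
by rewrite -(E s ps); exact: plen_le_length.
Qed.

Lemma isometric_rectifiable : rectifiable_curve c a b.
Proof.
split => //; last by rewrite isometric_length ?ab ?lexx// ltry.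
apply/subspace_continuousP => x /=; rewrite in_itv/= => xab.
apply/cvg_ballP => e e0; near=> y.
rewrite ballEmdist/= ci//; last first.
  by have : y \in `[a, b] by near: y; exact: withinT; rewrite in_itv.
by near: y; apply: cvg_within; apply: nbhsx_ballx.
Unshelve. all: by end_near. Qed.

Lemma isometric_integral (g : X -> \bar R) :
  curve_integral c a b g =
  (\int[lebesgue_measure]_(t in `[0%R, (b - a)%R]) g (c (a + t)%R))%E.
Proof.
rewrite /curve_integral isometric_length ?ab ?lexx//=.
apply: eq_integral => t /set_mem /=; rewrite in_itv/= => /andP[t0 tba].
have atb : a <= a + t <= b by rewrite lerDl t0 -lerBrDl.
rewrite /arc_length_param; case: xgetP => [x _|/(_ (a + t))[]]; last first.
  by split; rewrite ?in_itv//= isometric_length// addrC addKr.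
rewrite /= in_itv/= => -[xab]; rewrite isometric_length// => -[<-].
by rewrite (addrC a) subrK.
Qed.

End isometric_curve.

Section arc_length.
Context {R : realType} (X : pmetricType R) (c : R -> X) (a b : R).
Hypothesis rc : rectifiable_curve c a b.

Lemma rectifiable_le : a <= b. Proof. by have [] := rc. Qed.

Lemma rectifiable_continuous x e : a <= x <= b -> 0 < e -> exists2 d, 0 < d &
  forall y, a <= y <= b -> `|x - y| < d -> mdist (c x) (c y) < e.
Proof.
move=> xab e0; have [_ /subspace_continuousP cc _] := rc.
have /cc /(_ _ (nbhsx_ballx (c x) e e0)) : `[a, b]%classic x by rewrite /= in_itv.
move=> /nbhs_ballP[d /= d0 H]; exists d => // y yab xy.
by have := H y xy; rewrite /= in_itv/= ballEmdist/= => /(_ yab).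
Qed.

Lemma length_fin x y : a <= x -> x <= y -> y <= b -> curve_length c x y \is a fin_num.
Proof.
move=> ax xy yb; rewrite ge0_fin_numE ?length_ge0//; have [ab _ fin] := rc.
apply: le_lt_trans fin.
rewrite (lengthD c ax (le_trans xy yb)) (lengthD c xy yb).
rewrite addeCA leeDl// adde_ge0// length_ge0//; exact: le_trans xy.
Qed.

Local Notation l x := (fine (curve_length c a x)).

Lemma lB x y : a <= x -> x <= y -> y <= b -> fine (curve_length c x y) = l y - l x.
Proof.
move=> ax xy yb; rewrite (lengthD c ax xy) fineD ?length_fin ?(le_trans xy)//.
by rewrite addrC addKr.
Qed.

Lemma mdist_le_lB x y : a <= x -> x <= y -> y <= b -> mdist (c x) (c y) <= l y - l x.
Proof.
move=> ax xy yb; rewrite -lB// -lee_fin fineK ?length_fin//; exact: mdist_le_length.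
Qed.

Lemma l_homo x y : a <= x -> x <= y -> y <= b -> l x <= l y.
Proof. by move=> ax xy yb; rewrite -subr_ge0 (le_trans _ (mdist_le_lB ax xy yb))// mdist_ge0. Qed.

Lemma la : l a = 0.
Proof.
suff -> : curve_length c a a = 0%E by [].
apply/eqP; rewrite eq_le length_ge0// andbT; apply: le_length => s /itv_partitionxx ->.
by [].
Qed.

(** Insert y just before x in a partition whose polygonal length is within e/2 of the length up to
    x. By continuity of c the last chord is shorter than e/2, and the rest of the polygon is at most
    the length up to y. *)
Lemma l_left x e : a < x -> x <= b -> 0 < e -> exists y, [/\ a <= y, y < x & l x - l y <= e].
Proof.
move=> ax xb e0; have e2 : 0 < e / 2 by rewrite divr_gt0.
have fx := length_fin (lexx a) (ltW ax) xb.
have : (curve_length c a x - (e / 2)%:E < curve_length c a x)%E by rewrite lteBlDr// lteDl// lte_fin.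
rewrite {2}curve_lengthE => /ereal_sup_gt[_ [s sax <-]].
rewrite -(fineK fx) -EFinB lte_fin => H.
case: (lastP s) sax H => [/itv_partition_nil E|s' z]; first by rewrite E ltxx in ax.
move=> sax H; have zx : z = x by have [_ /eqP] := sax; rewrite last_rcons.
subst z; have [] := sax; rewrite rcons_path => /andP[ps' lx] _.
have al : a <= last a s' by apply: (@itv_partition_le _ _ _ _ s'); split.
have [d d0 Hd] := @rectifiable_continuous x (e / 2) (introT andP (conj (ltW ax) xb)) e2.
pose y := Num.max (last a s') (x - d / 2).
have ly : last a s' <= y by rewrite le_max lexx.
have yx : y < x by rewrite gt_max lx ltrBlDr ltrDl divr_gt0.
have ay := le_trans al ly.
exists y; split => //.
have dxy : mdist (c x) (c y) < e / 2.
  apply: Hd; first by rewrite ay (le_trans (ltW yx)).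
  rewrite gtr0_norm ?subr_gt0// ltrBlDr -ltrBlDl.
  by rewrite lt_max; apply/orP; right; rewrite ltrD2l ltrN2 ltr_pdivrMr// ltr_pMr// ltr1n.
move: H; rewrite -cats1 plen_cat/= addr0 => H.
have H1 : plen c a s' + mdist (c (last a s')) (c y) <= l y.
  rewrite -lee_fin fineK ?length_fin// ?(le_trans (ltW yx))//.
  move: ly; rewrite le_eqVlt => /predU1P[<-|ly].
    by rewrite mdistxx addr0; apply: plen_le_length; split.
  apply: le_trans (plen_le_length c (_ : itv_partition a y (s' ++ [:: y]))).
    by rewrite plen_cat/= addr0.
  by apply: itv_partition_cat (itv_partition1 ly); split.
have := metric_triangle (c (last a s')) (c y) (c x).
rewrite (metric_sym (c y) (c x)); lra.
Qed.

Lemma l_right x e : a <= x -> x < b -> 0 < e -> exists y, [/\ x < y, y <= b & l y - l x <= e].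
Proof.
move=> ax xb e0; have e2 : 0 < e / 2 by rewrite divr_gt0.
have fx := length_fin ax (ltW xb) (lexx b).
have : (curve_length c x b - (e / 2)%:E < curve_length c x b)%E by rewrite lteBlDr// lteDl// lte_fin.
rewrite {2}curve_lengthE => /ereal_sup_gt[_ [s sax <-]].
rewrite -(fineK fx) -EFinB lte_fin => H.
case: s sax H => [/itv_partition_nil E|z s sax H]; first by rewrite E ltxx in xb.
have sz := itv_partition_cons sax; have zb := itv_partition_le sz.
have [/= /andP[xz _] _] := sax.
have [d d0 Hd] := @rectifiable_continuous x (e / 2) (introT andP (conj ax (ltW xb))) e2.
pose y := Num.min z (x + d / 2).
have yz : y <= z by rewrite ge_min lexx.
have xy : x < y by rewrite lt_min xz ltrDl divr_gt0.
have yb := le_trans yz zb.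
exists y; split => //.
have dxy : mdist (c x) (c y) < e / 2.
  apply: Hd; first by rewrite yb (le_trans ax (ltW xy)).
  rewrite distrC gtr0_norm ?subr_gt0// ltrBlDl.
  by rewrite gt_min; apply/orP; right; rewrite ltrD2l ltr_pdivrMr// ltr_pMr// ltr1n.
have H1 : mdist (c y) (c z) + plen c z s <= fine (curve_length c y b).
  rewrite -lee_fin fineK ?length_fin// ?(le_trans ax (ltW xy))//.
  move: yz; rewrite le_eqVlt => /predU1P[->|yz].
    by rewrite mdistxx add0r; apply: plen_le_length.
  apply: le_trans (plen_le_length c (_ : itv_partition y b (z :: s))) => //.
  by have [P1 P2] := sz; split => //=; rewrite yz.
have ay := le_trans ax (ltW xy).
move: H1 H; rewrite (lB ax (ltW xb) (lexx b)) (lB ay yb (lexx b)) /=.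
have := metric_triangle (c x) (c y) (c z); lra.
Qed.

(** The length function is monotone and, by [l_left] and [l_right], continuous, so it takes all
    intermediate values. Hence [arc_length_param] never falls back on its default on [0, L]. *)
Lemma l_surj t : 0 <= t <= l b -> exists2 x, a <= x <= b & l x = t.
Proof.
move=> /andP[t0 tb]; have ab := rectifiable_le.
pose S := [set x | a <= x <= b /\ l x <= t].
have Sa : S a by rewrite /S/= lexx ab la.
have Sb : ubound S b by move=> x [/andP[]].
have hS : has_sup S by split; [exists a|exists b].
pose x := sup S.
have ax : a <= x by apply: ub_le_sup => //; exists b.
have xb : x <= b by apply: ge_sup => //; exists a.
have xab : a <= x <= b by rewrite ax.
exists x => //; apply/eqP; rewrite eq_le; apply/andP; split; apply/ler_addgt0Pr => e e0.
  move: ax; rewrite le_eqVlt => /predU1P[<-|ax]; first by rewrite la addr_ge0// ltW.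
  have [y [ay yx H]] := l_left ax xb e0.
  have xy0 : 0 < x - y by rewrite subr_gt0.
  have [z [/andP[az zb] zt] yz] := sup_adherent xy0 hS.
  rewrite -/x subKr in yz.
  have := l_homo ay (ltW yz) zb; lra.
move: xb; rewrite le_eqVlt => /predU1P[->|xb]; first by rewrite (le_trans tb)// lerDl ltW.
have [y [xy yb H]] := l_right ax xb e0.
have : ~ S y by move=> Sy; have : y <= x by [apply: ub_le_sup => //; exists b]; rewrite leNgt xy.
move=> nSy; have ty : t < l y.
  by rewrite ltNge; apply/negP => yt; apply: nSy; split => //; rewrite yb (le_trans ax (ltW xy)).
lra.
Qed.

Local Notation L := (l b).
Local Notation gam := (arc_length_param c a b).

Lemma arc_length_paramP t : 0 <= t <= L -> exists x, [/\ a <= x <= b, l x = t & gam t = c x].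
Proof.
move=> tL; rewrite /arc_length_param.
case: xgetP => [x _ [/=]|].
  by rewrite in_itv/= => xab xt; exists x; split => //; rewrite xt.
have [x xab xt] := l_surj tL => /(_ x) [].
have /andP[ax xb] := xab.
by split; rewrite ?in_itv//= -xt fineK// length_fin.
Qed.

Lemma arc_length_param_lipschitz t u : 0 <= t <= L -> 0 <= u <= L ->
  mdist (gam t) (gam u) <= `|t - u|.
Proof.
move=> tL uL; have [x [/andP[ax xb] <- ->]] := arc_length_paramP tL.
have [y [/andP[ay yb] <- ->]] := arc_length_paramP uL.
have [xy|/ltW yx] := leP x y.
  by rewrite distrC ger0_norm ?subr_ge0 ?l_homo// mdist_le_lB.
by rewrite metric_sym ger0_norm ?subr_ge0 ?l_homo// mdist_le_lB.
Qed.

Lemma arc_length_ge0 : 0 <= L.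
Proof. by rewrite fine_ge0// length_ge0// rectifiable_le. Qed.

Lemma arc_length_param0 : gam 0 = c a.
Proof.
have [x [/andP[ax xb] x0 ->]] := @arc_length_paramP 0 (introT andP (conj (lexx 0) arc_length_ge0)).
apply/esym/mdist_positivity/eqP; rewrite eq_le mdist_ge0 andbT.
by rewrite (le_trans (mdist_le_lB (lexx a) ax xb))// x0 la subrr.
Qed.

Lemma arc_length_paramL : gam L = c b.
Proof.
have [x [/andP[ax xb] x0 ->]] := @arc_length_paramP L (introT andP (conj arc_length_ge0 (lexx L))).
apply/mdist_positivity/eqP; rewrite eq_le mdist_ge0 andbT.
by rewrite (le_trans (mdist_le_lB ax xb (lexx b)))// x0 subrr.
Qed.

End arc_length.

(** * Radii of the holes and separations of the nets *)

(** [level_eq] gives each level capacity of order 1 per unit of area; [level_log] makes the loss of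
    a power eps of the logarithm summable over the levels; [level_le] makes the holes small compared
    with their distances; [level_decr] makes level K finer than all previous ones by a factor 2 K,
    which exceeds any prescribed dilation for K large. *)
Record levels {R : realType} (d : nat) (p l : R) (e r : nat -> R) : Prop := Levels {
  level_e_gt0 : forall i, 0 < e i;
  level_r_gt0 : forall i, 0 < r i;
  level_eq : forall i, r i ^+ d = e i ^+ d.+1 * Psi p l (e i)^-1;
  level_log : forall i, 2 ^+ i <= lne1D (e i)^-1;
  level_le : forall i, 8 * e i <= r i;
  level_decr : forall i, r i.+1 <= r i / (2 * i.+1%:R) }.

Section levels_theory.
Context {R : realType} (d : nat) (p l : R).

Lemma levels_exist : (0 < d)%N -> 1 < p -> p < d.+1%:R ->
  exists e r, levels d p l e r.
Proof.
move=> d0 p1 pd.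
have step (rho : {x : R | 0 < x}) (N : R) : {er : R * {x : R | 0 < x} |
    [/\ 0 < er.1, sval er.2 ^+ d = er.1 ^+ d.+1 * Psi p l er.1^-1, N <= lne1D er.1^-1,
        8 * er.1 <= sval er.2 & sval er.2 <= sval rho]}.
  have [e H] := cid (@Psi_levels R d p l (sval rho) N d0 p1 pd (svalP rho)).
  have [r [e0 r0 re Ne [rr er]]] := cid H.
  by exists (e, exist (fun x : R => 0 < x) r r0).
have half (x : {x : R | 0 < x}) (i : nat) : 0 < sval x / (2 * i.+1%:R).
  by rewrite divr_gt0 ?mulr_gt0// (svalP x).
pose f := fix f i : R * {x : R | 0 < x} := match i with
  | 0 => sval (step (exist (fun x : R => 0 < x) 1 ltr01) 1)
  | j.+1 => sval (step (exist (fun x : R => 0 < x) _ (half (f j).2 j)) (2 ^+ j.+1)) end.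
have f0 := svalP (step (exist (fun x : R => 0 < x) 1 ltr01) 1).
have fS i := svalP (step (exist (fun x : R => 0 < x) _ (half (f i).2 i)) (2 ^+ i.+1)).
have fP i : [/\ 0 < (f i).1, sval (f i).2 ^+ d = (f i).1 ^+ d.+1 * Psi p l (f i).1^-1,
    2 ^+ i <= lne1D (f i).1^-1 & 8 * (f i).1 <= sval (f i).2].
  by case: i => [|i]; [case: f0|case: (fS i)].
exists (fun i => (f i).1), (fun i => sval (f i).2); split => [i|i|i|i|i|i].
- by case: (fP i).
- exact: (svalP (f i).2).
- by case: (fP i).
- by case: (fP i).
- by case: (fP i).
- by case: (fS i).
Qed.

Context (e r : nat -> R) (lv : levels d p l e r).

Lemma level_half i : r i.+1 <= r i / 2.
Proof.
apply: le_trans (level_decr lv i) _; rewrite ler_wpM2l ?(ltW (level_r_gt0 lv i))//.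
by rewrite lef_pV2 ?posrE ?mulr_gt0// ler_peMr// ler1n.
Qed.

Lemma level_anti i j : (i <= j)%N -> r j <= r i.
Proof.
elim: j => [|j ih]; first by rewrite leqn0 => /eqP ->.
rewrite leq_eqVlt => /predU1P[->//|]; rewrite ltnS => /ih; apply: le_trans.
have := level_half j; have := level_r_gt0 lv j; lra.
Qed.

Lemma level_geo i : r i <= r 0%N * 2^-1 ^+ i.
Proof.
elim: i => [|i ih]; first by rewrite expr0 mulr1.
rewrite (le_trans (level_half i))// exprSr mulrA ler_wpM2r//.
Qed.

Lemma level_small (x : R) : 0 < x -> exists N, forall i, (N <= i)%N -> r i < x.
Proof.
move=> x0; have r0 := level_r_gt0 lv 0.
have : 2^-1 ^+ k @[k --> \oo] --> (0 : R).
  by apply: cvg_expr; rewrite ger0_norm// invf_lt1// ltr1n.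
move=> /cvgr_lt /(_ (x / r 0%N)); rewrite divr_gt0// => /(_ isT)[N _ H].
exists N => i Ni; apply: (le_lt_trans (level_geo i)).
by have := H i Ni; rewrite /= ltr_pdivlMr// mulrC.
Qed.

End levels_theory.

Section scaled_map.
Context d (T : measurableType d) (R : realType) (mu : {measure set T -> \bar R})
  (phi : T -> T) (k : R).
Hypotheses (mphi : measurable_fun setT phi) (k0 : 0 <= k).
Hypothesis muphi : forall A, measurable A -> mu (phi @^-1` A) = (k%:E * mu A)%E.
Local Open Scope ereal_scope.

Lemma integral_scaled_map (D : set T) (f : T -> \bar R) : measurable D ->
  measurable_fun setT f -> (forall x, 0 <= f x) ->
  \int[mu]_(x in phi @^-1` D) f (phi x) = k%:E * \int[mu]_(x in D) f x.
Proof.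
move=> mD mf f0.
have := @ge0_integral_pushforward _ _ _ _ R _ mphi mu D f mD _ _.
rewrite /= => <-; last 2 first.
- exact: measurable_funS mf.
- by move=> y _.
rewrite (@eq_measure_integral _ _ _ D (mscale (NngNum k0) mu) (push_measure mu mphi)).
  rewrite ge0_integral_mscale//; exact: measurable_funS mf.
by move=> A mA _; exact: muphi.
Qed.

End scaled_map.

(** * The slit space *)

Section slit_space.
Context {R : realType} (V : normedModType R) (q : nat -> V) (e r : nat -> R).
Local Notation W := (V * R)%type.

Definition gaps : set V :=
  [set x | exists i k, net q (r i) k /\ `|x - q k| < e i].

(* The complement of [~` gaps] x {0}. *)
Definition slit : set W := [set w | w.2 != 0 \/ gaps w.1].

Lemma slit_off (x : V) t : t != 0 -> slit (x, t). Proof. by left. Qed.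

Lemma slit01 : slit (0, 1). Proof. by left; rewrite /= oner_eq0. Qed.

Lemma open_gaps : open gaps.
Proof.
rewrite openE => x [i [k [nk xk]]]; apply/nbhs_ballP.
exists (e i - `|x - q k|); first by rewrite /= subr_gt0.
move=> y; rewrite -ball_normE/= => xy; exists i, k; split => //.
have := ler_normD (y - x) (x - q k); rewrite addrA subrK (distrC y x); lra.
Qed.

Lemma open_slit : open slit.
Proof.
rewrite (_ : slit = snd @^-1` [set~ 0] `|` fst @^-1` gaps); last first.
  by apply/seteqP; split=> w [/eqP|]; [left|right|left|right] => //; apply/eqP.
apply: openU; apply: open_comp.
- by move=> *; exact: cvg_snd.
- by rewrite openC; apply: accessible_closed_set1; apply: hausdorff_accessible; exact: Rhausdorff.
- by move=> *; exact: cvg_fst.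
- exact: open_gaps.
Qed.

Lemma slit_null (dq : dense_seq q) (m : {sigma_finite_measure set (borel V) -> \bar R}) :
  (m \x lebesgue_measure)%E (~` slit : set (borel V * measurableTypeR R)) = 0%E.
Proof.
apply/eqP; rewrite eq_le measure_ge0 andbT.
pose N : set (borel V * measurableTypeR R) := setT `*` [set (0%R : measurableTypeR R)].
have m0 : measurable [set (0%R : measurableTypeR R)].
  by rewrite -set_itv1; exact: measurable_itv.
have mN : measurable N by exact: measurableX.
have N0 : (m \x lebesgue_measure)%E N = 0%E.
  rewrite /N product_measure1E//; transitivity (m setT * 0)%E; last by rewrite mule0.
  by congr (_ * _)%E; exact: lebesgue_measure_set1.
rewrite -N0 le_measure// ?inE//; last first.
  by move=> [x t] /= H; split => //=; apply/eqP/negPn/negP => t0; apply: H; left.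
by apply: measurableC; apply: (open_prodR_measurable dq); exact: open_slit.
Qed.

End slit_space.

(** * Upper gradients along isometric curves *)

Section ug_segment.
Context {R : realType} (W : normedModType R) (S : set W) (w : W) (Sw : S w).
Local Notation X := (restr Sw).
Local Open Scope ereal_scope.

Definition extend_real (u : X -> R) (y : W) : R :=
  if pselect (S y) is left Sy then u (exist _ y (mem_set Sy)) else 0%R.

Lemma extend_realE (u : X -> R) x : extend_real u (emb x) = u x.
Proof.
rewrite /extend_real; case: pselect => [Sx|]; last by case; exact: embS.
by congr u; apply: emb_inj.
Qed.

Lemma ug_segment (u : X -> R) (g : X -> \bar R) (c : R -> W) (a b : R) : open S ->
  upper_gradient u g -> (a <= b)%R ->
  measurable_fun setT (c : measurableTypeR R -> borel W) ->
  (forall x, (a <= x <= b)%R -> S (c x)) ->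
  (forall x y, (a <= x <= b)%R -> (a <= y <= b)%R -> (`|c x - c y| = `|x - y|)%R) ->
  `|extend_real u (c a) - extend_real u (c b)|%:E <=
  \int[lebesgue_measure]_(t in `[a, b]) extend_by0 g (c t).
Proof.
move=> oS [mg g0 ug] ab mc cS ci.
pose c' t : X := if pselect (S (c t)) is left h then exist _ (c t) (mem_set h) else exist _ w (mem_set Sw).
have c'E t : (a <= t <= b)%R -> emb (c' t) = c t.
  by move=> /cS cSt; rewrite /c'; case: pselect.
have aab : (a <= a <= b)%R by rewrite lexx.
have bab : (a <= b <= b)%R by rewrite ab/=.
have c'i x y : (a <= x <= b)%R -> (a <= y <= b)%R -> mdist (c' x) (c' y) = `|x - y|%R.
  by move=> xab yab; rewrite mdist_restr !c'E// ci.
have := ug _ _ _ (isometric_rectifiable ab c'i).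
rewrite -!(extend_realE u) !c'E// => /le_trans; apply.
rewrite (isometric_integral ab c'i).
pose f t := extend_by0 g (c t).
have mf : measurable_fun setT (f : measurableTypeR R -> \bar R).
  by apply: measurableT_comp mc; exact: measurable_extend_by0.
have f0 t : 0 <= f t by exact: extend_by0_ge0.
have mphi : measurable_fun setT (fun t : measurableTypeR R => a + 1 * t : measurableTypeR R)%R.
  by apply: measurable_funD => //; apply: measurable_funM.
have k0 : (0 <= 1^-1 :> R)%R by rewrite invr1.
have := integral_scaled_map mphi k0 (fun A mA => lebesgue_affine a ltr01 mA) (measurable_itv `[a, b]) mf f0.
rewrite invr1 mul1e => <-.
rewrite (_ : _ @^-1` _ = `[0%R, (b - a)%R]%classic); last first.
  by apply/seteqP; split=> t /=; rewrite !in_itv/= mul1r lerDl -lerBrDl.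
rewrite le_eqVlt; apply/orP; left; apply/eqP; apply: eq_integral => t /set_mem /=.
rewrite in_itv/= => /andP[t0 tb].
by rewrite mul1r /f -c'E ?extend_by0E// lerDl t0 -lerBrDl.
Qed.

End ug_segment.
Local Open Scope ereal_scope.

Lemma limn_einf_ge {R : realType} (u : (\bar R)^nat) (c : \bar R) N :
  (forall i, (N <= i)%N -> c <= u i) -> c <= limn_einf u.
Proof.
move=> H; rewrite limn_einf_lim (cvg_lim _ (@cvg_einfs_sup _ u))//.
apply: le_trans (ereal_sup_ubound (_ : range (einfs u) (einfs u N))); last by exists N.
by apply: le_ereal_inf_tmp => _ [i /= Ni <-]; exact: H.
Qed.

Lemma limn_einf_le {R : realType} (u : (\bar R)^nat) (c : \bar R) :
  (forall N, exists2 i, (N <= i)%N & u i <= c) -> limn_einf u <= c.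
Proof.
move=> H; rewrite limn_einf_lim (cvg_lim _ (@cvg_einfs_sup _ u))//.
apply: ge_ereal_sup => _ [N _ <-]; have [i Ni ui] := H N.
by apply: le_trans ui; apply: ereal_inf_lbound; exists i.
Qed.

Lemma nonexpansive_continuous {R : realType} (W : normedModType R) (c : R -> W) :
  (forall x y, `|c x - c y| <= `|x - y|)%R -> continuous c.
Proof.
move=> cl x; apply/cvg_ballP => e e0; apply/nbhs_ballP; exists e => //= y.
by rewrite -!ball_normE/=; exact: le_lt_trans.
Qed.

Lemma nonexpansive_measurable {R : realType} (W : normedModType R) (c : R -> W) :
  (forall x y, `|c x - c y| <= `|x - y|)%R ->
  measurable_fun setT (c : measurableTypeR R -> borel W).
Proof.
move=> cl; apply: measurable_fun_borel => A oA; apply: open_measurable.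
by apply: open_comp => // x _; exact: nonexpansive_continuous.
Qed.

Lemma ler_dist_max {R : realType} (a b h : R) :
  (`|Num.max a h - Num.max b h| <= `|a - b|)%R.
Proof.
have h1 := ler_norm (a - b)%R; have h2 := ler_norm (b - a)%R; rewrite distrC in h2.
rewrite ler_norml; have [?|?] := leP a h; have [?|?] := leP b h; lra.
Qed.

(** * Vertical lines, horizontal segments and cones through the holes *)

Section slit_curves.
Context {R : realType} (d : nat) (p l : R) (V : normedModType R) (q : nat -> V)
  (e r : nat -> R) (lv : levels d p l e r).
Hypotheses (dq : dense_seq q) (unitV : exists v : V, `|v|%R = 1%R).
Local Notation W := (V * R)%type.
Local Notation S := (slit q e r).
Local Notation X := (restr (slit01 q e r)).
Local Notation lam := (@lebesgue_measure R).

Context (u : X -> R) (g : X -> \bar R) (ug : upper_gradient u g).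
Local Notation U := (extend_real u).
Local Notation G := (extend_by0 g).

Lemma G_ge0 w : 0 <= G w.
Proof. by apply: extend_by0_ge0; have [] := ug. Qed.

Lemma G_measurable : measurable_fun setT (G : borel W -> \bar R).
Proof. by apply: measurable_extend_by0; [exact: open_slit|have [] := ug]. Qed.

Lemma G_curve (c : R -> W) : (forall x y, `|c x - c y| = `|x - y|)%R ->
  measurable_fun setT (fun t : measurableTypeR R => G (c t)).
Proof. by move=> ci; apply: measurableT_comp (nonexpansive_measurable _) => [|x y]; [exact: G_measurable|rewrite ci]. Qed.

Lemma ug_isometry (c : R -> W) (a b : R) : (a <= b)%R ->
  (forall x, (a <= x <= b)%R -> S (c x)) ->
  (forall x y, `|c x - c y| = `|x - y|)%R ->
  `|U (c a) - U (c b)|%:E <= \int[lam]_(t in `[a, b]) G (c t).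
Proof.
move=> ab cS ci; apply: (ug_segment (@open_slit R V q e r) ug ab) => //.
by apply: nonexpansive_measurable => x y; rewrite ci.
Qed.

Lemma vertical_isometry (x : V) (s t : R) : (`|(x, s) - (x, t)| = `|s - t|)%R.
Proof. by rewrite prod_normE/= subrr normr0 max_r. Qed.

Lemma ug_vertical (x : V) s t : (s <= t)%R -> (0 < s \/ t < 0)%R ->
  `|U (x, s) - U (x, t)|%:E <= \int[lam]_(y in `[s, t]) G (x, y).
Proof.
move=> st st0; apply: (ug_isometry (c := fun y => (x, y))) => //.
  move=> y /andP[sy yt]; apply: slit_off; case: st0 => [s0|t0].
    by rewrite gt_eqF// (lt_le_trans s0).
  by rewrite lt_eqF// (le_lt_trans yt).
exact: vertical_isometry.
Qed.

(** The segment is first run at unit speed on [0, L], then rescaled to [0, 1]. The parametrization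
    by [0, 1] makes the integrand jointly measurable in the end points. *)
Lemma ug_horizontal (x y : V) t : (t != 0)%R ->
  `|U (x, t) - U (y, t)|%:E <=
  `|x - y|%:E * \int[lam]_(s in `[0%R, 1%R]) G ((x + s *: (y - x))%R, t).
Proof.
move=> t0; have [->|xy] := eqVneq x y.
  by rewrite !subrr !normr0 mul0e.
set L := `|x - y|%R; have L0 : (0 < L)%R by rewrite normr_gt0 subr_eq0.
have vn : (`|L^-1 *: (y - x)| = 1)%R.
  by rewrite normrZ (distrC y) -/L gtr0_norm ?invr_gt0// mulVf// gt_eqF.
pose c (s : R) : W := ((x + s *: (L^-1 *: (y - x)))%R, t).
have ci s s' : (`|c s - c s'| = `|s - s'|)%R.
  rewrite prod_normE/= subrr normr0 max_l// opprD addrACA subrr add0r -scalerBl.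
  by rewrite normrZ vn mulr1.
have := @ug_isometry c 0%R L (ltW L0) (fun s _ => slit_off _ _ _ _ t0) ci.
have -> : c 0%R = (x, t) by rewrite /c scale0r addr0.
have -> : c L = (y, t) by rewrite /c scalerA divff ?gt_eqF// scale1r addrC subrK.
move=> /le_trans; apply.
have mphi : measurable_fun setT (fun s : measurableTypeR R => 0 + L * s : measurableTypeR R)%R.
  by apply: measurable_funD => //; apply: measurable_funM.
have k0 : (0 <= L^-1 :> R)%R by rewrite invr_ge0 ltW.
have := integral_scaled_map mphi k0 (fun A mA => lebesgue_affine 0 L0 mA)
  (measurable_itv `[0%R, L]) (G_curve ci) (fun s => G_ge0 _).
rewrite (_ : _ @^-1` _ = `[0%R, 1%R]%classic); last first.
  apply/seteqP; split=> s /=; rewrite !in_itv/= add0r pmulr_rge0// -{2}(mulr1 L) ler_pM2l//.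
have -> : \int[lam]_(s in `[0%R, 1%R]) G (c (0 + L * s)%R) =
    \int[lam]_(s in `[0%R, 1%R]) G ((x + s *: (y - x))%R, t).
  apply: eq_integral => s _; rewrite /c add0r scalerA mulrAC divff ?mul1r// gt_eqF//.
move=> ->; rewrite muleA -EFinM divff ?mul1e// gt_eqF//.
Qed.

(** The factor 7 is that of [net_dense]: each x lies in the base of some cone of level i. *)
Definition cone_radius i : R := (7 * r i)%R.
Local Notation rho := cone_radius.

Definition cone_scale i (t : R) : R := (Num.max `|t| (e i / 2) / rho i)%R.

(** For fixed x and varying t this is a curve in a double cone with its neck in a hole: it is above
    or below x at heights of modulus [cone_radius i], and within e_i / 2 of the centre of the hole
    at height 0. *)
Definition cone i k (x : V) (t : R) : W := ((q k + cone_scale i t *: (x - q k))%R, t).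

Lemma cone_radius_gt0 i : (0 < rho i)%R.
Proof. by rewrite mulr_gt0// (level_r_gt0 lv). Qed.

Lemma e_le_rho i : (e i / 2 <= rho i)%R.
Proof. rewrite /rho; have := level_le lv i; have := level_r_gt0 lv i; have := level_e_gt0 lv i; lra. Qed.

Lemma cone_scale_gt0 i t : (0 < cone_scale i t)%R.
Proof.
rewrite divr_gt0 ?cone_radius_gt0// lt_max; apply/orP; right.
by rewrite divr_gt0// (level_e_gt0 lv).
Qed.

Lemma cone_scale1 i t : (`|t| = rho i)%R -> cone_scale i t = 1%R.
Proof.
move=> tr; rewrite /cone_scale tr max_l ?e_le_rho// divff// gt_eqF//.
exact: cone_radius_gt0.
Qed.

(** The horizontal component is nonexpansive in the height, so in the sup norm the vertical
    component alone determines the distance. *)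
Lemma cone_isometry i k x s t : (`|x - q k| <= rho i)%R ->
  (`|cone i k x s - cone i k x t| = `|s - t|)%R.
Proof.
move=> xq; have r0 := cone_radius_gt0 i.
rewrite prod_normE/= max_r// opprD addrACA subrr add0r -scalerBl normrZ.
have : (`|cone_scale i s - cone_scale i t| <= `|s - t| / rho i)%R.
  rewrite /cone_scale -mulrBl normrM (gtr0_norm (_ : 0 < (rho i)^-1)%R) ?invr_gt0//.
  rewrite ler_wpM2r ?invr_ge0 ?(ltW r0)//.
  by apply: le_trans (ler_dist_max _ _ _) _; exact: ler_dist_dist.
move=> H; apply: (le_trans (ler_pM _ _ H xq)) => //.
by rewrite divfK// gt_eqF.
Qed.

Lemma cone_slit i k x t : net q (r i) k -> (`|x - q k| <= rho i)%R -> S (cone i k x t).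
Proof.
move=> nk xq; have [->|t0] := eqVneq t 0%R; last exact: slit_off.
right; exists i, k; split => //=; rewrite addrC addKr normrZ gtr0_norm ?cone_scale_gt0//.
rewrite /cone_scale normr0 max_r; last by rewrite divr_ge0// ltW// (level_e_gt0 lv).
apply: (@le_lt_trans _ _ (e i / 2)%R).
  rewrite -mulrA -[leRHS]mulr1 ler_wpM2l//; first by rewrite divr_ge0// ltW// (level_e_gt0 lv).
  by rewrite mulrC ler_pdivrMr ?cone_radius_gt0// mul1r.
by rewrite ltr_pdivrMr// ltr_pMr ?(level_e_gt0 lv)// ltr1n.
Qed.

Definition cone_integral i k x := \int[lam]_(t in `[(- rho i)%R, rho i]) G (cone i k x t).

Lemma ug_cone i k x : net q (r i) k -> (`|x - q k| <= rho i)%R ->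
  `|U (x, - rho i)%R - U (x, rho i)|%:E <= cone_integral i k x.
Proof.
move=> nk xq; have r0 := cone_radius_gt0 i.
have cE t : (`|t| = rho i)%R -> cone i k x t = (x, t).
  by move=> tr; rewrite /cone cone_scale1// scale1r addrC subrK.
have n1 : (`|- rho i| = rho i)%R by rewrite normrN gtr0_norm.
have n2 : (`|rho i| = rho i)%R by rewrite gtr0_norm.
rewrite -(cE _ n1) -(cE _ n2).
apply: (ug_isometry (c := cone i k x)); first by rewrite ge0_cp// ltW.
  by move=> t _; exact: cone_slit.
by move=> s t; exact: cone_isometry.
Qed.

(** Summing over all cones whose base contains x, instead of choosing one, keeps the cost measurable
    in x; the bounded overlap of the cones limits the loss to a constant factor. *)
Definition cone_sum i x :=
  \sum_(k <oo | net q (r i) k && (`|x - q k| < rho i)%R) cone_integral i k x.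

Lemma cone_integral_ge0 i k x : 0 <= cone_integral i k x.
Proof. by apply: integral_ge0 => t _; exact: G_ge0. Qed.

Lemma ug_crossing x s t i : (s <= - rho i)%R -> (rho i <= t)%R ->
  `|U (x, s) - U (x, t)|%:E <= \int[lam]_(y in `[s, t]) G (x, y) + cone_sum i x.
Proof.
move=> si it; have r0 := cone_radius_gt0 i.
have [k nk xk] := net_dense x (level_r_gt0 lv i) dq unitV.
have mG : measurable_fun setT (fun y : measurableTypeR R => G (x, y)).
  by apply: (@G_curve (fun y => (x, y))); exact: vertical_isometry.
have Kk : cone_integral i k x <= cone_sum i x.
  rewrite /cone_sum (@nneseriesD1 _ _ k); [|by move=> *; exact: cone_integral_ge0|by rewrite nk].
  by rewrite leeDl// nneseries_ge0// => *; exact: cone_integral_ge0.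
have m1 : (- rho i < 0)%R by rewrite oppr_lt0.
have h1 := ug_vertical x si (or_intror m1).
have h2 := ug_vertical x it (or_introl r0).
have h3 := le_trans (ug_cone nk (ltW xk)) Kk.
apply: (@le_trans _ _ (\int[lam]_(y in `[s, (- rho i)%R]) G (x, y) +
   \int[lam]_(y in `[rho i, t]) G (x, y) + cone_sum i x)).
  apply: le_trans (leeD (leeD h1 h2) h3); rewrite -!EFinD lee_fin.
  have := ler_distD (U (x, - rho i)%R) (U (x, s)) (U (x, rho i)).
  have := ler_distD (U (x, rho i)%R) (U (x, s)) (U (x, t)); lra.
apply: leeD2r; rewrite -ge0_integral_setU//.
- apply: ge0_subset_integral => //; first exact: measurableU.
  + exact: measurable_funS mG.
  + by move=> *; exact: G_ge0.
  + move=> y [] /=; rewrite !in_itv/= => /andP[y1 y2].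
      by rewrite y1 (le_trans y2)//; lra.
    by rewrite y2 andbT (le_trans _ y1)//; lra.
- exact: measurable_funS mG.
- by move=> *; exact: G_ge0.
- apply/eqP/seteqP; split => // y [/=]; rewrite !in_itv/= => /andP[_ y1] /andP[y2 _]; lra.
Qed.

(** When s and t lie on opposite sides of the wall, every sufficiently fine level can be used for
    the crossing, so only the lower limit of the costs matters. *)
Lemma ug_fiber x a b s t : (a < s < b)%R -> (a < t < b)%R -> s != 0%R -> t != 0%R ->
  `|U (x, s) - U (x, t)|%:E <= \int[lam]_(y in `]a, b[) G (x, y) +
    (if (a < 0 < b)%R then limn_einf (cone_sum ^~ x) else 0).
Proof.
wlog st : s t / (s <= t)%R.
  move=> H sab tab s0 t0; have [st|/ltW ts] := leP s t; first exact: H.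
  by rewrite distrC; exact: H.
move=> /andP[as_ sb] /andP[at_ tb] s0 t0.
have mG : measurable_fun setT (fun y : measurableTypeR R => G (x, y)).
  by apply: (@G_curve (fun y => (x, y))); exact: vertical_isometry.
have sub : \int[lam]_(y in `[s, t]) G (x, y) <= \int[lam]_(y in `]a, b[) G (x, y).
  apply: ge0_subset_integral => //.
  + exact: measurable_funS mG.
  + by move=> *; exact: G_ge0.
  + by move=> y /=; rewrite !in_itv/= => /andP[y1 y2]; rewrite (lt_le_trans as_ y1) (le_lt_trans y2 tb).
have K0 : 0 <= limn_einf (cone_sum ^~ x).
  by apply: (@limn_einf_ge _ _ _ 0%N) => i _; apply: nneseries_ge0 => *; exact: cone_integral_ge0.
have [st0|] := boolP ((0 < s) || (t < 0))%R.
  apply: le_trans (ug_vertical x st (orP st0)) _; apply: le_trans sub _.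
  by rewrite leeDl//; case: ifPn.
rewrite negb_or -!leNgt => /andP[s0' t0'].
have {s0' s0}s0 : (s < 0)%R by rewrite lt_neqAle s0.
have {t0' t0}t0 : (0 < t)%R by rewrite lt_neqAle eq_sym t0.
rewrite ifT; last by rewrite (lt_trans as_)// (lt_trans t0).
apply: (@le_trans _ _ (\int[lam]_(y in `[s, t]) G (x, y) + limn_einf (cone_sum ^~ x))); last exact: leeD2r.
(* The infinite case is settled apart so that the integral can be subtracted before passing to the
   lower limit. *)
have [->|] := eqVneq (\int[lam]_(y in `[s, t]) G (x, y)) +oo.
  by rewrite addye ?leey// gt_eqF// (lt_le_trans _ K0).
rewrite -ltey => Ify.
have Ifin : \int[lam]_(y in `[s, t]) G (x, y) \is a fin_num.
  by rewrite ge0_fin_numE//; apply: integral_ge0 => *; exact: G_ge0.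
rewrite addeC -leeBlDr//.
have m0 : (0 < Num.min t (- s) / 7)%R by rewrite divr_gt0// lt_min t0 oppr_gt0.
have [N HN] := level_small lv m0.
apply: (@limn_einf_ge _ _ _ N) => i /HN; rewrite ltr_pdivlMr// mulrC lt_min => /andP[rt rs].
rewrite leeBlDr// addeC; apply: ug_crossing; rewrite /rho; lra.
Qed.

End slit_curves.

(** * Integration tools: Fubini on rectangles, shrinking domains, power tails *)

Section fubini_rect.
Context d1 d2 (T1 : measurableType d1) (T2 : measurableType d2) (R : realType)
  (m1 : {sigma_finite_measure set T1 -> \bar R})
  (m2 : {sigma_finite_measure set T2 -> \bar R}) (A : set T1) (B : set T2)
  (f : T1 * T2 -> \bar R).
Hypotheses (mA : measurable A) (mB : measurable B) (mf : measurable_fun setT f)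
  (f0 : forall z, 0 <= f z).

Let h := f \_ (A `*` B).

Let mh : measurable_fun setT h.
Proof. by apply/(measurable_restrictT f); [exact: measurableX|exact: measurable_funS mf]. Qed.

Let h0 z : 0 <= h z. Proof. by apply: erestrict_ge0 => ? _; exact: f0. Qed.

Lemma rect_fubini1 :
  \int[m1 \x m2]_(z in A `*` B) f z = \int[m1]_(x in A) \int[m2]_(y in B) f (x, y).
Proof.
rewrite integral_mkcond fubini_tonelli1// [RHS]integral_mkcond.
apply: eq_integral => x _; rewrite /fubini_F [RHS]patchE; case: ifPn => xA.
  rewrite [RHS]integral_mkcond; apply: eq_integral => y _; rewrite !patchE.
  by rewrite in_setX /= xA.
by rewrite integral0_eq// => y _; rewrite patchE in_setX/= (negbTE xA).
Qed.

Lemma rect_fubini2 :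
  \int[m1 \x m2]_(z in A `*` B) f z = \int[m2]_(y in B) \int[m1]_(x in A) f (x, y).
Proof.
rewrite integral_mkcond fubini_tonelli2// [RHS]integral_mkcond.
apply: eq_integral => y _; rewrite /fubini_G [RHS]patchE; case: ifPn => yB.
  rewrite [RHS]integral_mkcond; apply: eq_integral => x _; rewrite !patchE.
  by rewrite in_setX /= yB andbT.
by rewrite integral0_eq// => x _; rewrite patchE in_setX/= (negbTE yB) andbF.
Qed.

End fubini_rect.

Lemma measurable_fiber1 d1 d2 (T1 : measurableType d1) (T2 : measurableType d2) (R : realType)
    (m2 : {sigma_finite_measure set T2 -> \bar R}) (B : set T2) (f : T1 * T2 -> \bar R) :
  measurable B -> measurable_fun setT f -> (forall z, 0 <= f z) ->
  measurable_fun setT (fun x => \int[m2]_(y in B) f (x, y)).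
Proof.
move=> mB mf f0; pose h := f \_ (setT `*` B).
have mh : measurable_fun setT h.
  by apply/(measurable_restrictT f); [exact: measurableX|exact: measurable_funS mf].
have := @measurable_fun_fubini_tonelli_F _ _ T1 T2 R m2 h mh _.
rewrite (_ : fubini_F m2 h = fun x => \int[m2]_(y in B) f (x, y)); first last.
  apply/funext => x; rewrite /fubini_F [RHS]integral_mkcond; apply: eq_integral => y _.
  by rewrite /h !patchE in_setX in_setT.
by apply => z; apply: erestrict_ge0 => ? _; exact: f0.
Qed.

Lemma measurable_fiber2 d1 d2 (T1 : measurableType d1) (T2 : measurableType d2) (R : realType)
    (m1 : {sigma_finite_measure set T1 -> \bar R}) (A : set T1) (f : T1 * T2 -> \bar R) :
  measurable A -> measurable_fun setT f -> (forall z, 0 <= f z) ->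
  measurable_fun setT (fun y => \int[m1]_(x in A) f (x, y)).
Proof.
move=> mA mf f0; pose h := f \_ (A `*` setT).
have mh : measurable_fun setT h.
  by apply/(measurable_restrictT f); [exact: measurableX|exact: measurable_funS mf].
have := @measurable_fun_fubini_tonelli_G _ _ T1 T2 R m1 h mh _.
rewrite (_ : fubini_G m1 h = fun y => \int[m1]_(x in A) f (x, y)); first last.
  apply/funext => y; rewrite /fubini_G [RHS]integral_mkcond; apply: eq_integral => x _.
  by rewrite /h !patchE in_setX in_setT andbT.
by apply => z; apply: erestrict_ge0 => ? _; exact: f0.
Qed.

Lemma shrinking_integral_cvg0 d (T : measurableType d) (R : realType)
    (mu : {measure set T -> \bar R}) (A : (set T)^nat) (f : T -> \bar R) :
  (forall i, measurable (A i)) -> (forall i j, (i <= j)%N -> A j `<=` A i) ->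
  measurable_fun setT f -> (forall x, 0 <= f x) ->
  \int[mu]_(x in A 0%N) f x < +oo -> mu (\bigcap_i A i) = 0 ->
  \int[mu]_(x in A i) f x @[i --> \oo] --> 0.
Proof.
move=> mA ndA mf f0 fin cap0.
have mcap : measurable (\bigcap_i A i) by exact: bigcapT_measurable.
pose F i := A 0%N `\` A i.
have mF i : measurable (F i) by exact: measurableD.
have FE : \bigcup_i F i = A 0%N `\` \bigcap_i A i.
  apply/seteqP; split => [x [i _ [A0 nAi]]|x [A0 /existsNP[i /not_implyP[_ nAi]]]].
    by split => // H; apply: nAi; exact: H.
  by exists i.
have mono : nondecreasing_seq F.
  by move=> i j ij; apply/subsetPset => x [? nA]; split => // Aj; apply: nA; exact: ndA Aj.
have cv := @ge0_nondecreasing_set_cvg_integral _ _ _ F f mu mono mF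
  (fun i => measurable_funS measurableT (@subsetT _ _) mf) (fun i x _ => f0 x).
have tot i : \int[mu]_(x in A 0%N) f x = \int[mu]_(x in F i) f x + \int[mu]_(x in A i) f x.
  rewrite -ge0_integral_setU//.
  - by rewrite setUC setDUK//; exact: ndA.
  - exact: measurable_funS mf.
  - by apply/eqP/seteqP; split => // x [[_ ?]].
have finF i : \int[mu]_(x in F i) f x \is a fin_num.
  rewrite ge0_fin_numE ?integral_ge0//; apply: le_lt_trans fin.
  by rewrite (tot i) leeDl// integral_ge0.
have AE i : \int[mu]_(x in A i) f x = \int[mu]_(x in A 0%N) f x - \int[mu]_(x in F i) f x.
  by rewrite (tot i) addeAC subee// add0e.
under eq_fun do rewrite AE.
have finA : \int[mu]_(x in A 0%N) f x \is a fin_num by rewrite ge0_fin_numE ?integral_ge0.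
have E0 : \int[mu]_(x in \bigcup_i F i) f x = \int[mu]_(x in A 0%N) f x.
  rewrite FE; apply/esym; apply: ge0_negligible_integral => //; exact: measurable_funS mf.
rewrite -(subee finA) -{2}E0; apply: cvgeB.
- by rewrite fin_num_adde_defr// E0 fin_numN.
- exact: cvg_cst.
- exact: cv.
Qed.

Lemma Psi_extE {R : realType} (p l : R) : Psi_ext p l = er_map (Psi p l).
Proof. by apply/funext => -[]. Qed.

Lemma Psi_ext_ge0 {R : realType} (p l : R) (x : \bar R) : 0 <= x -> 0 <= Psi_ext p l x.
Proof. by case: x => [x|//|//] _; rewrite /= lee_fin Psi_ge0. Qed.

Lemma measurable_Psi_ext d (T : measurableType d) {R : realType} (p l : R) (f : T -> \bar R) :
  measurable_fun setT f -> measurable_fun setT (fun x => Psi_ext p l (f x)).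
Proof.
move=> mf; rewrite Psi_extE.
have mP : measurable_fun setT (Psi p l).
  apply: measurable_funM; first exact: measurable_powR.
  apply: (measurableT_comp (measurable_powR l)); apply: measurableT_comp => //.
  by apply: measurable_funD.
by apply: measurableT_comp mf; exact: measurable_er_map.
Qed.

Lemma geometric_nneseries {R : realType} (a z : R) : (0 <= a)%R -> (0 <= z < 1)%R ->
  \sum_(j <oo) (a * z ^+ j)%:E <= (a * (1 - z)^-1)%:E.
Proof.
move=> a0 /andP[z0 z1].
apply: lime_le; first by apply: is_cvg_nneseries => j _ _; rewrite lee_fin mulr_ge0 ?exprn_ge0.
apply: nearW => N; rewrite sumEFin lee_fin -mulr_sumr ler_wpM2l//.
have -> : (\sum_(0 <= i < N) z ^+ i = (1 - z ^+ N) / (1 - z))%R.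
  elim: N => [|N ih]; first by rewrite big_nil expr0 subrr mul0r.
  by rewrite big_nat_recr//= ih exprSr; field; rewrite subr_eq0 eq_sym lt_eqF.
by rewrite ler_piMl ?invr_ge0 ?subr_ge0 ?(ltW z1)// lerBlDr lerDl exprn_ge0.
Qed.

(* The integrand equals the largest of the dyadic step functions in the proof up to a constant. *)
Lemma tail_integral {R : realType} (b : R) : (1 < b)%R -> exists2 C, (0 < C)%R &
  forall e, (0 < e)%R -> \int[@lebesgue_measure R]_t
    (e^-1 * (Num.max `|t| (e / 2) / e) `^ (- b))%:E <= C%:E.
Proof.
move=> b1; have z1 : (2 `^ (1 - b) < 1 :> R)%R.
  by rewrite -[1%R in ltRHS](expR0) /powR pnatr_eq0/= ltr_expR nmulr_rlt0 ?ln_gt0 ?ltr1n//; lra.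
have z0 : (0 < 2 `^ (1 - b) :> R)%R by rewrite powR_gt0.
pose a : R := (2 * 2 `^ b)%R.
have a0 : (0 < a)%R by rewrite mulr_gt0 ?powR_gt0.
exists (a * (1 - 2 `^ (1 - b))^-1)%R.
  by rewrite mulr_gt0// invr_gt0 subr_gt0.
move=> e e0.
pose c j : R := (e^-1 * (2 `^ b * 2 `^ (- (b * j%:R))))%R.
have c0 j : (0 <= c j)%R by rewrite mulr_ge0 ?mulr_ge0 ?powR_ge0// invr_ge0 ltW.
pose I j : set (measurableTypeR R) := `[(- (2 ^+ j * e))%R, (2 ^+ j * e)%R]%classic.
have mI j : measurable (I j) by exact: measurable_itv.
have pt (t : R) : (e^-1 * (Num.max `|t| (e / 2) / e) `^ (- b))%:E <=
    \sum_(j <oo) ((c j)%:E * (\1_(I j) t)%:E).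
  have [k kt] : exists k, (`|t| <= 2 ^+ k * e)%R.
    exists (Num.bound (`|t| / e)); rewrite -ler_pdivrMr//.
    apply: (le_trans (ltW (archi_boundP _))); first by rewrite divr_ge0// ltW.
    by rewrite -natrX ler_nat ltnW// ltn_expl.
  (* For the least such level j, minimality gives |t| > 2^(j-1) e when j > 0; for j = 0 the cutoff
     [e / 2] in the integrand plays this part. *)
  have := @ex_minnP (fun k => `|t| <= 2 ^+ k * e)%R (ex_intro _ k kt).
  move=> [j tj jmin].
  apply: (@le_trans _ _ ((c j)%:E * (\1_(I j) t)%:E)); last first.
    rewrite (@nneseriesD1 _ _ j)//; last by move=> i _; rewrite mule_ge0// lee_fin.
    by rewrite leeDl// nneseries_ge0// => i _ _; rewrite mule_ge0// lee_fin.
  rewrite indicE mem_set ?mule1; last by rewrite /I/= in_itv/= -ler_norml.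
  rewrite lee_fin /c ler_wpM2l ?invr_ge0 ?(ltW e0)//.
  have v : (2 `^ (j%:R - 1) <= Num.max `|t| (e / 2) / e)%R.
    rewrite ler_pdivlMr// le_max.
    case: j tj jmin => [|j] tj jmin.
      by rewrite mulr0n sub0r powR_inv1// (mulrC _ e) lexx orbT.
    have /negP : ~ (`|t| <= 2 ^+ j * e)%R by move=> /jmin; rewrite ltnn.
    rewrite (_ : (j.+1%:R - 1 = j%:R :> R)%R); last by rewrite -[j.+1%:R]natr1 addrK.
    by rewrite powR_mulrn// -ltNge => /ltW ->.
  rewrite powRN -[leRHS]invrK lef_pV2 ?posrE; last 2 first.
  - by rewrite powR_gt0// (lt_le_trans _ v)// powR_gt0.
  - by rewrite invr_gt0 mulr_gt0// powR_gt0.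
  rewrite invfM -!powRN opprK -powRD; last by rewrite pnatr_eq0 implybT.
  rewrite (_ : - b + b * j%:R = (j%:R - 1) * b)%R; last ring.
  by rewrite powRrM ge0_ler_powR ?nnegrE ?powR_ge0//; [lra|rewrite (le_trans _ v)// powR_ge0].
apply: (@le_trans _ _ (\int[@lebesgue_measure R]_t \sum_(j <oo) ((c j)%:E * (\1_(I j) t)%:E))).
  apply: ge0_le_integral => //.
  - by move=> t _; rewrite lee_fin mulr_ge0 ?powR_ge0// invr_ge0 ltW.
  - apply/measurable_EFinP; apply: measurable_funM => //.
    apply: (measurableT_comp (measurable_powR (- b))).
    apply: measurable_funM => //; apply: measurable_maxr => //.
  - apply: ge0_emeasurable_sum => [j t _ _|j _]; first by rewrite mule_ge0// lee_fin.
    by apply: measurable_funeM; exact: measurableT_comp.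
rewrite integral_nneseries//; last 2 first.
  - by move=> j; apply: measurable_funeM; exact: measurableT_comp.
  - by move=> j t _; rewrite mule_ge0// lee_fin.
have -> : \sum_(j <oo) \int[@lebesgue_measure R]_t ((c j)%:E * (\1_(I j) t)%:E) =
    \sum_(j <oo) (a * (2 `^ (1 - b)) ^+ j)%:E.
  apply: eq_eseriesr => j _.
  rewrite ge0_integralZl_EFin//; last exact: measurableT_comp.
  have p0 : (0 < 2 ^+ j * e :> R)%R by rewrite mulr_gt0// exprn_gt0.
  transitivity ((c j)%:E * (2 ^+ j * e + 2 ^+ j * e)%:E).
    congr (_ * _); rewrite integral_indic// setIT.
    rewrite -[LHS]/(lebesgue_measure `[(- (2 ^+ j * e))%R, (2 ^+ j * e)%R]%classic).
    rewrite lebesgue_measure_itv/= lte_fin ifT ?EFinN ?oppeK//.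
    by rewrite (lt_trans _ p0)// oppr_lt0.
  rewrite -EFinM; congr EFin.
  rewrite /c /a -[X in (_ = _ * X)%R]powR_mulrn ?powR_ge0// -powRrM mulrBl mul1r.
  rewrite powRD ?pnatr_eq0 ?implybT// powR_mulrn//.
  by field; rewrite gt_eqF.
by apply: geometric_nneseries; [exact: ltW|rewrite powR_ge0].
Qed.

(** * The cost of crossing the wall and its vanishing in the limit *)

Section cone_estimate.
Context {R : realType} (d : nat) (p l : R) (V : normedModType R) (q : nat -> V)
  (e r : nat -> R) (lv : levels d p l e r)
  (m : {sigma_finite_measure set (borel V) -> \bar R}) (bm : box_space d m).
Hypotheses (dq : dense_seq q) (p1 : (1 < p)%R) (pd : (p < d.+1%:R)%R).
Local Notation W := (V * R)%type.
Local Notation T := (borel V * measurableTypeR R)%type.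
Local Notation S := (slit q e r).
Local Notation X := (restr (slit01 q e r)).
Local Notation lam := (@lebesgue_measure R).
Local Notation rho := (cone_radius r).

Context (u : X -> R) (g : X -> \bar R) (ug : upper_gradient u g).
Local Notation G := (extend_by0 g).

Lemma prod_borel_measurable : measurable_fun setT (id : T -> borel W).
Proof. by apply: measurable_fun_borel => A oA; exact: (open_prodR_measurable dq). Qed.

Lemma G_prod_measurable : measurable_fun setT (G : T -> \bar R).
Proof. exact: measurableT_comp (G_measurable ug) prod_borel_measurable. Qed.

Definition Psi_energy (w : W) : \bar R := Psi_ext p l (G w).
Local Notation F := Psi_energy.

Lemma F_ge0 w : 0 <= F w.
Proof. by apply: Psi_ext_ge0; exact: (G_ge0 ug). Qed.

Lemma F_measurable : measurable_fun setT (F : T -> \bar R).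
Proof. exact: (measurable_Psi_ext p l G_prod_measurable). Qed.

Lemma measurable_zoom (a : V) (h : R -> R) :
  measurable_fun setT (h : measurableTypeR R -> measurableTypeR R) ->
  measurable_fun setT (fun z : T => ((a + h z.2 *: (z.1 - a))%R, z.2) : T).
Proof.
move=> mh; apply: measurable_fun_pair => //.
apply: (@measurableT_comp _ _ _ _ T _ (fun z : T => (a + z.2 *: (z.1 - a))%R : borel V) _
  (fun z : T => (z.1, h z.2))).
  apply: measurable_fun_borel => A oA; apply: (open_prodR_measurable dq).
  apply: (@open_comp W V (fun z => a + z.2 *: (z.1 - a))%R) => // z _.
  apply: (@cvgD _ _ _ _ _ (fun=> a) (fun z : W => z.2 *: (z.1 - a))%R); first exact: cvg_cst.
  by apply: cvgZ; [exact: cvg_snd|apply: cvgB; [exact: cvg_fst|exact: cvg_cst]].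
by apply: measurable_fun_pair => //; exact: measurableT_comp.
Qed.

Lemma measurable_cone i k : measurable_fun setT (fun z : T => G (cone q e r i k z.1 z.2)).
Proof.
apply: (measurableT_comp G_prod_measurable (measurable_zoom (q k) (h := cone_scale e r i) _)).
apply: measurable_funM => //; apply: measurable_maxr => //; exact: normr_measurable.
Qed.

Lemma measurable_cone_integral i k :
  measurable_fun setT (cone_integral g i k : borel V -> \bar R).
Proof.
apply: (@measurable_fiber1 _ _ _ _ R lam _ (fun z : T => G (cone q e r i k z.1 z.2))) => //.
  exact: measurable_cone.
by move=> z; exact: (G_ge0 ug).
Qed.

Lemma scaled_ball_integral (a : V) (s c : R) (f : borel V -> \bar R) :
  (0 < s)%R -> (0 < c)%R -> measurable_fun setT f -> (forall y, 0 <= f y) ->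
  \int[m]_(x in ball a c) f (a + s *: (x - a))%R =
  (s^-1 ^+ d)%:E * \int[m]_(y in ball a (s * c)%R) f y.
Proof.
move=> s0 c0 mf f0.
pose phi (x : borel V) : borel V := ((a - s *: a) + s *: (x : V))%R.
have mphi : measurable_fun setT phi.
  apply: measurable_fun_borel => A oA; apply: borel_open.
  apply: (@open_comp V V (fun x => a - s *: a + s *: x)%R) => // x _.
  apply: (@cvgD _ _ _ _ _ (fun=> a - s *: a)%R (fun x : V => s *: x)%R); first exact: cvg_cst.
  by apply: cvgZ; [exact: cvg_cst|].
have k0 : (0 <= s^-1 ^+ d)%R by rewrite exprn_ge0// invr_ge0 ltW.
have phiE x : phi x = (a + s *: (x - a))%R by rewrite /phi scalerBr addrA addrAC.
rewrite -(integral_scaled_map mphi k0 (fun A mA => box_affine bm _ s0 mA) (ball_measurable a (s * c)%R) mf f0).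
rewrite (_ : phi @^-1` _ = ball a c); last first.
  apply/seteqP; split=> x; rewrite /= phiE -!ball_normE/= opprD addrA subrr sub0r normrN;
    by rewrite normrZ gtr0_norm// ltr_pM2l// distrC.
by apply: eq_integral => x _; rewrite phiE.
Qed.

(** At fixed height apply [Psi_young], then the substitution x -> q_k + s (x - q_k), whose factor
    s^(-d) cancels (7 s)^d up to 7^d; then integrate the tail in t. C is independent of B, and A is
    independent of the hole and of its level. *)
Lemma cone_integral_bound : exists C, (0 < C)%R /\ forall B, (0 < B <= 1)%R ->
  exists A, (0 < A)%R /\ forall i k,
  \int[m]_(x in ball (q k) (rho i)) cone_integral g i k x <=
  A%:E * (\int[m \x lam]_(z in ball (q k) (rho i) `*` `[(- rho i)%R, rho i]) F z) +
  (B * C * (2 * rho i) ^+ d)%:E.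
Proof.
have [b b1 young] := Psi_young l p1 pd.
have [C C0 tail] := @tail_integral R b b1.
exists C; split => // B B01; have [A A0 {}young] := young B B01.
exists (A * 7 ^+ d)%R; split; first by rewrite mulr_gt0// exprn_gt0.
move=> i k; have rho0 := cone_radius_gt0 lv i.
have e0 := level_e_gt0 lv i; have r0 := level_r_gt0 lv i.
have B0 : (0 < B)%R by case/andP: B01.
set I := (`[(- rho i)%R, rho i]%classic : set (measurableTypeR R)).
set D := (ball (q k) (rho i) : set (borel V)).
have mI : measurable I by exact: measurable_itv.
have mD : measurable D by exact: ball_measurable.
pose f (z : T) := G (cone q e r i k z.1 z.2).
have f0 z : 0 <= f z by exact: (G_ge0 ug).
have mf : measurable_fun setT f by exact: measurable_cone.
pose h (t : R) : R := ((e i)^-1 * (Num.max `|t| (e i / 2) / e i) `^ (- b))%R.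
have h0 t : (0 <= h t)%R by rewrite mulr_ge0 ?powR_ge0// invr_ge0 ltW.
have mh : measurable_fun setT (fun t : measurableTypeR R => (h t)%:E).
  apply/measurable_EFinP; apply: measurable_funM => //.
  apply: (measurableT_comp (measurable_powR (- b))).
  by apply: measurable_funM => //; apply: measurable_maxr => //; exact: normr_measurable.
rewrite -[leLHS](rect_fubini1 m lam mD mI mf f0) (rect_fubini2 m lam mD mI mf f0).
rewrite (rect_fubini2 m lam mD mI F_measurable F_ge0).
pose Phi (t : measurableTypeR R) := \int[m]_(x in D) F (x, t).
have mPhi : measurable_fun setT Phi.
  by apply: (measurable_fiber2 m mD F_measurable F_ge0).
have Phi0 t : 0 <= Phi t by apply: integral_ge0 => x _; exact: F_ge0.
have mfib : measurable_fun setT (fun t : measurableTypeR R => \int[m]_(x in D) f (x, t)).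
  exact: (measurable_fiber2 m mD mf f0).
have c1 : (0 <= A * 7 ^+ d)%R by rewrite mulr_ge0 ?exprn_ge0// ltW.
have c2 : (0 <= B * (2 * rho i) ^+ d)%R by rewrite mulr_ge0 ?exprn_ge0 ?mulr_ge0 ?(ltW B0)// ltW.
have fiber (t : R) : I t -> \int[m]_(x in D) f (x, t) <=
    (A * 7 ^+ d)%:E * Phi t + (B * (2 * rho i) ^+ d)%:E * (h t)%:E.
  rewrite /I/= in_itv/= -ler_norml => tr.
  set s := cone_scale e r i t; have s0 : (0 < s)%R by exact: cone_scale_gt0 lv _ _.
  have s1 : (s <= 1)%R.
    by rewrite /s /cone_scale ler_pdivrMr// mul1r ge_max tr (e_le_rho lv).
  pose Ft (x : borel V) := F (x, t).
  have mFt : measurable_fun setT Ft by exact: measurableT_comp F_measurable (pair2_measurable t).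
  have mFs : measurable_fun setT (fun x : borel V => Ft (q k + s *: (x - q k))%R).
    have mz := measurable_zoom (q k) (h := fun=> s) (@measurable_cst _ _ _ _ _ s).
    exact: measurableT_comp F_measurable (measurableT_comp mz (pair2_measurable t)).
  have c3 : (0 <= A * (7 * s) ^+ d)%R.
    by rewrite mulr_ge0 ?exprn_ge0 ?(ltW A0)// mulr_ge0// ltW.
  apply: (@le_trans _ _ (\int[m]_(x in D)
      ((A * (7 * s) ^+ d)%:E * Ft (q k + s *: (x - q k))%R + (B * h t)%:E))).
    apply: ge0_le_integral => //.
    - by apply: measurable_funS (measurableT_comp mf (pair2_measurable t)).
    - apply: measurable_funS measurableT (@subsetT _ _) _.
      by apply: emeasurable_funD => //; exact: measurable_funeM.
    move=> x _; rewrite /f /cone /= -/s /Ft /F.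
    have := G_ge0 ug ((q k + s *: (x - q k))%R, t).
    case: (G _) => [a|_|//]; last first.
      have c4 : (0 < A * (7 * s) ^+ d)%R by rewrite mulr_gt0// exprn_gt0// mulr_gt0.
      by rewrite (_ : Psi_ext p l +oo = +oo)// gt0_muley ?lte_fin// addye.
    rewrite lee_fin => a0; rewrite (_ : Psi_ext p l a%:E = (Psi p l a)%:E)// -EFinM -EFinD lee_fin.
    have v2 : (2^-1 <= Num.max `|t| (e i / 2) / e i)%R.
      by rewrite ler_pdivlMr// le_max (mulrC _ (e i)) lexx orbT.
    have := young _ _ e0 r0 (level_eq lv i) _ _ v2 a0.
    rewrite divfK ?gt_eqF// (_ : Num.max _ _ / r i = 7 * s)%R; last first.
      by rewrite /s /cone_scale /cone_radius; field; rewrite gt_eqF.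
    by rewrite /h (mulrA B).
  rewrite ge0_integralD//; try first
    [by move=> x _; rewrite mule_ge0 ?F_ge0
    |by apply: measurable_funeM; apply: measurable_funS mFs
    |by move=> x _; rewrite lee_fin mulr_ge0// ltW].
  rewrite ge0_integralZl_EFin//; try first
    [by move=> x _; exact: F_ge0|by apply: measurable_funS mFs].
  have -> : \int[m]_(_ in D) (B * h t)%:E = (B * h t)%:E * ((2 * rho i) ^+ d)%:E.
    by rewrite integral_cst//; congr (_ * _); exact: (box_ball bm).
  rewrite (scaled_ball_integral (q k) s0 rho0 mFt); last by move=> y; exact: F_ge0.
  rewrite muleA -EFinM -EFinM; apply: leeD; last first.
    by rewrite -EFinM lee_fin le_eqVlt; apply/orP; left; apply/eqP; ring.
  rewrite (_ : A * _ * _ = A * 7 ^+ d)%R; last first.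
    by rewrite exprMn exprVn; field; rewrite expf_neq0// gt_eqF.
  apply: lee_wpmul2l; first by rewrite lee_fin.
  apply: ge0_subset_integral => //; first exact: ball_measurable.
  - exact: measurable_funS mFt.
  - by move=> x _; exact: F_ge0.
  - by apply: le_ball; rewrite ler_piMl// ltW.
apply: (@le_trans _ _ (\int[lam]_(t in I)
  ((A * 7 ^+ d)%:E * Phi t + (B * (2 * rho i) ^+ d)%:E * (h t)%:E))).
  apply: ge0_le_integral => //.
  - by move=> t _; apply: integral_ge0 => x _.
  - exact: measurable_funS mfib.
  - apply: measurable_funS measurableT (@subsetT _ _) _.
    by apply: emeasurable_funD; exact: measurable_funeM.
rewrite ge0_integralD//; try first
  [by move=> t _; rewrite mule_ge0
  |by apply: measurable_funeM; apply: measurable_funS mPhi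
  |by apply: measurable_funeM; apply: measurable_funS mh].
rewrite ge0_integralZl_EFin//; try by apply: measurable_funS mPhi.
rewrite ge0_integralZl_EFin//; try by apply: measurable_funS mh.
apply: leeD2l; rewrite (_ : B * C * _ = (B * (2 * rho i) ^+ d) * C)%R; last ring.
rewrite [leRHS]EFinM; apply: lee_wpmul2l; first by rewrite lee_fin.
apply: le_trans (tail _ e0); apply: ge0_subset_integral => //.
all: by move=> x _; rewrite ?mule_ge0 ?lee_fin.
Qed.

End cone_estimate.

(** Each point lies in a bounded number of the balls, by [separated_count]. *)
Lemma overlap_integral {R : realType} (n : nat) (V : normedModType R)
    (m : {sigma_finite_measure set (borel V) -> \bar R}) (bm : box_space n m)
    (q : nat -> V) (P : pred nat) (r rho : R) (D : set (borel V)) (f : borel V -> \bar R) :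
  (0 < r)%R -> (0 < rho)%R ->
  (forall j k, P j -> P k -> j != k -> (r <= `|q j - q k|)%R) ->
  measurable D -> measurable_fun setT f -> (forall x, 0 <= f x) ->
  (forall k, P k -> ball (q k) rho `<=` (D : set V)) ->
  \sum_(k <oo | P k) \int[m]_(x in ball (q k) rho) f x <=
  (((2 * rho + r) / r) ^+ n)%:E * \int[m]_(x in D) f x.
Proof.
move=> r0 rho0 sep mD mf f0 sub.
set K := (((2 * rho + r) / r) ^+ n)%R.
have K0 : (0 <= K)%R by rewrite exprn_ge0// divr_ge0 ?ltW// addr_gt0// mulr_gt0.
pose h k (x : borel V) := if P k then (f \_ (ball (q k) rho : set (borel V))) x else 0.
have h0 k x : 0 <= h k x by rewrite /h; case: ifP => // _; exact: erestrict_ge0.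
have mh k : measurable_fun setT (h k).
  rewrite /h; case: (P k) => //.
  by apply/(measurable_restrictT f); [exact: ball_measurable|exact: measurable_funS mf].
have -> : \sum_(k <oo | P k) \int[m]_(x in ball (q k) rho) f x = \int[m]_x \sum_(k <oo) h k x.
  rewrite integral_nneseries// [LHS]eseries_mkcond; apply: eq_eseriesr => k _.
  rewrite /h; case: (P k); first by rewrite [LHS]integral_mkcond.
  by rewrite integral0.
rewrite -ge0_integralZl_EFin//; last exact: measurable_funS mf.
rewrite [leRHS]integral_mkcond; apply: ge0_le_integral => //.
- by move=> x _; exact: nneseries_ge0.
- by apply: ge0_emeasurable_sum.
- apply/(measurable_restrictT (fun x => K%:E * f x)) => //.
  by apply: measurable_funeM; exact: measurable_funS mf.
move=> x _; have hE : \sum_(k <oo) h k x = \sum_(k <oo | P k && (`|x - q k| < rho)%R) f x.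
  rewrite [RHS]eseries_mkcond; apply: eq_eseriesr => k _; rewrite /h patchE.
  case: (P k) => //=; congr (if _ then _ else _); apply/idP/idP.
    by move=> /set_mem; rewrite -ball_normE/= distrC.
  by move=> H; apply/mem_set; rewrite -ball_normE/= distrC.
rewrite hE patchE; case: ifPn => [_|xD]; last first.
  rewrite eseries0// => k _ /andP[Pk xk]; case/negP: xD; apply/mem_set.
  by apply: (sub k Pk); rewrite -ball_normE/= distrC.
case: (f x) (f0 x) => [a|_|//]; last first.
  by rewrite gt0_muley ?leey// lte_fin exprn_gt0// divr_gt0// addr_gt0// mulr_gt0.
rewrite lee_fin => a0.
have r1 : (0 < r ^+ n)%R by rewrite exprn_gt0.
have -> : \sum_(k <oo | P k && (`|x - q k| < rho)%R) a%:E =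
    (a / r ^+ n)%:E * \sum_(k <oo | P k && (`|x - q k| < rho)%R) (r ^+ n)%:E.
  rewrite -nneseriesZl; last by move=> *; rewrite lee_fin ltW.
  by apply: eq_eseriesr => k _; rewrite -EFinM divfK// gt_eqF.
apply: (@le_trans _ _ ((a / r ^+ n)%:E * ((2 * rho + r) ^+ n)%:E)).
  apply: lee_wpmul2l; first by rewrite lee_fin divr_ge0// ltW.
  exact: separated_count bm _ _ _ _ x r0 rho0 sep.
rewrite -!EFinM lee_fin /K expr_div_n le_eqVlt; apply/orP; left; apply/eqP; field.
by rewrite gt_eqF.
Qed.

Section cone_sum.
Context {R : realType} (d : nat) (p l : R) (V : normedModType R) (q : nat -> V)
  (e r : nat -> R) (lv : levels d p l e r)
  (m : {sigma_finite_measure set (borel V) -> \bar R}) (bm : box_space d m).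
Hypotheses (dq : dense_seq q) (p1 : (1 < p)%R) (pd : (p < d.+1%:R)%R).
Local Notation T := (borel V * measurableTypeR R)%type.
Local Notation X := (restr (slit01 q e r)).
Local Notation lam := (@lebesgue_measure R).
Local Notation rho := (cone_radius r).
Context (u : X -> R) (g : X -> \bar R) (ug : upper_gradient u g).
Local Notation F := (Psi_energy p l g).

Let hk i k (x : borel V) : \bar R :=
  if net q (r i) k then (cone_integral g i k \_ (ball (q k) (rho i) : set (borel V))) x else 0.

Let hk_ge0 i k x : 0 <= hk i k x.
Proof.
rewrite /hk; case: ifP => // _; apply: erestrict_ge0 => y _; exact: cone_integral_ge0 ug _ _ _.
Qed.

Let measurable_hk i k : measurable_fun setT (hk i k).
Proof.
rewrite /hk; case: (net _ _ _) => //.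
apply/(measurable_restrictT (cone_integral g i k : borel V -> \bar R)).
  exact: ball_measurable.
exact: measurable_funS (measurable_cone_integral dq ug i k).
Qed.

Let cone_sumE i x : cone_sum g i x = \sum_(k <oo) hk i k x.
Proof.
rewrite /cone_sum eseries_mkcond; apply: eq_eseriesr => k _; rewrite /hk patchE.
case: (net _ _ _) => //=; congr (if _ then _ else _); apply/idP/idP.
  by move=> H; apply/mem_set; rewrite -ball_normE/= distrC.
by move=> /set_mem; rewrite -ball_normE/= distrC.
Qed.

Lemma cone_sum_ge0 i x : 0 <= cone_sum g i x.
Proof. by rewrite cone_sumE; exact: nneseries_ge0. Qed.

Lemma measurable_cone_sum i : measurable_fun setT (cone_sum g i : borel V -> \bar R).
Proof.
rewrite (_ : cone_sum g i = fun x => \sum_(k <oo) hk i k x); last exact/funext/cone_sumE.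
exact: ge0_emeasurable_sum.
Qed.

(** The bound for one cone is summed over the holes of level i near the ball: the energies have
    bounded overlap, and the number of holes is at most a multiple of r_i^(-d), which compensates
    the volume (2 rho_i)^d of a base. *)
Lemma cone_sum_bound (x0 : V) (R0 : R) : (0 < R0)%R -> exists C, (0 < C)%R /\
  forall B, (0 < B <= 1)%R -> exists A, (0 < A)%R /\ forall i, (2 * rho i <= R0)%R ->
  \int[m]_(x in ball x0 R0) cone_sum g i x <=
  A%:E * (\int[m \x lam]_(z in ball x0 (2 * R0)%R `*` `[(- rho i)%R, rho i]) F z) + (B * C)%:E.
Proof.
move=> R00; have [C [C0 HC]] := cone_integral_bound lv bm dq p1 pd ug.
(* 14 comes from 2 rho_i = 14 r_i, and 5 R0 bounds the quantity 2 (R0 + rho_i) + r_i of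
   [separated_count]. Below, 15 = (2 rho_i + r_i) / r_i is the overlap constant. *)
exists (C * 14 ^+ d * (5 * R0) ^+ d)%R; split.
  by rewrite !mulr_gt0// exprn_gt0// mulr_gt0.
move=> B B01; have [A [A0 HA]] := HC B B01.
exists (A * 15 ^+ d)%R; split; first by rewrite mulr_gt0// exprn_gt0.
move=> i rR; have r0 := level_r_gt0 lv i; have rho0 := cone_radius_gt0 lv i.
have B0 : (0 < B)%R by case/andP: B01.
pose P k := net q (r i) k && (`|x0 - q k| < R0 + rho i)%R.
have sep j k : P j -> P k -> j != k -> (r i <= `|q j - q k|)%R.
  by move=> /andP[nj _] /andP[nk _]; exact: net_separated.
set I := (`[(- rho i)%R, rho i]%classic : set (measurableTypeR R)).
have mI : measurable I by exact: measurable_itv.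
pose Phi (x : borel V) := \int[lam]_(t in I) F (x, t).
have mPhi : measurable_fun setT Phi.
  exact: (measurable_fiber1 lam mI (F_measurable p l dq ug) (F_ge0 p l ug)).
have Phi0 x : 0 <= Phi x by apply: integral_ge0 => t _; exact: F_ge0 ug _.
have fubPhi D : measurable D -> \int[m \x lam]_(z in D `*` I) F z = \int[m]_(x in D) Phi x.
  by move=> mD; rewrite (rect_fubini1 m lam mD mI (F_measurable p l dq ug) (F_ge0 p l ug)).
have mB x s : measurable (ball x s : set (borel V)) by exact: ball_measurable.
have -> : \int[m]_(x in ball x0 R0) cone_sum g i x = \sum_(k <oo) \int[m]_(x in ball x0 R0) hk i k x.
  rewrite -integral_nneseries//; last by move=> k; exact: measurable_funS (measurable_hk i k).
  by apply: eq_integral => x _; exact: cone_sumE.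
apply: (@le_trans _ _ (\sum_(k <oo | P k) (A%:E * (\int[m]_(x in ball (q k) (rho i)) Phi x) +
    (B * C * (2 * rho i) ^+ d)%:E))).
  rewrite [leRHS]eseries_mkcond; apply: lee_nneseries => k _.
    by move=> _; apply: integral_ge0.
  rewrite /P; case: ifPn => [/andP[nk _]|nP]; last first.
    rewrite integral0_eq// => x; rewrite /hk; case: ifP => // nk.
    move: nP; rewrite nk/= -leNgt -ball_normE/= => far near.
    rewrite patchE; case: ifPn => // /set_mem; move=> /= H.
    suff: (`|x0 - q k| < R0 + rho i)%R by rewrite ltNge far.
    apply: le_lt_trans (@ler_distD _ V x x0 (q k)) _.
    by apply: (ltrD near); rewrite distrC; exact: H.
  rewrite -fubPhi//; apply: le_trans (HA i k); rewrite /hk nk.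
  rewrite -integral_mkcondr setIC; apply: ge0_subset_integral => //.
  - exact: measurableI.
  - exact: measurable_funS (measurable_cone_integral dq ug i k).
  - by move=> x _; exact: cone_integral_ge0 ug _ _ _.
have g1 k : 0 <= A%:E * (\int[m]_(x in ball (q k) (rho i)) Phi x).
  by rewrite mule_ge0 ?lee_fin ?(ltW A0)//; exact: integral_ge0.
have g2 : 0 <= (B * C * (2 * rho i) ^+ d)%:E by rewrite lee_fin !mulr_ge0 ?exprn_ge0 ?mulr_ge0 ?ltW.
rewrite (nneseriesD (fun k _ _ => g1 k) (fun k _ _ => g2)).
apply: leeD.
  rewrite nneseriesZl; last by move=> k _; apply: integral_ge0.
  rewrite fubPhi// EFinM -muleA; apply: lee_wpmul2l; first by rewrite lee_fin ltW.
  have := @overlap_integral _ _ _ m bm q P (r i) (rho i) (ball x0 (2 * R0)%R) Phi r0 rho0 sep _ mPhi Phi0.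
  rewrite (_ : (2 * rho i + r i) / r i = 15)%R; last first.
    by rewrite /cone_radius; field; rewrite gt_eqF.
  apply => //; move=> k /andP[_ near] y; rewrite -!ball_normE/= => yk.
  have := ler_normD (x0 - q k)%R (q k - y)%R; rewrite addrA subrK; lra.
have -> : \sum_(k <oo | P k) (B * C * (2 * rho i) ^+ d)%:E =
    (B * C * 14 ^+ d)%:E * \sum_(k <oo | P k) (r i ^+ d)%:E.
  rewrite -nneseriesZl; last by move=> *; rewrite lee_fin exprn_ge0// ltW.
  apply: eq_eseriesr => k _; rewrite -EFinM; congr EFin.
  by rewrite -[RHS]mulrA -exprMn; congr (_ * _ ^+ _)%R; rewrite /cone_radius; ring.
rewrite !mulrA [leRHS]EFinM -(mulrA B); apply: lee_wpmul2l.
  by rewrite lee_fin !mulr_ge0 ?exprn_ge0 ?mulr_ge0 ?ltW.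
have Rr : (0 < R0 + rho i)%R by rewrite addr_gt0.
have := separated_count bm (q := q) (P := net q (r i)) x0 r0 Rr (@net_separated _ _ q (r i)).
move=> /le_trans; apply; rewrite lee_fin lerXn2r ?nnegrE//; rewrite /cone_radius in rR *; lra.
Qed.

(** The slabs shrink to the null wall, so their energies tend to 0; together with the freedom in B
    this makes the integrated costs small along a sequence of levels, and Fatou's lemma
    concludes. *)
Lemma cone_liminf_null (x0 : V) (R0 h0 : R) : (0 < R0)%R -> (0 < h0)%R ->
  \int[m \x lam]_(z in ball x0 (2 * R0)%R `*` `](- h0)%R, h0[) F z < +oo ->
  \int[m]_(x in ball x0 R0) limn_einf (cone_sum g ^~ x) = 0.
Proof.
move=> R00 h00 fin; have [C [C0 HC]] := cone_sum_bound x0 R00.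
have mB x s : measurable (ball x s : set (borel V)) by exact: ball_measurable.
pose D i : set T := ball x0 (2 * R0)%R `*` `[(- rho i)%R, rho i].
have mD i : measurable (D i) by apply: measurableX => //; exact: measurable_itv.
have rhoS i j : (i <= j)%N -> (rho j <= rho i)%R.
  by move=> ij; rewrite ler_wpM2l// (level_anti lv).
have small x : (0 < x)%R -> exists N, forall i, (N <= i)%N -> (rho i < x)%R.
  move=> x0'; have [|N H] := level_small lv (_ : 0 < x / 7)%R; first by rewrite divr_gt0.
  by exists N => i /H; rewrite /cone_radius ltr_pdivlMr// mulrC.
have [N0 HN0] := small h0 h00.
have cv : \int[m \x lam]_(z in D (N0 + i)%N) F z @[i --> \oo] --> 0.
  apply: (@shrinking_integral_cvg0 _ _ _ (m \x lam) (fun i => D (N0 + i)%N)).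
  - by move=> i; exact: mD.
  - move=> i j ij [x t] [/= xB]; rewrite !in_itv/= -!ler_norml => ti.
    by split => //=; rewrite in_itv/= -ler_norml (le_trans ti)// rhoS// leq_add2l.
  - exact: (F_measurable p l dq ug).
  - exact: (F_ge0 p l ug).
  - apply: le_lt_trans fin; apply: ge0_subset_integral => //.
    + by apply: measurableX => //; exact: measurable_itv.
    + exact: measurable_funS (F_measurable p l dq ug).
    + by move=> z _; exact: (F_ge0 p l ug).
    + rewrite addn0 => -[x t] [/= xB]; rewrite !in_itv/= -ler_norml => ti; split => //=.
      by rewrite -ltr_norml (le_lt_trans ti)// HN0.
  - pose N : set T := ball x0 (2 * R0)%R `*` [set (0%R : measurableTypeR R)].
    rewrite (_ : \bigcap_i _ = N).
      transitivity ((m \x lam) N) => //; rewrite /N product_measure1E//; transitivity (m (ball x0 (2 * R0)%R) * 0); last by rewrite mule0.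
      by congr (_ * _); exact: lebesgue_measure_set1.
    apply/seteqP; split => -[x t] H; last first.
      move=> i _; case: H => /= xB ->; split => //=; rewrite in_itv/= oppr_le0.
      by rewrite !ltW// (cone_radius_gt0 lv).
    split; first by case: (H 0%N I).
    apply/eqP; rewrite -normr_le0 leNgt; apply/negP => t0.
    have [N' HN'] := small _ t0; have [_ /=] := H N' I.
    rewrite in_itv/= -ler_norml leNgt HN'//; exact: leq_addl.
apply/eqP; rewrite eq_le; apply/andP; split; last first.
  apply: integral_ge0 => x _; apply: (@limn_einf_ge _ _ _ 0%N) => i _; exact: cone_sum_ge0.
have mcs i : measurable_fun (ball x0 R0 : set (borel V)) (cone_sum g i).
  exact: measurable_funS (measurable_cone_sum i).
apply: le_trans (@fatou _ _ _ m _ (mB x0 R0) _ mcs (fun i x _ => cone_sum_ge0 i x)) _.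
apply/lee_addgt0Pr => eps eps0; rewrite add0e.
(* Order of the choices: B from eps, then A from B, then a level fine enough that A times the energy
   of its slab is below eps / 2. *)
pose B := (Num.min 1 (eps / 2 / C))%R.
have B0 : (0 < B)%R by rewrite lt_min ltr01 !divr_gt0.
have B1 : (B <= 1)%R by rewrite ge_min lexx.
have BC : (B * C <= eps / 2)%R by rewrite -ler_pdivlMr// ge_min lexx orbT.
have [A [A0 HA]] := HC B (introT andP (conj B0 B1)).
apply: limn_einf_le => N.
have [|N1 HN1] := small (R0 / 2)%R; first by rewrite divr_gt0.
have eA : 0 < (eps / 2 / A)%:E by rewrite lte_fin !divr_gt0.
have [N2 _ HN2] := cv _ (open_ereal_lt' eA).
exists (N0 + (N + N1 + N2))%N; first by rewrite -addnA addnCA leq_addr.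
apply: le_trans (HA _ _) _.
  rewrite mulrC -ler_pdivlMr// ltW// HN1// addnCA -addnA addnCA leq_addr//.
apply: (@le_trans _ _ (A%:E * (eps / 2 / A)%:E + (eps / 2)%:E)).
  apply: leeD; last by rewrite lee_fin.
  apply: lee_wpmul2l; first by rewrite lee_fin ltW.
  by apply/ltW/HN2; rewrite /= leq_addl.
by rewrite -EFinM -EFinD lee_fin mulrC divfK ?gt_eqF// -splitr.
Qed.

End cone_sum.

(** * Integrals over the segments joining two points of a ball *)

Section segments.
Context {R : realType} (d : nat) (V : normedModType R) (q : nat -> V)
  (m : {sigma_finite_measure set (borel V) -> \bar R}) (bm : box_space d m).
Hypothesis dq : dense_seq q.
Local Notation T := (borel V * measurableTypeR R)%type.
Local Notation lam := (@lebesgue_measure R).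

Definition segment_point (y : V) (s : R) (z : V) : V := (y + s *: (z - y))%R.

Lemma measurable_segment_point : measurable_fun setT
  (fun z : T * borel V => segment_point z.1.1 z.1.2 z.2 : borel V).
Proof.
have ms : measurable_fun setT (fun z : T => (z.2 *: (z.1 : V))%R : borel V).
  apply: measurable_fun_borel => A oA; apply: (open_prodR_measurable dq).
  apply: (@open_comp (V * R)%type V (fun z => z.2 *: z.1)%R) => // z _.
  by apply: cvgZ; [exact: cvg_snd|exact: cvg_fst].
have m11 : measurable_fun setT (fun z : T * borel V => z.1.1).
  exact: measurableT_comp measurable_fst measurable_fst.
have m12 : measurable_fun setT (fun z : T * borel V => z.1.2).
  exact: measurableT_comp measurable_snd measurable_fst.
have mD := measurableT_comp (measurable_fun_lin2 dq 1 (-1))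
  (measurable_fun_pair (measurable_snd : measurable_fun setT (snd : T * borel V -> _)) m11).
have mS := measurableT_comp (measurable_fun_lin2 dq 1 1)
  (measurable_fun_pair m11 (measurableT_comp ms (measurable_fun_pair mD m12))).
move: mS; congr measurable_fun; apply/funext => z /=.
by rewrite /segment_point !scale1r scaleN1r.
Qed.

Lemma segment_pointC y s z : segment_point y s z = segment_point z (1 - s) y.
Proof.
rewrite /segment_point scalerBl scale1r addrA (addrC z) subrK.
by rewrite -[X in _ = (_ - X)%R]opprK -scalerN opprK opprB.
Qed.

Variable (x0 : V) (r : R).
Hypothesis r0 : (0 < r)%R.
Local Notation B := (ball x0 r : set (borel V)).
Let mB : measurable B. Proof. exact: ball_measurable. Qed.
Let MB : m B = ((2 * r) ^+ d)%:E. Proof. exact: (box_ball bm). Qed.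

Lemma segment_ball y z s : (0 <= s <= 1)%R -> ball x0 r y -> ball x0 r z ->
  ball x0 r (segment_point y s z).
Proof.
move=> /andP[s0 s1]; rewrite -!ball_normE/= => By Bz.
have -> : (x0 - segment_point y s z = (1 - s) *: (x0 - y) + s *: (x0 - z))%R.
  rewrite scalerBl scale1r -addrA (addrC (- _)%R) -scalerBr opprB (addrC (x0 - z)%R) subrKA.
  by rewrite /segment_point opprD -scalerN opprB addrA.
apply: le_lt_trans (ler_normD _ _) _; rewrite !normrZ !ger0_norm ?subr_ge0//.
have [->|s00] := eqVneq s 0%R; first by rewrite subr0 mul1r mul0r addr0.
have {s00 s0}s0 : (0 < s)%R by rewrite lt_neqAle eq_sym s00.
have h1 : ((1 - s) * `|x0 - y| <= (1 - s) * r)%R by rewrite ler_wpM2l ?subr_ge0// ltW.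
have h2 : (s * `|x0 - z| < s * r)%R by rewrite ltr_pM2l.
lra.
Qed.

(** The map z -> y + s (z - y) sends the ball into itself by convexity and scales volume by s^d >=
    2^(-d). *)
Lemma segment_half_integral (f : borel V -> \bar R) (y : V) s :
  measurable_fun setT f -> (forall x, 0 <= f x) -> (2^-1 <= s <= 1)%R -> ball x0 r y ->
  \int[m]_(z in B) f (segment_point y s z) <= (2 ^+ d)%:E * \int[m]_(z in B) f z.
Proof.
move=> mf f0 /andP[s2 s1] By; have s0 : (0 < s)%R by lra.
pose phi (z : borel V) : borel V := ((y - s *: y) + s *: (z : V))%R.
have phiE z : phi z = segment_point y s z by rewrite /phi /segment_point scalerBr addrA addrAC.
have mphi : measurable_fun setT phi.
  apply: measurable_fun_borel => A oA; apply: borel_open.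
  apply: (@open_comp V V (fun x => y - s *: y + s *: x)%R) => // x _.
  apply: (@cvgD _ _ _ _ _ (fun=> y - s *: y)%R (fun x : V => s *: x)%R); first exact: cvg_cst.
  by apply: cvgZ; [exact: cvg_cst|].
have k0 : (0 <= s^-1 ^+ d)%R by rewrite exprn_ge0// invr_ge0 ltW.
have mphiB : measurable (phi @^-1` B) by rewrite -[X in measurable X]setTI; exact: mphi.
have If : 0 <= \int[m]_(z in B) f z by exact: integral_ge0.
apply: (@le_trans _ _ ((s^-1 ^+ d)%:E * \int[m]_(z in B) f z)); last first.
  apply: lee_wpmul2r => //; rewrite lee_fin lerXn2r ?nnegrE ?invr_ge0 ?(ltW s0)//.
  by rewrite invf_ple ?posrE.
rewrite -(integral_scaled_map mphi k0 (fun A mA => box_affine bm _ s0 mA) mB mf f0).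
apply: (@le_trans _ _ (\int[m]_(z in B) f (phi z))).
  by rewrite le_eqVlt; apply/orP; left; apply/eqP; apply: eq_integral => z _; rewrite phiE.
apply: ge0_subset_integral => //.
- exact: measurable_funS (measurableT_comp mf mphi).
- by move=> z Bz; rewrite /= phiE; apply: segment_ball => //; rewrite (ltW s0).
Qed.

(** For s >= 1/2 the substitution is made in z; for s <= 1/2 the segment is run backwards and the
    substitution is made in y. No power of 1/s is left. *)
Lemma segment_double_integral (f : borel V -> \bar R) s :
  measurable_fun setT f -> (forall x, 0 <= f x) -> (0 <= s <= 1)%R ->
  \int[m]_(y in B) \int[m]_(z in B) f (segment_point y s z) <=
  (2 ^+ d * (2 * r) ^+ d)%:E * \int[m]_(z in B) f z.
Proof.
move=> mf f0 /andP[s0 s1].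
have mg : measurable_fun setT (fun z : borel V * borel V => f (segment_point z.1 s z.2)).
  have mp : measurable_fun setT (fun z : borel V * borel V => ((z.1, s), z.2) : T * borel V).
    by apply: measurable_fun_pair => //; apply: measurable_fun_pair.
  exact: measurableT_comp mf (measurableT_comp measurable_segment_point mp).
have g0 z : 0 <= (fun z : borel V * borel V => f (segment_point z.1 s z.2)) z by [].
have bound (h : borel V -> \bar R) : measurable_fun setT h -> (forall y, 0 <= h y) ->
    (forall y, B y -> h y <= (2 ^+ d)%:E * \int[m]_(z in B) f z) ->
    \int[m]_(y in B) h y <= (2 ^+ d * (2 * r) ^+ d)%:E * \int[m]_(z in B) f z.
  move=> mh h0 hb.
  apply: (@le_trans _ _ (\int[m]_(y in B) ((2 ^+ d)%:E * \int[m]_(z in B) f z))).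
    by apply: ge0_le_integral => //; exact: measurable_funS mh.
  rewrite integral_cst//; apply: (@le_trans _ _ ((2 ^+ d)%:E * \int[m]_(z in B) f z * ((2 * r) ^+ d)%:E)).
    by rewrite le_eqVlt; apply/orP; left; apply/eqP; congr (_ * _); exact: MB.
  by rewrite muleAC -EFinM.
have [s2|/ltW s2] := leP 2^-1%R s.
  apply: bound => [|y|y By].
  - exact: (measurable_fiber1 m mB mg g0).
  - exact: integral_ge0.
  - by apply: segment_half_integral; rewrite ?s2.
rewrite -(rect_fubini1 m m mB mB mg g0) (rect_fubini2 m m mB mB mg g0).
apply: bound => [|y|y By].
- exact: (measurable_fiber2 m mB mg g0).
- exact: integral_ge0.
- under eq_integral do rewrite /= segment_pointC.
  by apply: segment_half_integral => //; lra.
Qed.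

Variable G : T -> \bar R.
Hypotheses (mG : measurable_fun setT G) (G0 : forall z, 0 <= G z).

Definition segment_integral (w : T) (z : borel V) :=
  \int[lam]_(s in `[0%R, 1%R]) G (segment_point w.1 s z, w.2).

Let K (x : (T * borel V) * measurableTypeR R) :=
  G (segment_point x.1.1.1 x.2 x.1.2, x.1.1.2).

Let mK : measurable_fun setT K.
Proof.
apply: (measurableT_comp mG); apply: measurable_fun_pair.
  have mp : measurable_fun setT (fun x : (T * borel V) * measurableTypeR R =>
      ((x.1.1.1, x.2), x.1.2) : T * borel V).
    apply: measurable_fun_pair; first apply: measurable_fun_pair => //.
      by apply: measurableT_comp => //; exact: measurableT_comp.
    exact: measurableT_comp.
  exact: measurableT_comp measurable_segment_point mp.
by apply: measurableT_comp => //; exact: measurableT_comp.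
Qed.

Let mI : measurable (`[0%R, 1%R]%classic : set (measurableTypeR R)).
Proof. exact: measurable_itv. Qed.

Lemma segment_integral_ge0 w z : 0 <= segment_integral w z.
Proof. exact: integral_ge0. Qed.

Lemma measurable_segment_integral :
  measurable_fun setT (fun x : T * borel V => segment_integral x.1 x.2).
Proof. exact: (measurable_fiber1 lam mI mK (fun _ => G0 _)). Qed.

Lemma segment_integral_bound (J : set (measurableTypeR R)) : measurable J ->
  \int[m \x lam]_(w in B `*` J) \int[m]_(z in B) segment_integral w z <=
  (2 ^+ d * (2 * r) ^+ d)%:E * \int[m \x lam]_(w in B `*` J) G w.
Proof.
move=> mJ; set C := (2 ^+ d * (2 * r) ^+ d)%R.
have C0 : (0 <= C)%R by rewrite mulr_ge0 ?exprn_ge0// mulr_ge0// ltW.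
have mN : measurable_fun setT (fun w => \int[m]_(z in B) segment_integral w z).
  exact: (measurable_fiber1 m mB measurable_segment_integral (fun _ => segment_integral_ge0 _ _)).
have N0 w : 0 <= \int[m]_(z in B) segment_integral w z.
  by apply: integral_ge0 => z _; exact: segment_integral_ge0.
rewrite (rect_fubini2 m lam mB mJ mN N0) (rect_fubini2 m lam mB mJ mG G0).
have mt := measurable_fiber2 m mB mG G0.
rewrite -ge0_integralZl_EFin//; last 2 first.
- by move=> t _; exact: integral_ge0.
- exact: measurable_funS mt.
apply: ge0_le_integral => //.
- by move=> t _; exact: integral_ge0.
- by apply: measurable_funS (measurable_fiber2 m mB mN N0).
- by apply: measurable_funS (_ : measurable_fun setT _) => //; exact: measurable_funeM.
move=> t _; pose f (x : borel V) := G (x, t).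
have mf : measurable_fun setT f by exact: measurableT_comp mG (pair2_measurable t).
have mL : measurable_fun setT (fun x : T * borel V => f (segment_point x.1.1 x.1.2 x.2)).
  exact: measurableT_comp mf measurable_segment_point.
have mL' (y : borel V) : measurable_fun setT (fun x : T => f (segment_point y x.2 x.1)).
  have mp : measurable_fun setT (fun x : T => ((y, x.2), x.1) : T * borel V).
    by apply: measurable_fun_pair => //; apply: measurable_fun_pair.
  exact: measurableT_comp mL mp.
have f0 x : 0 <= f x by exact: G0.
pose g (x : T) := \int[m]_(z in B) f (segment_point x.1 x.2 z).
have mg : measurable_fun setT g by exact: (measurable_fiber1 m mB mL (fun _ => f0 _)).
have g0 x : 0 <= g x by exact: integral_ge0.
apply: (@le_trans _ _ (\int[m]_(y in B) \int[lam]_(s in `[0%R, 1%R]) g (y, s))).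
  rewrite le_eqVlt; apply/orP; left; apply/eqP; apply: eq_integral => y _.
  by rewrite -(rect_fubini1 m lam mB mI (mL' y) (fun _ => f0 _)) (rect_fubini2 m lam mB mI (mL' y) (fun _ => f0 _)).
rewrite -(rect_fubini1 m lam mB mI mg g0) (rect_fubini2 m lam mB mI mg g0).
apply: (@le_trans _ _ (\int[lam]_(s in `[0%R, 1%R]) (C%:E * \int[m]_(x in B) f x))).
  apply: ge0_le_integral => //.
  - by move=> s _; exact: integral_ge0.
  - by apply: measurable_funS (measurable_fiber2 m mB mg g0).
  - by move=> s; rewrite /= in_itv/= => s01; exact: segment_double_integral.
rewrite integral_cst//.
rewrite -[leRHS]mule1 le_eqVlt; apply/orP; left; apply/eqP; congr (_ * _).
transitivity (lam (`[0%R, 1%R]%classic : set (measurableTypeR R))) => //.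
by rewrite lebesgue_measure_itv/= lte_fin ltr01 sube0.
Qed.

End segments.

Lemma measurable_fun_limn_einf d (T : measurableType d) (R : realType) (D : set T)
    (f : (T -> \bar R)^nat) : (forall n, measurable_fun D (f n)) ->
  measurable_fun D (fun x => limn_einf (f ^~ x)).
Proof.
move=> mf; apply: (@emeasurable_fun_cvg _ _ _ D (fun n x => einfs (f ^~ x) n)).
  exact: measurable_fun_einfs.
move=> x _; rewrite limn_einf_lim; exact: is_cvg_einfs.
Qed.

Lemma mean_deviation d (T : measurableType d) (R : realType) (mu : {measure set T -> \bar R})
    (A : set T) (M : R) (u : T -> R) (y : T) :
  measurable A -> (0 < M)%R -> mu A = M%:E -> mu.-integrable A (EFin \o u) ->
  `|u y - fine ((\int[mu]_(z in A) (u z)%:E) / mu A)|%:E <=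
  M^-1%:E * \int[mu]_(z in A) `|u y - u z|%:E.
Proof.
move=> mA M0 MA iu.
have ic : mu.-integrable A (EFin \o (fun=> u y)).
  apply/integrableP; split; first exact: measurable_cst.
  by rewrite /= integral_cst// MA -EFinM ltry.
have fu : \int[mu]_(z in A) (u z)%:E \is a fin_num by exact: integrable_fin_num.
have E : \int[mu]_(z in A) ((u y)%:E - (u z)%:E) =
    (M * (u y - fine ((\int[mu]_(z in A) (u z)%:E) / mu A)))%:E.
  rewrite (integralB_EFin mA ic iu) integral_cst// MA.
  rewrite -(fineK fu) inver gt_eqF// -EFinM -EFinM -EFinB; congr EFin => /=.
  by field; rewrite gt_eqF.
rewrite -lee_pdivrMl//; last first.
  by rewrite invr_gt0.
rewrite invrK.
apply: (@le_trans _ _ `| \int[mu]_(z in A) ((u y)%:E - (u z)%:E) |).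
  by rewrite E /= normrM (gtr0_norm M0).
have mu' : measurable_fun A (fun z => (u y)%:E - (u z)%:E).
  by apply: emeasurable_funB; [exact: measurable_cst|exact: measurable_int iu].
by apply: le_trans (le_abse_integral _ mA mu') _.
Qed.

(** * Integration on the slit space against the product measure *)

Section slit_measure.
Context {R : realType} (d : nat) (V : normedModType R) (q : nat -> V) (e r : nat -> R)
  (m : {sigma_finite_measure set (borel V) -> \bar R})
  (m' : {sigma_finite_measure set (borel (V * R)%type) -> \bar R}).
Hypotheses (bm : box_space d m) (bm' : box_space d.+1 m') (dq : dense_seq q).
Hypothesis m'E : forall A, m' A = (m \x @lebesgue_measure R) A.
Local Notation W := (V * R)%type.
Local Notation T := (borel V * measurableTypeR R)%type.
Local Notation X := (restr (slit01 q e r)).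
Local Notation lam := (@lebesgue_measure R).
Local Notation mu := (hausdorff_measure X d.+1).
Local Notation CT := (caratheodory_type (hausdorff_outer X d.+1)).
Local Notation emb := (@emb R W (slit q e r) (0%R, 1%R) (slit01 q e r)).

Lemma borel_prod_measurable : measurable_fun setT (id : borel W -> T).
Proof.
apply/measurable_fun_pairP; split.
  apply: measurable_fun_borel => A oA; apply: borel_open.
  by apply: (@open_comp W V fst) => // z _; exact: cvg_fst.
apply: (measurability _ (RGenOInfty.measurableE R)) => //.
move=> _ [_ [x ->] <-]; rewrite setTI; apply: borel_open.
apply: (@open_comp W R snd) => [z _|]; first exact: cvg_snd.
exact: interval_open.
Qed.

Lemma measurable_slit_emb : measurable_fun setT (emb : CT -> T).
Proof.
exact: (measurableT_comp borel_prod_measurable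
  (@measurable_emb R d.+1 W (slit q e r) (0%R, 1%R) (slit01 q e r))).
Qed.

(** Passes from the Caratheodory sigma-algebra of the space to the product sigma-algebra of [V] and
    the line, where Fubini applies. The constant k cancels in averages. *)
Lemma slit_integral : exists2 k : R, (0 < k)%R &
  (forall A : set T, measurable A -> mu (emb @^-1` A) = k%:E * (m \x lam) A) /\
  forall (D : set T) (f : T -> \bar R), measurable D -> measurable_fun setT f ->
    (forall y, 0 <= f y) ->
  \int[mu]_(x in emb @^-1` D) f (emb x) = k%:E * \int[m \x lam]_(y in D) f y.
Proof.
have mS : m' (~` slit q e r) = 0 by rewrite m'E; exact: slit_null.
have [k k0 [k1 k2]] := restr_integral bm' (ltn0Sn d) (slit01 q e r) (@open_slit R V q e r) mS.
have mT (A : set T) : measurable A -> measurable (A : set (borel W)).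
  by move=> mA; have := borel_prod_measurable measurableT mA; rewrite setTI.
exists k => //; split => [A mA|D f mD mf f0].
  by rewrite -m'E -k1//; exact: mT.
have mf' : measurable_fun setT (f : borel W -> \bar R).
  exact: measurableT_comp mf borel_prod_measurable.
rewrite (k2 D f (mT D mD) mf' f0); congr (_ * _).
have mid : measurable_fun setT (id : T -> borel W) by exact: prod_borel_measurable dq.
have := @ge0_integral_pushforward _ _ T (borel W) R _ mid (m \x lam) D f (mT D mD) _ _.
rewrite preimage_id => <-.
- apply: eq_measure_integral => A mA _; exact: m'E.
- exact: measurable_funS mf'.
- by move=> y _.
Qed.

End slit_measure.

Lemma centered_itv_measure {R : realType} (t s : R) : (0 < s)%R ->
  @lebesgue_measure R `](t - s)%R, (t + s)%R[%classic = (2 * s)%:E.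
Proof.
move=> s0; have E := @lebesgue_measure_ball R t s (ltW s0).
by rewrite ball_itv in E; rewrite mulr_natl; exact: E.
Qed.

(** * The Orlicz-Poincare inequality on the slit space *)

Section slit_average.
Context {R : realType} (d : nat) (V : normedModType R) (q : nat -> V) (e r : nat -> R)
  (m : {sigma_finite_measure set (borel V) -> \bar R}).
Hypotheses (bm : box_space d m) (dq : dense_seq q).
Local Notation W := (V * R)%type.
Local Notation T := (borel V * measurableTypeR R)%type.
Local Notation X := (restr (slit01 q e r)).
Local Notation lam := (@lebesgue_measure R).
Local Notation mu := (hausdorff_measure X d.+1).
Local Notation CT := (caratheodory_type (hausdorff_outer X d.+1)).
Local Notation emb := (@emb R W (slit q e r) (0%R, 1%R) (slit01 q e r)).

Definition box (w : W) (s : R) : set T := ball w.1 s `*` `](w.2 - s)%R, (w.2 + s)%R[.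

Lemma ball_slit (x : X) s : ball x s = emb @^-1` box (emb x) s.
Proof.
by rewrite ball_restr; apply/seteqP; split => y /= -[b1 b2]; split => //; rewrite ball_itv in b2 *.
Qed.

Lemma measurable_box w s : measurable (box w s).
Proof. by apply: measurableX; [exact: ball_measurable|exact: measurable_itv]. Qed.

Lemma box_measure w s : (0 < s)%R -> (m \x lam) (box w s) = ((2 * s) ^+ d.+1)%:E.
Proof.
move=> s0; rewrite product_measure1E//; last exact: ball_measurable.
transitivity (((2 * s) ^+ d)%:E * (2 * s)%:E); last by rewrite -EFinM exprSr.
congr (_ * _); first exact: (box_ball bm).
exact: centered_itv_measure.
Qed.

Lemma box_le w s t : (s <= t)%R -> box w s `<=` box w t.
Proof.
move=> st y [/= y1 y2]; split; first exact: le_ball y1.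
by move: y2; rewrite /= !in_itv/= => /andP[? ?]; apply/andP; split; lra.
Qed.

Variable k : R.
Hypotheses (k0 : (0 < k)%R)
  (muE : forall A : set T, measurable A -> mu (emb @^-1` A) = k%:E * (m \x lam) A)
  (intE : forall (D : set T) (f : T -> \bar R), measurable D -> measurable_fun setT f ->
    (forall y, 0 <= f y) ->
    \int[mu]_(x in emb @^-1` D) f (emb x) = k%:E * \int[m \x lam]_(y in D) f y).

Lemma ball_slit_measure (x : X) s : (0 < s)%R -> mu (ball x s) = (k * (2 * s) ^+ d.+1)%:E.
Proof. by move=> s0; rewrite ball_slit muE ?box_measure//; exact: measurable_box. Qed.

Lemma measurable_ball_slit (x : X) s : measurable (ball x s : set CT).
Proof.
rewrite ball_slit -[X in measurable X]setTI.
exact: (@measurable_slit_emb R d V q e r measurableT _ (measurable_box _ _)).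
Qed.

Lemma averageE (f : X -> \bar R) (x : X) s : (0 < s)%R ->
  average d.+1 f (ball x s) = (k * (2 * s) ^+ d.+1)^-1%:E * \int[mu]_(y in ball x s) f y.
Proof.
move=> s0; rewrite /average ball_slit_measure// inver gt_eqF ?mulr_gt0 ?exprn_gt0 ?mulr_gt0//.
by rewrite muleC.
Qed.

Lemma average_emb (f : T -> \bar R) (x : X) s : (0 < s)%R -> measurable_fun setT f ->
  (forall y, 0 <= f y) ->
  average d.+1 (f \o emb) (ball x s) =
  ((2 * s) ^+ d.+1)^-1%:E * \int[m \x lam]_(y in box (emb x) s) f y.
Proof.
move=> s0 mf f0; rewrite averageE// ball_slit intE//; last exact: measurable_box.
rewrite muleA -EFinM; congr (_%:E * _).
by rewrite invfM mulrAC mulVf ?mul1r// gt_eqF.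
Qed.

Section gradient.
Context (p l : R) (lv : levels d p l e r) (p1 : (1 < p)%R) (pd : (p < d.+1%:R)%R)
  (u : X -> R) (g : X -> \bar R) (ug : upper_gradient u g).
Hypothesis iu : integrable_on_balls d.+1 u.
Local Notation U := (extend_real u).
Local Notation G := (extend_by0 g).
Local Notation F := (Psi_energy p l g).
Let mG := G_prod_measurable dq ug.
Let G0 := G_ge0 ug.

Section at_ball.
Variables (x : X) (s : R).
Hypothesis s0 : (0 < s)%R.
Hypothesis Ffin : \int[m \x lam]_(w in box (emb x) (2 * s)%R) F w < +oo.
Local Notation x0 := (emb x).1.
Local Notation t0 := (emb x).2.
Local Notation B := (ball x0 s : set (borel V)).
Local Notation I := (`](t0 - s)%R, (t0 + s)%R[%classic : set (measurableTypeR R)).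
Let mB : measurable B. Proof. exact: ball_measurable. Qed.
Let mI : measurable I. Proof. exact: measurable_itv. Qed.

Let Gam (y : borel V) := \int[lam]_(t in I) G (y, t).
Let kap (y : borel V) : \bar R :=
  if (t0 - s < 0 < t0 + s)%R then limn_einf (cone_sum g ^~ y) else 0.
(** Cost of going horizontally from w to the vertical line over y and then along that line; only the
    term [kap], null on average, takes account of the wall. *)
Let h (w : T) (y : borel V) : \bar R :=
  (2 * s)%:E * segment_integral G w y + (Gam y + kap y).

Let Gam0 y : 0 <= Gam y. Proof. exact: integral_ge0. Qed.

Let mGam : measurable_fun setT Gam.
Proof. exact: (measurable_fiber1 lam mI mG G0). Qed.

Let kap0 y : 0 <= kap y.
Proof.
rewrite /kap; case: ifP => // _.
apply: (@limn_einf_ge _ _ _ 0%N) => i _; exact: cone_sum_ge0 ug _ _.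
Qed.

Let mkap : measurable_fun setT kap.
Proof.
rewrite /kap; case: (t0 - s < 0 < t0 + s)%R => //.
by apply: measurable_fun_limn_einf => i; exact: (measurable_cone_sum dq ug i).
Qed.

Let kap_null : \int[m]_(y in B) kap y = 0.
Proof.
rewrite /kap; have [/andP[t1 t2]|_] := boolP (t0 - s < 0 < t0 + s)%R; last by rewrite integral0.
apply: (cone_liminf_null lv bm dq p1 pd ug s0 s0); apply: le_lt_trans Ffin.
apply: ge0_subset_integral => //.
- by apply: measurableX; [exact: ball_measurable|exact: measurable_itv].
- exact: measurable_box.
- exact: measurable_funS (F_measurable p l dq ug).
- by move=> w _; exact: (F_ge0 p l ug).
- move=> w [/= w1 w2]; split => //; move: w2.
  by rewrite /= !in_itv/= => /andP[? ?]; apply/andP; split; lra.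
Qed.

Let h0 w y : 0 <= h w y.
Proof.
apply: adde_ge0; last exact: adde_ge0.
apply: mule_ge0; first by rewrite lee_fin mulr_ge0// ltW.
exact: (segment_integral_ge0 G0).
Qed.

Let pointwise (y z : X) : ball x s y -> ball x s z -> ((emb y).2 != 0)%R -> ((emb z).2 != 0)%R ->
  `|u y - u z|%:E <= h (emb y) (emb z).1.
Proof.
rewrite !ball_slit -!(extend_realE u) => -[/=].
case: (emb y) => y' t /=; case: (emb z) => z' t' /= By ty [/= Bz tz] yt zt.
have h1 := ug_horizontal ug y' z' yt.
have h2 := ug_fiber lv dq (box_unit bm) ug z' ty tz yt zt.
have yz : (`|y' - z'| <= 2 * s)%R.
  move: By Bz; rewrite -!ball_normE/= => By Bz.
  have := ler_distD x0 y' z'; rewrite (distrC y' x0); lra.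
apply: (@le_trans _ _ (`|U (y', t) - U (z', t)|%:E + `|U (z', t) - U (z', t')|%:E)).
  by rewrite -EFinD lee_fin ler_distD.
apply: leeD.
  apply: le_trans h1 _; apply: lee_wpmul2r; last by rewrite lee_fin.
  by apply: integral_ge0.
by apply: le_trans h2 _.
Qed.

Let mh w : measurable_fun setT (h w).
Proof.
apply: emeasurable_funD; last exact: emeasurable_funD.
apply: measurable_funeM.
exact: measurableT_comp (measurable_segment_integral dq mG G0) (pair1_measurable w).
Qed.

Local Notation D := (box (emb x) s).
Local Notation S := (fun w => \int[m]_(z in B) segment_integral G w z).
Local Notation J := (\int[m \x lam]_(w in D) G w).

Let J0 : 0 <= J. Proof. exact: integral_ge0. Qed.

Let h_integral w : \int[m \x lam]_(z in D) h w z.1 = (2 * s)%:E * ((2 * s)%:E * S w + J).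
Proof.
have mh1 : measurable_fun setT (fun z : T => h w z.1) by exact: measurableT_comp (mh w) _.
have mS := measurableT_comp (measurable_segment_integral dq mG G0) (pair1_measurable w).
have S0 z : 0 <= segment_integral G w z by exact: (segment_integral_ge0 G0).
have s20 : (0 <= 2 * s)%R by rewrite mulr_ge0// ltW.
rewrite (rect_fubini1 m lam mB mI mh1 (fun z => h0 w z.1)).
transitivity (\int[m]_(y in B) ((2 * s)%:E * h w y)).
  apply: eq_integral => y _; rewrite /= integral_cst// muleC; congr (_ * _).
  exact: centered_itv_measure.
have mon (f : borel V -> \bar R) : measurable_fun setT f -> measurable_fun B f.
  exact: measurable_funS.
rewrite (ge0_integralZl_EFin m mB (fun y _ => h0 w y) (mon _ (mh w)) s20).
have mS2 : measurable_fun setT (fun y => (2 * s)%:E * segment_integral G w y).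
  exact: measurable_funeM.
have S20 y : 0 <= (2 * s)%:E * segment_integral G w y by rewrite mule_ge0.
have GK0 y : 0 <= Gam y + kap y by exact: adde_ge0.
have mGK : measurable_fun setT (fun y => Gam y + kap y) by exact: emeasurable_funD.
rewrite (ge0_integralD m mB (fun y _ => S20 y) (mon _ mS2) (fun y _ => GK0 y) (mon _ mGK)).
rewrite (ge0_integralZl_EFin m mB (fun y _ => S0 y) (mon _ mS) s20).
rewrite (ge0_integralD m mB (fun y _ => Gam0 y) (mon _ mGam) (fun y _ => kap0 y) (mon _ mkap)).
by rewrite kap_null adde0 (rect_fubini1 m lam mB mI mG G0).
Qed.

Let off_slit_ae : {ae mu, forall y : CT, ((emb y).2 != 0)%R}.
Proof.
pose N : set T := setT `*` [set (0%R : measurableTypeR R)].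
have m0 : measurable [set (0%R : measurableTypeR R)].
  by rewrite -set_itv1; exact: measurable_itv.
have mN : measurable N by exact: measurableX.
exists (emb @^-1` N); split.
- by rewrite -[X in measurable X]setTI; exact: (@measurable_slit_emb R d V q e r measurableT _ mN).
- rewrite muE// /N product_measure1E//.
  transitivity (k%:E * (m setT * 0)); last by rewrite !mule0.
  by congr (_ * (_ * _)); exact: lebesgue_measure_set1.
- by move=> y /negP; rewrite negbK => /eqP y0; split.
Qed.

(** A Poincare estimate with the plain integral of the gradient, valid as soon as the Psi-energy on
    the doubled ball is finite: the lower limits of the crossing costs integrate to 0, and the
    double integral of the segment costs is controlled by [segment_integral_bound]. *)
Lemma deviation_integral :
  \int[mu]_(y in ball x s) `|u y - fine (average d.+1 (EFin \o u) (ball x s))|%:E <= (k * (2 * s) * (2 ^+ d + 1))%:E * J.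
Proof.
set uB := fine _; set M := (k * (2 * s) ^+ d.+1)%R.
have s20 : (0 < 2 * s)%R by rewrite mulr_gt0.
have M0 : (0 < M)%R by rewrite mulr_gt0// exprn_gt0.
have MA : mu (ball x s) = M%:E by exact: ball_slit_measure.
have mA := measurable_ball_slit x s.
have iuA : mu.-integrable (ball x s) (EFin \o u : CT -> \bar R) by exact: iu.
have mu' : measurable_fun (ball x s : set CT) (u : CT -> R).
  by apply/measurable_EFinP; exact: measurable_int iuA.
have mdev (c : R) : measurable_fun (ball x s : set CT) (fun y : CT => `|c - u y|%:E).
  have mc : measurable_fun (ball x s : set CT) (fun y : CT => (c - u y)%R).
    exact: (measurable_funB (measurable_cst c) mu').
  have mn : measurable_fun (ball x s : set CT) (fun y : CT => `|c - u y|%R).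
    exact: (measurableT_comp (@normr_measurable R setT) mc).
  by apply/measurable_EFinP.
have inner (y : CT) : ball x s y -> ((emb y).2 != 0)%R ->
    \int[mu]_(z in ball x s) `|u y - u z|%:E <= (k * (2 * s))%:E * ((2 * s)%:E * S (emb y) + J).
  move=> yA y0; have mhy : measurable_fun setT (fun w : T => h (emb y) w.1).
    by exact: measurableT_comp (mh (emb y)) _.
  rewrite EFinM -muleA -h_integral -intE//; last exact: measurable_box.
  have mhe : measurable_fun (ball x s : set CT) (fun z : CT => h (emb y) (emb z).1).
    apply: measurable_funS measurableT (@subsetT _ _) _.
    exact: (measurableT_comp mhy (@measurable_slit_emb R d V q e r)).
  have ae : {ae mu, forall z, (ball x s : set CT) z -> `|u y - u z|%:E <= h (emb y) (emb z).1}.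
    by apply: filterS off_slit_ae => z z0 zA; exact: pointwise.
  have f0 z : (ball x s : set CT) z -> 0 <= `|u y - u z|%:E by move=> _; rewrite lee_fin.
  rewrite -ball_slit.
  exact: (ae_ge0_le_integral mA f0 (mdev (u y)) (fun z _ => h0 (emb y) (emb z).1) mhe ae).
pose c := (M^-1 * (k * (2 * s)))%R.
have c0 : (0 <= c)%R by rewrite /c; rewrite mulr_ge0 ?invr_ge0 ?(ltW M0)// mulr_ge0 ?(ltW k0) ?(ltW s20).
have mS : measurable_fun setT S.
  exact: (measurable_fiber1 m mB (measurable_segment_integral dq mG G0) (fun _ => segment_integral_ge0 G0 _ _)).
have S0 w : 0 <= S w by apply: integral_ge0 => z _; exact: (segment_integral_ge0 G0).
have mSJ : measurable_fun setT (fun w : T => (2 * s)%:E * S w + J).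
  by apply: emeasurable_funD => //; exact: measurable_funeM.
have SJ0 w : 0 <= (2 * s)%:E * S w + J by rewrite adde_ge0// mule_ge0// lee_fin ltW.
apply: (@le_trans _ _ (\int[mu]_(y in ball x s) (c%:E * ((2 * s)%:E * S (emb y) + J)))).
  have mSe : measurable_fun (ball x s : set CT)
      (fun y : CT => c%:E * ((2 * s)%:E * S (emb y) + J)).
    apply: measurable_funS measurableT (@subsetT _ _) _; apply: measurable_funeM.
    exact: (measurableT_comp mSJ (@measurable_slit_emb R d V q e r)).
  have mdu : measurable_fun (ball x s : set CT) (fun y : CT => `|u y - uB|%:E).
    by under eq_fun do rewrite distrC; exact: mdev.
  have f0 y : (ball x s : set CT) y -> 0 <= `|u y - uB|%:E by move=> _; rewrite lee_fin.
  have f1 y : (ball x s : set CT) y -> 0 <= c%:E * ((2 * s)%:E * S (emb y) + J).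
    by move=> _; rewrite mule_ge0.
  apply: (ae_ge0_le_integral mA f0 mdu f1 mSe).
  apply: filterS off_slit_ae => y y0 yA.
  apply: le_trans (mean_deviation y mA M0 MA iuA) _.
  by rewrite /c EFinM -muleA; apply: lee_wpmul2l; [rewrite lee_fin invr_ge0 ltW|exact: inner].
rewrite ball_slit (intE (f := fun w => c%:E * ((2 * s)%:E * S w + J)))//; last 3 first.
- exact: measurable_box.
- exact: measurable_funeM.
- by move=> w; rewrite mule_ge0.
have mD := measurable_box (emb x) s.
have mon (f : T -> \bar R) : measurable_fun setT f -> measurable_fun D f.
  exact: measurable_funS.
have mS2 : measurable_fun setT (fun w : T => (2 * s)%:E * S w) by exact: measurable_funeM.
have S20 w : 0 <= (2 * s)%:E * S w by rewrite mule_ge0// lee_fin ltW.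
rewrite (ge0_integralZl_EFin (m \x lam) mD (fun w _ => SJ0 w) (mon _ mSJ) c0).
rewrite (ge0_integralD (m \x lam) mD (fun w _ => S20 w) (mon _ mS2) (fun _ _ => J0) (measurable_cst J)).
rewrite (ge0_integralZl_EFin (m \x lam) mD (fun w _ => S0 w) (mon _ mS) (ltW s20)).
rewrite (integral_cst (m \x lam) mD J).
have HS := segment_integral_bound bm dq x0 s0 mG G0 mI.
apply: (@le_trans _ _ (k%:E * (c%:E * ((2 * s)%:E * ((2 ^+ d * (2 * s) ^+ d)%:E * J) + J * ((2 * s) ^+ d.+1)%:E)))).
  apply: lee_wpmul2l; first by rewrite lee_fin ltW.
  apply: lee_wpmul2l; first by rewrite lee_fin.
  apply: leeD; first by apply: lee_wpmul2l => //; rewrite lee_fin ltW.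
  by apply: lee_wpmul2l => //; rewrite le_eqVlt; apply/orP; left; apply/eqP; exact: box_measure.
rewrite (muleC J) 2!muleA -EFinM -ge0_muleDl ?lee_fin ?mulr_ge0 ?exprn_ge0 ?(ltW s20) ?(ltW s0)//.
rewrite -EFinD !muleA -!EFinM le_eqVlt; apply/orP; left; apply/eqP; congr (_%:E * _).
by rewrite /c /M exprS; field; rewrite ?gt_eqF// exprn_gt0.
Qed.

End at_ball.

(* Psi_linear_bound plays the role of Jensen's inequality for the average of [g]. *)
Lemma gradient_average (x : X) (s a C : R) : (0 < s)%R -> (0 < a)%R -> (0 < C)%R ->
  (forall b, (0 <= b)%R -> (b <= a + C * a * (Psi p l b / Psi p l a))%R) ->
  average d.+1 (Psi_ext p l \o g) (ball x s) < (Psi p l a)%:E ->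
  \int[m \x lam]_(w in box (emb x) s) F w < +oo /\
  \int[m \x lam]_(w in box (emb x) s) G w <= ((1 + C) * a * (2 * s) ^+ d.+1)%:E.
Proof.
move=> s0 a0 C0 lin; set N := ((2 * s) ^+ d.+1)%R.
have N0 : (0 < N)%R by rewrite exprn_gt0// mulr_gt0.
have P0 := Psi_gt0 p l a0.
have mF := F_measurable p l dq ug; have F0 := F_ge0 p l ug.
have mD := measurable_box (emb x) s.
have -> : Psi_ext p l \o g = F \o emb.
  by apply/funext => y; rewrite /= /Psi_energy extend_by0E.
rewrite (average_emb x s0 mF F0) -/N lte_pdivrMl// -EFinM => Ilt.
split; first exact: lt_trans Ilt (ltry _).
pose K := (C * a / Psi p l a)%R.
have Kp : (0 < K)%R by apply: divr_gt0 => //; apply: mulr_gt0.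
have K0 := ltW Kp.
have pt w : G w <= a%:E + K%:E * F w.
  rewrite /Psi_energy; have := G0 w; case: (G w) => [b|_|//]; last first.
    by rewrite (_ : Psi_ext p l +oo = +oo)// gt0_muley ?lte_fin// addey.
  rewrite lee_fin => b0; rewrite (_ : Psi_ext p l b%:E = (Psi p l b)%:E)// -EFinM -EFinD lee_fin.
  apply: le_trans (lin b b0) _; rewrite le_eqVlt; apply/orP; left; apply/eqP.
  by rewrite /K; field; rewrite gt_eqF.
have mon (f : T -> \bar R) : measurable_fun setT f ->
    measurable_fun (box (emb x) s) f by exact: measurable_funS.
have mKF : measurable_fun setT (fun w : T => K%:E * F w) by exact: measurable_funeM.
have KF0 w : 0 <= K%:E * F w by rewrite mule_ge0.
have a0' : 0 <= a%:E by rewrite lee_fin ltW.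
apply: (@le_trans _ _ (\int[m \x lam]_(w in box (emb x) s) (a%:E + K%:E * F w))).
  apply: ge0_le_integral => //; first exact: mon.
  by apply: mon; exact: emeasurable_funD.
rewrite (ge0_integralD (m \x lam) mD (fun _ _ => a0') (measurable_cst _) (fun w _ => KF0 w) (mon _ mKF)).
rewrite (ge0_integralZl_EFin (m \x lam) mD (fun w _ => F0 w) (mon _ mF) K0).
rewrite (integral_cst (m \x lam) mD a%:E).
apply: (@le_trans _ _ (a%:E * N%:E + K%:E * (N * Psi p l a)%:E)).
  apply: leeD; last by apply: lee_wpmul2l; [rewrite lee_fin|exact: ltW].
  by apply: lee_wpmul2l => //; rewrite le_eqVlt; apply/orP; left; apply/eqP; exact: box_measure.
rewrite -!EFinM -EFinD lee_fin le_eqVlt; apply/orP; left; apply/eqP.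
by rewrite /K; field; rewrite gt_eqF.
Qed.

End gradient.

Lemma slit_poincare (p l : R) : levels d p l e r -> (1 < p)%R -> (p < d.+1%:R)%R ->
  supports_orlicz_poincare X d.+1 p l.
Proof.
move=> lv p1 pd; have [C C0 lin] := Psi_linear_bound l p1.
have D0 : (0 < 2 * (2 ^+ d + 1) * (1 + C) * 2 ^+ d.+1 :> R)%R.
  by rewrite !mulr_gt0 ?exprn_gt0// addr_gt0// exprn_gt0.
set K := (2 * (2 ^+ d + 1) * (1 + C) * 2 ^+ d.+1 : R)%R in D0.
(* The dilation 2 is that of [cone_liminf_null], where the cones over a ball of radius s are
   controlled by the energy over the ball of radius 2 s. *)
exists K, 2%R; split; [exact: D0|by rewrite ler1n|].
move=> u g iu ug x s s0 /=.
set uB := fine _; set A := average _ _ (ball x (2 * s)%R).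
have s20 : (0 < 2 * s)%R by rewrite mulr_gt0.
have Ks : (0 < K * s)%R by rewrite mulr_gt0.
have [_ g0 _] := ug.
have A0 : 0 <= A.
  rewrite /A averageE//; apply: mule_ge0; last by apply: integral_ge0 => y _; exact: Psi_ext_ge0.
  by rewrite lee_fin invr_ge0 ltW// mulr_gt0// exprn_gt0// mulr_gt0.
(* [Psi_inv] is an infimum, so the bound is proved for each a with Psi(a) above the average; such an
   a also certifies that the energy is finite. *)
rewrite -lee_pdivrMl//; apply: le_ereal_inf_tmp => _ [a [a0 Aa] <-].
rewrite lee_pdivrMl// -EFinM.
have {}a0 : (0 < a)%R.
  rewrite lt_neqAle a0 andbT eq_sym; apply: contraTneq Aa => ->.
  by rewrite Psi0 ?gt_eqF ?(lt_trans ltr01)// -leNgt.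
have [Ffin Gle] := gradient_average ug s20 a0 C0 (fun b b0 => lin b a b0 a0) Aa.
have mG := G_prod_measurable dq ug; have G0 := G_ge0 ug.
have GJ : \int[m \x lam]_(w in box (emb x) s) extend_by0 g w <=
    ((1 + C) * a * (2 * (2 * s)) ^+ d.+1)%:E.
  apply: le_trans Gle; apply: ge0_subset_integral => //; try exact: measurable_box.
  - exact: measurable_funS mG.
  - by apply: box_le; lra.
have H := deviation_integral lv p1 pd ug iu s0 Ffin.
rewrite averageE//.
have k1 : (0 < (k * (2 * s) ^+ d.+1)^-1)%R by rewrite invr_gt0 mulr_gt0// exprn_gt0.
have k2 : (0 < k * (2 * s) * (2 ^+ d + 1))%R by rewrite !mulr_gt0// addr_gt0// exprn_gt0.
apply: (@le_trans _ _ ((k * (2 * s) ^+ d.+1)^-1%:E * ((k * (2 * s) * (2 ^+ d + 1))%:E *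
   ((1 + C) * a * (2 * (2 * s)) ^+ d.+1)%:E))).
  apply: lee_wpmul2l; first by rewrite lee_fin ltW.
  by apply: le_trans H _; apply: lee_wpmul2l; [rewrite lee_fin ltW|exact: GJ].
rewrite -!EFinM lee_fin le_eqVlt; apply/orP; left; apply/eqP.
have -> : ((2 * (2 * s)) ^+ d.+1 = 2 ^+ d.+1 * (2 * s) ^+ d.+1)%R by rewrite exprMn.
rewrite /K; field.
by rewrite !gt_eqF ?exprn_gt0.
Qed.

End slit_average.

Lemma continuous_borel_measurable {R : realType} (W : normedModType R) (f : W -> R) :
  continuous f -> measurable_fun setT (f : borel W -> R).
Proof.
move=> cf; apply: (measurability _ (RGenOInfty.measurableE R)) => //.
move=> _ [_ [x ->] <-]; rewrite setTI; apply: borel_open.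
by apply: (@open_comp W R f) => [w _|]; [exact: cf|exact: interval_open].
Qed.

(** * The test function and its upper gradient *)

Section crack_functions.
Context {R : realType} (V : normedModType R) (q : nat -> V) (e r : nat -> R).
Hypothesis e0 : forall i, (0 < e i)%R.
Local Notation W := (V * R)%type.
Local Notation X := (restr (slit01 q e r)).
Local Notation lam := (@lebesgue_measure R).
Local Notation emb := (@emb R W (slit q e r) (0%R, 1%R) (slit01 q e r)).

Definition crack (n : nat) : nat * nat := odflt (0, 0)%N (unpickle n).

(** It rises with slope 1 / e_i from 0, within e_i of the centre of the hole, to 1, beyond 2 e_i.
    Indices that code no net point get 1, which is neutral for the infimum in [step_fun]. *)
Definition crack_profile (n : nat) (w : W) : R :=
  if net q (r (crack n).1) (crack n).2 then
    Num.min 1%R (Num.max 0%R (`|w - (q (crack n).2, 0%R)| / e (crack n).1 - 1)%R)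
  else 1%R.

Definition step_fun (w : W) : R :=
  if (0 < w.2)%R then infs (crack_profile ^~ w) 0%N else 0%R.

Definition crack_nbhd (i : nat) : set W :=
  [set w | exists k, net q (r i) k /\ (`|w - (q k, 0%R)| < 2 * e i)%R].

Definition step_gradient (w : W) : \bar R :=
  esups (fun i => ((e i)^-1 * \1_(crack_nbhd i) w)%:E) 0%N.

Lemma crack_profile01 n w : (0 <= crack_profile n w <= 1)%R.
Proof.
rewrite /crack_profile; case: ifP => _; last by rewrite ler01 lexx.
by rewrite le_min ler01 le_max lexx ge_min lexx.
Qed.

Lemma has_inf_profiles w : has_inf [set crack_profile n w | n in [set n | (0 <= n)%N]].
Proof.
split; first by exists (crack_profile 0%N w), 0%N.
by exists 0%R => _ [n _ <-]; case/andP: (crack_profile01 n w).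
Qed.

Lemma step_fun_le n w : (0 < w.2)%R -> (step_fun w <= crack_profile n w)%R.
Proof.
move=> w0; rewrite /step_fun w0 /infs /sdrop/=; apply: ge_inf; last by exists n.
by have [] := has_inf_profiles w.
Qed.

Lemma step_fun01 w : (0 <= step_fun w <= 1)%R.
Proof.
rewrite /step_fun; case: ifPn => w0; last by rewrite lexx ler01.
apply/andP; split.
  apply: lb_le_inf; first by have [] := has_inf_profiles w.
  by move=> _ [n _ <-]; case/andP: (crack_profile01 n w).
have := step_fun_le 0%N w0; rewrite /step_fun w0 => /le_trans; apply.
by case/andP: (crack_profile01 0%N w).
Qed.

Lemma step_fun_adherent w c : (0 < w.2)%R -> (0 < c)%R ->
  exists n, (crack_profile n w < step_fun w + c)%R.
Proof.
move=> w0 c0; have [_ [n _ <-] H] := inf_adherent c0 (has_inf_profiles w).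
by exists n; rewrite /step_fun w0.
Qed.

Lemma open_crack_nbhd i : open (crack_nbhd i).
Proof.
rewrite openE => w [k [nk wk]]; apply/nbhs_ballP.
exists (2 * e i - `|w - (q k, 0%R)|)%R; first by rewrite /= subr_gt0.
move=> y; rewrite -ball_normE/= => wy; exists k; split => //.
have := ler_distD w y (q k, 0%R); rewrite (distrC y w); lra.
Qed.

Lemma measurable_step_gradient : measurable_fun setT (step_gradient : borel W -> \bar R).
Proof.
apply: (measurable_fun_esups (f := fun i (w : borel W) => ((e i)^-1 * \1_(crack_nbhd i) w)%:E)) => i.
apply/measurable_EFinP; apply: measurable_funM; first exact: measurable_cst.
by apply: measurable_indic; apply: borel_open; exact: open_crack_nbhd.
Qed.

Lemma step_gradient_ge i w : crack_nbhd i w -> (e i)^-1%:E <= step_gradient w.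
Proof.
move=> iw; apply: ereal_sup_ubound; exists i => //.
by rewrite indicE mem_set// mulr1.
Qed.

Lemma step_gradient_ge0 w : 0 <= step_gradient w.
Proof.
apply: (@le_trans _ _ ((e 0%N)^-1 * \1_(crack_nbhd 0%N) w)%:E).
  by rewrite lee_fin mulr_ge0// invr_ge0 ltW.
by apply: ereal_sup_ubound; exists 0%N.
Qed.

Lemma measurable_crack_profile n : measurable_fun setT (crack_profile n : borel W -> R).
Proof.
rewrite /crack_profile; case: (net _ _ _) => //.
apply: measurable_minr => //; apply: measurable_maxr => //.
apply: measurable_funB => //; apply: measurable_funM => //.
apply: (@continuous_borel_measurable _ W (fun w => `|w - (q (crack n).2, 0%R)|%R)) => w.
apply: (@cvg_norm _ _ _ _ _ (fun w : W => w - (q (crack n).2, 0%R))%R).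
by apply: (@cvgB _ _ _ _ _ (fun w : W => w) (fun=> (q (crack n).2, 0%R))); [|exact: cvg_cst].
Qed.

Lemma measurable_step_fun : measurable_fun setT (step_fun : borel W -> R).
Proof.
have m2 : measurable_fun setT (fun w : borel W => w.2).
  by apply: (@continuous_borel_measurable _ W snd) => w; exact: cvg_snd.
rewrite /step_fun; apply: measurable_fun_ifT.
- by apply: measurable_fun_ltr => //; exact: measurable_cst.
- apply: measurable_fun_infs; last exact: measurable_crack_profile.
  by move=> w _; exists 0%R => _ [n _ <-]; case/andP: (crack_profile01 n w).
- exact: measurable_cst.
Qed.

Section curve.
Variables (L : R) (gam : R -> X).
Hypotheses (L0 : (0 <= L)%R)
  (gamL : forall s t, (0 <= s <= L)%R -> (0 <= t <= L)%R -> (mdist (gam s) (gam t) <= `|s - t|)%R).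
Local Notation I := (`[0%R, L]%classic : set (measurableTypeR R)).

(** The curve is nonexpansive on [0, L] only; clamping the parameter makes it so on the whole line,
    hence continuous and measurable. *)
Let clamp (t : R) : R := Num.max 0%R (Num.min L t).
Let w (t : R) : W := emb (gam (clamp t)).

Let clamp_itv t : (0 <= clamp t <= L)%R.
Proof. by rewrite /clamp le_max lexx/= ge_max L0 ge_min lexx. Qed.

Let clampE t : (0 <= t <= L)%R -> clamp t = t.
Proof. by move=> /andP[t0 tL]; rewrite /clamp min_r// max_r. Qed.

Let w_nonexpansive s t : (`|w s - w t| <= `|s - t|)%R.
Proof.
apply: le_trans (gamL (clamp_itv s) (clamp_itv t)) _.
rewrite /clamp !(maxC 0%R) !(minC L); apply: le_trans (ler_dist_max _ _ _) _.
have h1 := ler_norm (s - t)%R; have h2 := ler_norm (t - s)%R; rewrite distrC in h2.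
rewrite ler_norml; have [?|?] := leP s L; have [?|?] := leP t L; lra.
Qed.

Let mw : measurable_fun setT (w : measurableTypeR R -> borel W).
Proof. exact: nonexpansive_measurable. Qed.

Let mgw : measurable_fun setT (fun t : measurableTypeR R => step_gradient (w t)).
Proof. exact: measurableT_comp measurable_step_gradient mw. Qed.

Local Notation K := (\int[lam]_(t in I) step_gradient (w t)).

Let K0 : 0 <= K. Proof. by apply: integral_ge0 => t _; exact: step_gradient_ge0. Qed.

(* On a path from [s] to [t] the profile rises by [b], so it stays below 1 for a time at least [e * b] after [s]. *)
Lemma crack_profile_curve n s t : (0 <= s <= L)%R -> (0 <= t <= L)%R ->
  (crack_profile n (w t) - crack_profile n (w s))%:E <= K.
Proof.
move=> sL tL; rewrite /crack_profile; case: ifPn => [nn|_]; last by rewrite subrr.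
set i := (crack n).1; set c : W := (q (crack n).2, 0%R).
set a := Num.min 1%R (Num.max 0%R (`|w s - c| / e i - 1)%R).
set b := Num.min 1%R (Num.max 0%R (`|w t - c| / e i - 1)%R).
have [ba|ab] := leP b a; first by apply: le_trans K0; rewrite lee_fin subr_le0.
have ei := e0 i.
have b1 : (b <= 1)%R by rewrite /b ge_min lexx.
have a0 : (0 <= a)%R by rewrite /a le_min ler01 le_max lexx.
have sa : (`|w s - c| <= e i * (1 + a))%R.
  have : (`|w s - c| / e i - 1 <= a)%R.
    rewrite /a le_min le_max lexx orbT andbT; move: (lt_le_trans ab b1).
    by rewrite /a gt_min ltxx/= gt_max => /andP[_ /ltW].
  by rewrite lerBlDl ler_pdivrMr// mulrC.
have tb : (e i * (1 + b) <= `|w t - c|)%R.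
  have : (b <= `|w t - c| / e i - 1)%R.
    have : (b <= Num.max 0%R (`|w t - c| / e i - 1))%R by rewrite /b ge_min lexx orbT.
    by rewrite le_max => /orP[b0|//]; move: (lt_le_trans ab b0); rewrite ltNge a0.
  by rewrite lerBrDl ler_pdivlMr// mulrC.
set h := (e i * (b - a))%R; have h0 : (0 < h)%R by rewrite mulr_gt0// subr_gt0.
have hst : (h <= `|s - t|)%R.
  apply: le_trans (w_nonexpansive s t).
  have := ler_distD (w s) (w t) c; rewrite (distrC (w t) (w s)) /h mulrBr; rewrite !mulrDr in sa tb; lra.
have near x : (`|x - s| < h)%R -> crack_nbhd i (w x).
  move=> xs; exists (crack n).2; split => //; rewrite -/c.
  apply: le_lt_trans (ler_distD (w s) _ _) _.
  apply: (@lt_le_trans _ _ (h + e i * (1 + a))%R).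
    by apply: ltr_leD => //; exact: le_lt_trans (w_nonexpansive _ _) xs.
  by rewrite /h -mulrDr mulrC ler_pM2r//; lra.
(* The interval of length h is taken on the side of s where t lies, so that it stays inside
   [0, L]. *)
have [lo [lo0 loL lon]] : exists lo, [/\ (0 <= lo)%R, (lo + h <= L)%R &
    forall x, (lo < x < lo + h)%R -> (`|x - s| < h)%R].
  have /andP[s0 sL'] := sL; have /andP[t0 tL'] := tL.
  have [st|/ltW ts] := leP s t.
    exists s; split => //.
      by rewrite distrC ger0_norm ?subr_ge0// in hst; lra.
    by move=> x /andP[x1 x2]; rewrite gtr0_norm ?subr_gt0//; lra.
  exists (s - h)%R; split.
  - by rewrite ger0_norm ?subr_ge0// in hst; lra.
  - lra.
  - by move=> x /andP[x1 x2]; rewrite ltr0_norm ?subr_lt0//; lra.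
pose J := (`]lo, (lo + h)%R[%classic : set (measurableTypeR R)).
have mJ : measurable J by exact: measurable_itv.
apply: (@le_trans _ _ (\int[lam]_(x in J) step_gradient (w x))); last first.
  apply: ge0_subset_integral => //.
  - exact: measurable_funS mgw.
  - by move=> x _; exact: step_gradient_ge0.
  - by move=> x; rewrite /J/= !in_itv/= => /andP[? ?]; apply/andP; split; lra.
apply: (@le_trans _ _ (\int[lam]_(x in J) (e i)^-1%:E)); last first.
  apply: ge0_le_integral => //.
  - by move=> x _; rewrite lee_fin invr_ge0 ltW.
  - exact: measurable_funS mgw.
  - by move=> x; rewrite /J/= in_itv/= => /lon/near; exact: step_gradient_ge.
rewrite (integral_cst lam mJ (e i)^-1%:E).
apply: (@le_trans _ _ ((e i)^-1%:E * h%:E)).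
  by rewrite -EFinM lee_fin /h mulrA mulVf ?mul1r// gt_eqF.
rewrite le_eqVlt; apply/orP; left; apply/eqP; congr (_ * _).
transitivity (lam J) => //.
by rewrite /J lebesgue_measure_itv/= lte_fin ltrDl h0 -EFinB addrAC subrr add0r.
Qed.

(** A rise of the infimum is, up to an arbitrarily small error, at most the rise of a single
    profile. A curve that starts on or below the wall must pass through a hole, where the profile of
    that hole is 0. *)
Lemma step_fun_curve s t : (0 <= s <= L)%R -> (0 <= t <= L)%R ->
  (step_fun (w t) - step_fun (w s))%:E <= K.
Proof.
move=> sL tL; have /andP[us0 _] := step_fun01 (w s).
have [ut|ut] := leP (step_fun (w t)) (step_fun (w s)).
  by apply: le_trans K0; rewrite lee_fin subr_le0.
have wt0 : (0 < (w t).2)%R.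
  by rewrite ltNge; apply/negP => wt; move: (le_lt_trans us0 ut); rewrite /step_fun [(0 < (w t).2)%R]ltNge wt/= ltxx.
have [ws0|ws0] := ltP 0%R (w s).2.
  apply/lee_addgt0Pr => c c0; have [n Hn] := step_fun_adherent ws0 c0.
  apply: (@le_trans _ _ ((crack_profile n (w t) - crack_profile n (w s))%:E + c%:E)).
    by rewrite -EFinD lee_fin; have := step_fun_le n wt0; lra.
  by apply: leeD2r; exact: crack_profile_curve.
have [x xst wx] : exists2 x, (0 <= x <= L)%R & (w x).2 = 0%R.
  have cw : continuous (fun x => (w x).2).
    move=> x; apply: (@continuous_comp _ _ _ w snd); last exact: cvg_snd.
    by apply: nonexpansive_continuous.
  have /andP[s0 sL'] := sL; have /andP[t0 tL'] := tL.
  have [st|/ltW ts] := leP s t.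
    have [|x] := IVT st (continuous_subspaceT cw) (v := 0%R).
      by rewrite ge_min ws0 le_max (ltW wt0) orbT.
    by rewrite in_itv/= => /andP[x1 x2] wx0; exists x => //; rewrite (le_trans s0)//= (le_trans x2).
  have [|x] := IVT ts (continuous_subspaceT cw) (v := 0%R).
    by rewrite ge_min ws0 orbT le_max (ltW wt0).
  by rewrite in_itv/= => /andP[x1 x2] wx0; exists x => //; rewrite (le_trans t0)//= (le_trans x2).
(* A point of the space at height 0 lies in some hole (i, k), whose profile vanishes there. *)
have := embS (gam (clamp x)); rewrite -/(w x) => -[/eqP//|[i [k [nk xk]]]].
have cE : crack (pickle (i, k)) = (i, k) by rewrite /crack pickleK.
have px : crack_profile (pickle (i, k)) (w x) = 0%R.
  rewrite /crack_profile cE /= nk; apply/eqP; rewrite eq_le le_min ler01 le_max lexx !andbT.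
  rewrite ge_min ge_max lexx/=; apply/orP; right; rewrite subr_le0 ler_pdivrMr// mul1r.
  by rewrite prod_normE ge_max /= wx subrr normr0 (ltW xk) ltW.
apply: le_trans (crack_profile_curve (pickle (i, k)) xst tL).
by rewrite px lee_fin; have := step_fun_le (pickle (i, k)) wt0; lra.
Qed.

Lemma step_fun_curve_dist : 
  `|step_fun (emb (gam 0%R)) - step_fun (emb (gam L))|%:E <=
  \int[lam]_(t in `[0%R, L]) step_gradient (emb (gam t)).
Proof.
have -> : \int[lam]_(t in `[0%R, L]) step_gradient (emb (gam t)) = K.
  by apply: eq_integral => t; rewrite inE/= in_itv/= => tL; rewrite /w clampE.
have z : (0 <= (0 : R) <= L)%R by apply/andP; split.
have l : (0 <= L <= L)%R by apply/andP; split.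
have := step_fun_curve z l; have := step_fun_curve l z.
rewrite /w !clampE// => h1 h2.
have [le01|/ltW le10] := leP (step_fun (emb (gam 0%R))) (step_fun (emb (gam L))).
  by rewrite distrC ger0_norm ?subr_ge0.
by rewrite ger0_norm ?subr_ge0.
Qed.

End curve.

Lemma step_upper_gradient :
  upper_gradient (step_fun \o emb : X -> R) (step_gradient \o emb).
Proof.
split => [|x|c a b rc].
- rewrite /borel_function; apply: (measurableT_comp measurable_step_gradient).
  apply: measurable_fun_borel => A oA; apply: sub_sigma_algebra; exact: open_restr.
- exact: step_gradient_ge0.
- rewrite /curve_integral -{1}(arc_length_param0 rc) -(arc_length_paramL rc).
  exact: (step_fun_curve_dist (arc_length_ge0 rc) (arc_length_param_lipschitz rc)).
Qed.

End crack_functions.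

(** * Energy of the test function for the smaller exponent *)

Section levels_bounds.
Context {R : realType} (d : nat) (p l : R) (e r : nat -> R) (lv : levels d p l e r).

Lemma level_lt i K : (i < K)%N -> (r K <= r i / (2 * K%:R))%R.
Proof.
case: K => // K; rewrite ltnS => iK; apply: le_trans (level_decr lv K) _.
by rewrite ler_wpM2r ?(level_anti lv)// invr_ge0 mulr_ge0.
Qed.

(** By [level_eq] the energy of level i per unit of area is a constant times log(e + 1/e_i)^(-eps)
    <= 2^(-i eps). This is written as a square: one factor will be summed over i >= K, the other
    gives the decay in K. *)
Lemma Psi_level_bound (eps : R) i : (0 < eps)%R ->
  (Psi p (l - eps) (e i)^-1 * ((4 * e i) ^+ d.+1 / r i ^+ d) <=
   4 ^+ d.+1 * ((2 `^ (- (eps / 2))) ^+ i) ^+ 2)%R.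
Proof.
move=> eps0; have e0 := level_e_gt0 lv i; have r0 := level_r_gt0 lv i.
have ei0 : (0 < (e i)^-1)%R by rewrite invr_gt0.
have P0 := Psi_gt0 p l ei0; have L0 := lne1D_gt0 (ltW ei0).
have -> : (Psi p (l - eps) (e i)^-1 = Psi p l (e i)^-1 * lne1D (e i)^-1 `^ (- eps))%R.
  rewrite /Psi -/(lne1D _) -mulrA -powRD//; by rewrite (gt_eqF L0) implybT.
have L : (lne1D (e i)^-1 `^ (- eps) <= ((2 `^ (- (eps / 2))) ^+ i) ^+ 2)%R.
  have x2 : ((2 `^ (- (eps / 2))) ^+ 2 = 2 `^ (- eps) :> R)%R.
    by rewrite -powR_mulrn ?powR_ge0// -powRrM; congr (_ `^ _)%R; field.
  have -> : (((2 `^ (- (eps / 2))) ^+ i) ^+ 2 = (2 ^+ i) `^ (- eps) :> R)%R.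
    by rewrite -exprM mulnC exprM x2 -!powR_mulrn ?powR_ge0// -!powRrM mulrC.
  rewrite !powRN.
  rewrite lef_pV2 ?posrE ?powR_gt0// ?exprn_gt0//.
  by rewrite ge0_ler_powR ?nnegrE ?(ltW eps0) ?exprn_ge0 ?(ltW L0)// (level_log lv).
rewrite (level_eq lv) exprMn.
rewrite (_ : _ * _ = 4 ^+ d.+1 * lne1D (e i)^-1 `^ (- eps))%R; last first.
  by field; rewrite !gt_eqF// exprn_gt0.
by rewrite ler_wpM2l// exprn_ge0.
Qed.

End levels_bounds.

Lemma finite_support_max {R : realType} (a : nat -> R) (N : nat) :
  (forall i, (0 <= a i)%R) -> (forall i, (N <= i)%N -> a i = 0%R) ->
  exists j, forall i, (a i <= a j)%R.
Proof.
move=> a0 aN; suff [j Hj] : exists j, forall i, (i < N)%N -> (a i <= a j)%R.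
  exists j => i; have [/Hj//|/aN ->] := ltnP i N; exact: a0.
elim: N {aN} => [|N [j Hj]]; first by exists 0%N.
have [Nj|/ltW jN] := leP (a N) (a j).
  by exists j => i; rewrite ltnS leq_eqVlt => /predU1P[->//|]; exact: Hj.
by exists N => i; rewrite ltnS leq_eqVlt => /predU1P[->//|/Hj/le_trans]; exact.
Qed.

Section energy.
Context {R : realType} (d : nat) (p l : R) (V : normedModType R) (q : nat -> V)
  (e r : nat -> R) (lv : levels d p l e r)
  (m : {sigma_finite_measure set (borel V) -> \bar R}) (bm : box_space d m).
Hypotheses (dq : dense_seq q) (p1 : (1 < p)%R).
Local Notation W := (V * R)%type.
Local Notation T := (borel V * measurableTypeR R)%type.
Local Notation lam := (@lebesgue_measure R).
Local Notation M := (m \x lam).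
Local Notation N i := (crack_nbhd q e r i).
Local Notation sg := (step_gradient q e r).

Let e0 i : (0 < e i)%R. Proof. exact: level_e_gt0 lv i. Qed.

Lemma measurable_crack_nbhd i : measurable (N i : set T).
Proof. by apply: (open_prodR_measurable dq); exact: open_crack_nbhd. Qed.

(** Number of holes near D, by [separated_count], times the volume (4 e_i)^(d+1) of one
    neighbourhood. *)
Lemma crack_nbhd_measure i (D : set T) (s : R) : (0 < s)%R -> measurable D ->
  (forall w : W, (D : set W) w -> (`|w.1| < s)%R) ->
  M (N i `&` D) <= ((4 * e i) ^+ d.+1 / r i ^+ d * (2 * (s + 2 * e i) + r i) ^+ d)%:E.
Proof.
move=> s0 mD Ds; have r0 := level_r_gt0 lv i; have ei := e0 i.
have se : (0 < s + 2 * e i)%R by rewrite addr_gt0// mulr_gt0.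
pose P k := net q (r i) k && (`|0 - q k| < s + 2 * e i)%R.
pose F k : set T := if P k then box (q k, 0%R) (2 * e i)%R else set0.
have mF k : measurable (F k) by rewrite /F; case: ifP => // _; exact: measurable_box.
have sub : N i `&` D `<=` \bigcup_k F k.
  move=> w [[k [nk wk]] /Ds ws]; exists k => //; rewrite /F /P nk /=.
  move: wk; rewrite prod_normE gt_max /= subr0 => /andP[wk1 wk2].
  rewrite ifT; last first.
    have := ler_distD w.1 0%R (q k); rewrite sub0r normrN sub0r normrN; lra.
  split; first by rewrite -ball_normE/= distrC.
  by rewrite /= in_itv/= sub0r add0r -ltr_norml.
have mND : measurable (N i `&` D : set T).
  by apply: measurableI => //; exact: measurable_crack_nbhd.
apply: le_trans (@measure_sigma_subadditive _ _ _ M _ F mF mND sub) _.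
rewrite (eq_eseriesr (g := fun k => if P k then ((4 * e i) ^+ d.+1)%:E else 0)); last first.
  move=> k _; rewrite /F; case: ifP => _; last exact: measure0.
  rewrite [LHS](box_measure bm) ?mulr_gt0// mulrA -natrM.
  by [].
rewrite -eseries_mkcond.
have -> : \sum_(k <oo | P k) ((4 * e i) ^+ d.+1)%:E =
    ((4 * e i) ^+ d.+1 / r i ^+ d)%:E * \sum_(k <oo | P k) (r i ^+ d)%:E.
  rewrite -nneseriesZl; last by move=> *; rewrite lee_fin exprn_ge0// ltW.
  by apply: eq_eseriesr => k _; rewrite -EFinM divfK// gt_eqF// exprn_gt0.
rewrite [leRHS]EFinM; apply: lee_wpmul2l.
  by rewrite lee_fin divr_ge0 ?exprn_ge0 ?mulr_ge0 ?(ltW ei) ?(ltW r0).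
exact: (separated_count bm (q := q) (P := net q (r i)) 0%R r0 se (@net_separated _ _ q (r i))).
Qed.

(** Off the wall only finitely many levels have a neighbourhood containing w, so the supremum in the
    gradient is attained and Psi of it is a single term of the sum. Attainment avoids appealing to
    monotonicity of Psi, which can fail for negative exponents of the logarithm. *)
Lemma step_energy (l' : R) (D : set T) : measurable D ->
  \int[M]_(w in D) Psi_ext p l' (sg w) <=
  \sum_(i <oo) ((Psi p l' (e i)^-1)%:E * M (N i `&` D)).
Proof.
move=> mD; pose f i (w : T) : \bar R := (Psi p l' (e i)^-1)%:E * (\1_(N i) w)%:E.
have f0 i w : 0 <= f i w by rewrite mule_ge0// lee_fin Psi_ge0.
have mf i : measurable_fun setT (f i).
  by apply: measurable_funeM; apply/measurable_EFinP; apply: measurable_indic; exact: measurable_crack_nbhd.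
have p0 : p != 0%R by rewrite gt_eqF// (lt_trans ltr01).
have pt (w : T) : w.2 != 0%R -> Psi_ext p l' (sg w) <= \sum_(i <oo) f i w.
  move=> w0; pose a i : R := ((e i)^-1 * \1_(N i) w)%R.
  have a0 i : (0 <= a i)%R by rewrite mulr_ge0// invr_ge0 ltW.
  have [|n Hn] := level_small lv (_ : 0 < `|w.2|)%R; first by rewrite normr_gt0.
  have an i : (n <= i)%N -> a i = 0%R.
    move=> /Hn rw; rewrite /a indicE memNset ?mulr0// => -[k [_]].
    rewrite prod_normE gt_max /= subr0 => /andP[_].
    have := level_le lv i; have := e0 i; lra.
  have [j Hj] := finite_support_max a0 an.
  have -> : sg w = (a j)%:E.
    apply/eqP; rewrite eq_le; apply/andP; split.
      by apply: ge_ereal_sup => _ [i _ <-]; rewrite lee_fin; exact: Hj.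
    by apply: ereal_sup_ubound; exists j.
  rewrite (_ : Psi_ext p l' (a j)%:E = (Psi p l' (a j))%:E)// /a indicE.
  have [wj|wj] := boolP (w \in N j); last first.
    by rewrite mulr0 Psi0//; exact: nneseries_ge0.
  rewrite mulr1 (@nneseriesD1 _ _ j)//; apply: (@le_trans _ _ (f j w)).
    by rewrite /f indicE wj mule1.
  by rewrite leeDl// nneseries_ge0.
have msg : measurable_fun setT (fun w : T => Psi_ext p l' (sg w)).
  apply: measurable_Psi_ext.
  exact: measurableT_comp (measurable_step_gradient q e r) (prod_borel_measurable dq).
have m0 : measurable [set (0%R : measurableTypeR R)].
  by rewrite -set_itv1; exact: measurable_itv.
have Nae : {ae M, forall w : T, w.2 != 0%R}.
  exists (setT `*` [set (0%R : measurableTypeR R)]); split.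
  - exact: measurableX.
  - rewrite product_measure1E//.
    transitivity (m setT * 0); last by rewrite mule0.
    by congr (_ * _); exact: lebesgue_measure_set1.
  - by move=> w /negP; rewrite negbK => /eqP w0; split.
have sg0 w : 0 <= Psi_ext p l' (sg w) by apply: Psi_ext_ge0; exact: step_gradient_ge0.
have mon (h : T -> \bar R) : measurable_fun setT h -> measurable_fun D h.
  exact: measurable_funS.
have sf0 (w : T) : 0 <= \sum_(i <oo) f i w by exact: nneseries_ge0.
have msf : measurable_fun setT (fun w : T => \sum_(i <oo) f i w).
  exact: ge0_emeasurable_sum.
have ae : {ae M, forall w : T, D w -> Psi_ext p l' (sg w) <= \sum_(i <oo) f i w}.
  by apply: filterS Nae => w w0 _; exact: pt.
apply: le_trans (ae_ge0_le_integral mD (fun w _ => sg0 w) (mon _ msg) (fun w _ => sf0 w) (mon _ msf) ae) _.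
rewrite integral_nneseries//; last by move=> i; exact: mon.
rewrite le_eqVlt; apply/orP; left; apply/eqP; apply: eq_eseriesr => i _.
have mi : measurable_fun setT (fun w : T => (\1_(N i : set T) w : R)%:E).
  by apply/measurable_EFinP; apply: measurable_indic; exact: measurable_crack_nbhd.
have i0 (w : T) : D w -> 0 <= (\1_(N i : set T) w : R)%:E by move=> _; rewrite lee_fin.
rewrite (ge0_integralZl_EFin M mD i0 (mon _ mi) (Psi_ge0 p l' (e i)^-1)).
by congr (_ * _); rewrite integral_indic//; exact: measurable_crack_nbhd.
Qed.

End energy.

(** * Oscillation and energy of the test function near the origin *)

Section failure.
Context {R : realType} (d : nat) (p l : R) (V : normedModType R) (q : nat -> V)
  (e r : nat -> R) (lv : levels d p l e r)
  (m : {sigma_finite_measure set (borel V) -> \bar R}) (bm : box_space d m).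
Hypotheses (dq : dense_seq q) (p1 : (1 < p)%R).
Local Notation W := (V * R)%type.
Local Notation T := (borel V * measurableTypeR R)%type.
Local Notation X := (restr (slit01 q e r)).
Local Notation lam := (@lebesgue_measure R).
Local Notation M := (m \x lam).
Local Notation mu := (hausdorff_measure X d.+1).
Local Notation CT := (caratheodory_type (hausdorff_outer X d.+1)).
Local Notation emb := (@emb R W (slit q e r) (0%R, 1%R) (slit01 q e r)).
Local Notation N i := (crack_nbhd q e r i).
Local Notation sg := (step_gradient q e r).
Local Notation sf := (step_fun q e r).
Variable k : R.
Hypotheses (k0 : (0 < k)%R)
  (muE : forall A : set T, measurable A -> mu (emb @^-1` A) = k%:E * M A)
  (intE : forall (D : set T) (f : T -> \bar R), measurable D -> measurable_fun setT f ->
    (forall y, 0 <= f y) ->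
    \int[mu]_(x in emb @^-1` D) f (emb x) = k%:E * \int[M]_(y in D) f y).

Let e0 i : (0 < e i)%R. Proof. exact: level_e_gt0 lv i. Qed.
Let r0 i : (0 < r i)%R. Proof. exact: level_r_gt0 lv i. Qed.

Let msf : measurable_fun setT (sf : T -> R).
Proof. exact: measurableT_comp (measurable_step_fun q e r) (prod_borel_measurable dq). Qed.

Lemma step_integrable : integrable_on_balls d.+1 (sf \o emb : X -> R).
Proof.
move=> x s s0; apply/integrableP; split.
  apply: measurable_funS measurableT (@subsetT _ _) _; apply/measurable_EFinP.
  exact: (measurableT_comp msf (@measurable_slit_emb R d V q e r)).
have mB := measurable_ball_slit d x s.
have mf : measurable_fun setT (fun w : T => `|sf w|%:E).
  by apply/measurable_EFinP; exact: measurableT_comp (@normr_measurable R setT) msf.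
rewrite ball_slit (intE (f := fun w : T => `|sf w|%:E))//; last exact: measurable_box.
apply: (@le_lt_trans _ _ (k%:E * \int[M]_(w in box (emb x) s) 1)).
  apply: lee_wpmul2l; first by rewrite lee_fin ltW.
  apply: ge0_le_integral => //.
  - exact: measurable_box.
  - exact: measurable_funS mf.
  - by move=> w _; have /andP[? ?] := step_fun01 q e r w; rewrite lee_fin ger0_norm.
rewrite (integral_cst M (measurable_box _ _) 1) mul1e.
apply: (@le_lt_trans _ _ (k%:E * ((2 * s) ^+ d.+1)%:E)); last by rewrite -EFinM ltry.
by rewrite le_eqVlt; apply/orP; left; apply/eqP; congr (_ * _); exact: box_measure.
Qed.

Variable K : nat.
Local Notation rK := (r K).

(** The centres of level i keep a distance r_i from the origin, so they are at least r_i / 2 >= 4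
    e_i away from the points over the ball of radius s. *)
Lemma net_avoid i j w s : (i < K)%N -> net q (r i) j -> (2 * s <= r i)%R -> (`|(w : W).1| < s)%R ->
  (4 * e i < `|w - (q j, 0%R)|)%R.
Proof.
move=> iK nj si ws; apply: (@lt_le_trans _ _ `|w.1 - q j|%R); last first.
  by rewrite prod_normE le_max lexx.
have := net_norm nj; have := level_le lv i; have := ler_distD w.1 (0 : V)%R (q j).
rewrite !sub0r !normrN; have := e0 i; lra.
Qed.

Lemma level_lt_half i : (i < K)%N -> (2 * rK <= r i)%R.
Proof.
move=> iK; apply: le_trans (_ : 2 * (r i / (2 * K%:R)) <= _)%R.
  by rewrite ler_pM2l// (level_lt lv).
rewrite mulrA ler_pdivrMr ?mulr_gt0 ?ltr0n ?(leq_trans _ iK)//.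
rewrite mulrC ler_wpM2l ?(ltW (r0 i))// ler_peMr// ler1n; exact: leq_trans iK.
Qed.

(** All profiles equal 1 there: the holes of levels below K are horizontally far away by
    [net_avoid], and those of levels i >= K are too small, as 2 e_i <= r_K / 4, to reach the height
    r_K / 2. *)
Lemma step_fun_above (w : W) : (`|w.1| < rK)%R -> (rK / 2 < w.2)%R -> sf w = 1%R.
Proof.
move=> w1 w2; have w0 : (0 < w.2)%R by apply: lt_trans w2; rewrite divr_gt0.
apply/eqP; rewrite eq_le; have /andP[_ ->] := step_fun01 q e r w.
rewrite /step_fun w0 /infs /sdrop/=; apply: lb_le_inf.
  by have [] := has_inf_profiles q e r w.
move=> _ [n _ <-]; rewrite /crack_profile; case: ifPn => // nn.
set i := (crack n).1 in nn *; set c := (_, _).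
suff : (2 * e i <= `|w - c|)%R.
  move=> H; rewrite le_min lexx le_max; apply/orP; right.
  by rewrite lerBrDl ler_pdivlMr.
have ei := e0 i; have [iK|Ki] := ltnP i K.
  by have := net_avoid iK nn (level_lt_half iK) w1; rewrite -/c; lra.
apply: (@le_trans _ _ `|w.2|%R); last by rewrite prod_normE le_max /= subr0 lexx orbT.
rewrite gtr0_norm//; have := level_anti lv Ki; have := level_le lv i; lra.
Qed.

Lemma step_deviation (x : X) (c : R) : emb x = (0%R, (rK / 2)%R) ->
  (4^-1)%:E <= average d.+1 (fun y : X => `|(sf \o emb) y - c|%:E) (ball x rK).
Proof.
move=> xE; have rK0 := r0 K.
pose B := (ball (0 : V)%R rK : set (borel V)).
pose f (w : T) : \bar R := `|sf w - c|%:E.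
have mf : measurable_fun setT f.
  have mc : measurable_fun setT (fun w : T => (sf w - c)%R).
    exact: (measurable_funB msf (measurable_cst c)).
  by apply/measurable_EFinP; exact: (measurableT_comp (@normr_measurable R setT) mc).
have f0 w : 0 <= f w by rewrite lee_fin.
rewrite (average_emb bm k0 muE intE x rK0 mf f0).
rewrite -lee_pdivrMl ?invr_gt0 ?exprn_gt0 ?mulr_gt0// invrK xE.
(* Two slabs of the ball, each a quarter of its volume, on which the function is 0 and 1; since |0 -
   c| + |1 - c| >= 1, the mean deviation from any constant c is at least 1/4. *)
pose A1 : set T := B `*` `](- (rK / 2))%R, 0%R[.
pose A2 : set T := B `*` `](rK / 2)%R, rK[.
have mB : measurable B by exact: ball_measurable.
have mA1 : measurable A1 by apply: measurableX => //; exact: measurable_itv.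
have mA2 : measurable A2 by apply: measurableX => //; exact: measurable_itv.
pose v := ((2 * rK) ^+ d * (rK / 2))%R.
have v0 : (0 <= v)%R by rewrite mulr_ge0 ?exprn_ge0 ?divr_ge0 ?mulr_ge0 ?(ltW rK0).
have slab (a b : R) : (a < b)%R -> (b - a = rK / 2)%R -> M (B `*` `]a, b[) = v%:E.
  move=> ab abr; rewrite product_measure1E//.
  rewrite /v EFinM; congr (_ * _); first exact: (box_ball bm).
  transitivity (lam `]a, b[%classic) => //.
  by rewrite lebesgue_measure_itv/= lte_fin ab -EFinB abr.
have M1 : M A1 = v%:E by apply: slab; lra.
have M2 : M A2 = v%:E by apply: slab; lra.
have mon (D : set T) : measurable_fun D f by exact: measurable_funS mf.
apply: (@le_trans _ _ (\int[M]_(w in A1 `|` A2) f w)); last first.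
  apply: ge0_subset_integral => //.
  - exact: measurableU.
  - exact: measurable_box.
  - move=> w [] [w1]; rewrite /= in_itv/= => /andP[? ?]; split => //;
      by rewrite /= in_itv/=; apply/andP; split; lra.
rewrite ge0_integral_setU//; last first.
  apply/eqP/seteqP; split => // w [[_ /=]]; rewrite in_itv/= => /andP[_ w2] [_ /=].
  by rewrite in_itv/= => /andP[w3 _]; have : (rK / 2 < 0)%R := lt_trans w3 w2; rewrite ltNge divr_ge0// ltW.
have bound (A : set T) (a : R) : measurable A -> M A = v%:E -> (forall w, A w -> sf w = a) ->
    (`|a - c| * v)%:E <= \int[M]_(w in A) f w.
  move=> mA MA Aa; rewrite EFinM -MA -(integral_cst M mA `|a - c|%:E).
  apply: ge0_le_integral => //; first by move=> w _; rewrite lee_fin.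
  by move=> w /Aa aw; rewrite /f aw.
apply: (@le_trans _ _ ((`|0 - c| * v)%:E + (`|1 - c| * v)%:E)); last first.
  apply: leeD; apply: bound => // w [/= w1]; rewrite in_itv/= => /andP[w2 w3].
    by rewrite /step_fun ltNge (ltW w3).
  by apply: step_fun_above => //; move: w1; rewrite /B -ball_normE/= sub0r normrN.
rewrite -EFinM -EFinD lee_fin -mulrDl.
have c1 : (1 <= `|0 - c| + `|1 - c|)%R.
  by have := ler_distD c 1%R 0%R; rewrite subr0 normr1 (distrC 0%R); lra.
apply: (@le_trans _ _ (1 * v)%R); last by rewrite ler_wpM2r.
by rewrite mul1r /v exprSr le_eqVlt; apply/orP; left; apply/eqP; field.
Qed.

(** For i < K the neighbourhoods miss the dilated ball, because 2 tau r_K <= 2 K r_K <= r_i. For i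
    >= K the energies are summed with [Psi_level_bound], one factor y^i of the square being bounded
    by y^K. The quotient by r_K arises because only the area of the wall, of order r_K^d, is divided
    by a volume of order r_K^(d+1). *)
Lemma step_average_energy (eps tau y : R) (x : X) : y = (2 `^ (- (eps / 2)))%R -> (0 < eps)%R -> (1 <= tau)%R ->
  (tau <= K%:R)%R -> emb x = (0%R, (rK / 2)%R) ->
  average d.+1 (Psi_ext p (l - eps) \o (sg \o emb)) (ball x (tau * rK)) <=
  (4 ^+ d.+1 * (2 * tau + 2) ^+ d / (2 * tau) ^+ d.+1 / (1 - y) * y ^+ K / rK)%:E.
Proof.
move=> yE eps0 tau1 tauK xE.
have rK0 := r0 K; have tau0 : (0 < tau)%R by exact: lt_le_trans tau1.
have y0 : (0 < y)%R by rewrite yE powR_gt0.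
have y1 : (y < 1)%R.
  rewrite yE powRN invf_lt1 ?powR_gt0//.
  by rewrite /powR pnatr_eq0/= -[ltLHS](@expR0 R) ltr_expR mulr_gt0 ?divr_gt0 ?ln_gt0 ?ltr1n.
have s0 : (0 < tau * rK)%R by rewrite mulr_gt0.
pose D : set T := box ((0%R, (rK / 2)%R) : W) (tau * rK)%R.
have mD : measurable D by exact: measurable_box.
have Ds (w : W) : (D : set W) w -> (`|w.1| < tau * rK)%R.
  by move=> [/=]; rewrite -ball_normE/= sub0r normrN.
have mg : measurable_fun setT (fun w : T => Psi_ext p (l - eps) (sg w)).
  apply: measurable_Psi_ext.
  exact: measurableT_comp (measurable_step_gradient q e r) (prod_borel_measurable dq).
have g0 (w : T) : 0 <= Psi_ext p (l - eps) (sg w).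
  by apply: Psi_ext_ge0; exact: step_gradient_ge0.
have := average_emb bm k0 muE intE x s0 mg g0; rewrite xE -/D => ->.
pose c := (4 ^+ d.+1 * ((2 * tau + 2) * rK) ^+ d)%R.
have c0 : (0 <= c)%R by rewrite !mulr_ge0 ?exprn_ge0 ?mulr_ge0 ?addr_ge0 ?mulr_ge0 ?(ltW tau0) ?(ltW rK0).
have en : \int[M]_(w in D) Psi_ext p (l - eps) (sg w) <= (c * y ^+ K / (1 - y))%:E.
  apply: le_trans (step_energy lv m dq p1 (l - eps) mD) _.
  apply: le_trans (geometric_nneseries (a := c * y ^+ K) (z := y) _ _); last 2 first.
  - by rewrite mulr_ge0 ?exprn_ge0 ?(ltW y0).
  - by rewrite (ltW y0).
  apply: lee_nneseries => i _.
    by move=> _; rewrite mule_ge0 ?lee_fin ?Psi_ge0.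
  have P0 : (0 <= Psi p (l - eps) (e i)^-1)%R by exact: Psi_ge0.
  have [iK|Ki] := ltnP i K.
    suff ND : N i `&` D = set0.
      have -> : M (N i `&` D) = 0 by rewrite ND measure0.
      rewrite mule0 lee_fin; apply: mulr_ge0; [apply: mulr_ge0 => //|]; exact: exprn_ge0 (ltW y0).
    apply/seteqP; split => // w [[j [nj wj]] /Ds ws].
    have ti : (2 * (tau * rK) <= r i)%R.
      have K0 : (0 < K%:R :> R)%R by rewrite ltr0n (leq_trans _ iK).
      have := level_lt lv iK; rewrite ler_pdivlMr ?mulr_gt0//; apply: le_trans.
      by rewrite (mulrC tau) mulrCA ler_pM2l// ler_pM2l.
    have := net_avoid iK nj ti ws; have := e0 i; lra.
  have rKi := level_anti lv Ki; have ei := level_le lv i; have ei0 := e0 i.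
  apply: (@le_trans _ _ ((Psi p (l - eps) (e i)^-1)%:E *
     ((4 * e i) ^+ d.+1 / r i ^+ d * (2 * (tau * rK + 2 * e i) + r i) ^+ d)%:E)).
    by apply: lee_wpmul2l; [rewrite lee_fin|exact: (crack_nbhd_measure lv bm dq i s0 mD Ds)].
  rewrite -EFinM lee_fin mulrA /c.
  have i1 : (0 <= y ^+ i <= 1)%R.
    by rewrite exprn_ge0 ?(ltW y0)//= exprn_ile1 ?(ltW y0) ?(ltW y1).
  have iK : (y ^+ i <= y ^+ K)%R.
    by rewrite ler_wiXn2l ?(ltW y0) ?(ltW y1).
  apply: (@le_trans _ _ (4 ^+ d.+1 * (y ^+ i) ^+ 2 * ((2 * tau + 2) * rK) ^+ d)%R).
    have ri := r0 i.
    have a1 : (0 <= (4 * e i) ^+ d.+1 / r i ^+ d)%R.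
      by apply: divr_ge0; apply: exprn_ge0; lra.
    have a2 : (0 <= 2 * (tau * rK + 2 * e i) + r i)%R by lra.
    have a3 : (0 <= (2 * tau + 2) * rK)%R by apply: mulr_ge0; lra.
    apply: ler_pM.
    - exact: mulr_ge0.
    - exact: exprn_ge0.
    - by rewrite yE; exact: (Psi_level_bound lv i eps0).
    - by rewrite lerXn2r ?nnegrE// mulrDl; lra.
  rewrite mulrAC -!mulrA ler_wpM2l ?exprn_ge0//.
  rewrite ler_wpM2l ?exprn_ge0 ?mulr_ge0 ?addr_ge0 ?mulr_ge0 ?(ltW tau0) ?(ltW rK0)//.
  rewrite expr2 ler_wpM2r//; by case/andP: i1.
apply: (@le_trans _ _ (((2 * (tau * rK)) ^+ d.+1)^-1%:E * (c * y ^+ K / (1 - y))%:E)).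
  by apply: lee_wpmul2l => //; rewrite lee_fin invr_ge0 exprn_ge0// mulr_ge0// ltW.
rewrite -EFinM lee_fin le_eqVlt; apply/orP; left; apply/eqP.
rewrite /c mulrA !exprMn !exprSr; field.
by rewrite subr_eq0 !gt_eqF ?exprn_gt0.
Qed.

End failure.

(** * Regularity and failure of the inequality for the smaller exponent *)

Section slit_space_properties.
Context {R : realType} (d : nat) (p l : R) (V : normedModType R) (q : nat -> V)
  (e r : nat -> R) (lv : levels d p l e r)
  (m : {sigma_finite_measure set (borel V) -> \bar R}) (bm : box_space d m).
Hypotheses (dq : dense_seq q) (p1 : (1 < p)%R).
Local Notation W := (V * R)%type.
Local Notation T := (borel V * measurableTypeR R)%type.
Local Notation X := (restr (slit01 q e r)).
Local Notation lam := (@lebesgue_measure R).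
Local Notation mu := (hausdorff_measure X d.+1).
Local Notation emb := (@emb R W (slit q e r) (0%R, 1%R) (slit01 q e r)).
Variable k : R.
Hypotheses (k0 : (0 < k)%R)
  (muE : forall A : set T, measurable A -> mu (emb @^-1` A) = k%:E * (m \x lam) A)
  (intE : forall (D : set T) (f : T -> \bar R), measurable D -> measurable_fun setT f ->
    (forall y, 0 <= f y) ->
    \int[mu]_(x in emb @^-1` D) f (emb x) = k%:E * \int[m \x lam]_(y in D) f y).

Lemma slit_regular : regular_space_of_dim X d.+1.
Proof.
pose a := (k * 2 ^+ d.+1)%R.
have a0 : (0 < a)%R by rewrite mulr_gt0// exprn_gt0.
have ai : (0 < a^-1)%R by rewrite invr_gt0.
exists (1 + a + a^-1)%R; split; first lra.
move=> x s s0 _; rewrite (ball_slit_measure bm muE x s0) exprMn mulrA -/a !lee_fin.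
have sn : (0 <= s ^+ d.+1)%R by rewrite exprn_ge0// ltW.
split; apply: ler_wpM2r => //; last lra.
by rewrite invf_ple ?posrE; lra.
Qed.

(* The test function has oscillation of order 1 in the ball of radius [r K] centred at
   [(0, r K / 2)], while its gradient only sees the levels [i >= K] there. *)
Lemma slit_no_poincare (eps : R) : (0 < eps)%R ->
  ~ supports_orlicz_poincare X d.+1 p (l - eps).
Proof.
move=> eps0 [C [tau [C0 tau1 PI]]].
have e0 i : (0 < e i)%R by exact: level_e_gt0 lv i.
pose y : R := (2 `^ (- (eps / 2)))%R.
have y0 : (0 < y)%R by rewrite powR_gt0.
have y1 : (y < 1)%R.
  rewrite /y powRN invf_lt1 ?powR_gt0//.
  by rewrite /powR pnatr_eq0/= -[ltLHS](@expR0 R) ltr_expR mulr_gt0 ?divr_gt0 ?ln_gt0 ?ltr1n.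
have [a a0 Ha] := Psi_superlinear (l - eps) 1 p1.
pose D := (4 ^+ d.+1 * (2 * tau + 2) ^+ d / (2 * tau) ^+ d.+1 / (1 - y))%R.
have D0 : (0 < D)%R.
  by rewrite /D !divr_gt0 ?mulr_gt0 ?exprn_gt0 ?subr_gt0//; lra.
have [|N1 HN1] := level_small lv (_ : 0 < (8 * C * a)^-1)%R.
  by rewrite invr_gt0 !mulr_gt0.
have [N2 _ HN2] : \forall n \near \oo, (y ^+ n < (8 * C * D)^-1)%R.
  have cv : (y ^+ n)%R @[n --> \oo] --> (0 : R)%R by apply: cvg_expr; rewrite gtr0_norm.
  move: cv => /cvgr_lt; apply.
  by rewrite invr_gt0; apply: mulr_gt0 => //; exact: mulr_gt0.
(* The three summands ensure that s below exceeds the threshold of superlinearity, that the mean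
   energy is at most s, and that the dilation tau is at most K. *)
pose K := (N1 + N2 + (Num.truncn tau).+1)%N.
have rK0 := level_r_gt0 lv K.
have rK1 : (r K < (8 * C * a)^-1)%R by apply: HN1; rewrite /K -addnA leq_addr.
have yK : (y ^+ K < (8 * C * D)^-1)%R by apply: HN2; rewrite /= /K addnAC leq_addl.
have tauK : (tau <= K%:R)%R.
  by apply: le_trans (ltW (truncnS_gt tau)) _; rewrite ler_nat leq_addl.
(* With this s the right-hand side of the assumed inequality is at most C r_K s = 1/8, because
   Psi(s) > s is above the mean energy; the left-hand side is at least 1/4. *)
pose s := ((8 * C * r K)^-1)%R.
have s0 : (0 < s)%R by rewrite invr_gt0 !mulr_gt0.
have sa : (a <= s)%R.
  rewrite /s -[leLHS]invrK lef_pV2 ?posrE ?invr_gt0 ?mulr_gt0//.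
  rewrite -ler_pdivlMl ?mulr_gt0//; apply: ltW; apply: lt_le_trans rK1 _.
  by rewrite invfM.
have Ds : (D * y ^+ K / r K <= s)%R.
  rewrite /s invfM ler_pM2r ?invr_gt0// -ler_pdivlMl//.
  by apply: ltW; apply: lt_le_trans yK _; rewrite invfM mulrC.
have rK2 : (r K / 2 != 0)%R by rewrite gt_eqF// divr_gt0.
have [x xE] := emb_surj (slit01 q e r) (slit_off q e r 0%R rK2).
have := PI _ _ (step_integrable bm dq k0 intE) (step_upper_gradient q r e0) x (r K) rK0.
cbv zeta; set uB := fine _ => {}PI.
have inv : Psi_inv p (l - eps) (average d.+1 (Psi_ext p (l - eps) \o
    (step_gradient q e r \o emb)) (ball x (tau * r K)%R)) <= s%:E.
  apply: ereal_inf_lbound; exists s => //; split; first exact: ltW.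
  apply: le_lt_trans (step_average_energy lv bm dq p1 k0 muE intE (erefl y) eps0 tau1 tauK xE) _.
  by rewrite lte_fin; apply: le_lt_trans Ds _; rewrite -[ltLHS]mul1r; exact: Ha.
have := le_trans (step_deviation lv bm dq k0 muE intE uB xE) PI.
have CK : 0 <= (C * r K)%:E by rewrite lee_fin mulr_ge0// ltW.
move=> /le_trans/(_ (lee_wpmul2l CK inv)).
rewrite -EFinM lee_fin (_ : C * r K * s = 8^-1)%R; last by rewrite /s; field; rewrite !gt_eqF.
by rewrite lef_pV2 ?posrE// ler_nat.
Qed.

End slit_space_properties.

Local Close Scope ereal_scope.

Theorem mainTheorem2 (R : realType) (n : nat) (p lam : R)
    (hn : (2 <= n)%N) (hp1 : 1 < p) (hpn : p < n%:R) :
  exists X : pmetricType R,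
    [/\ locally_compact [set: X],
        regular_space_of_dim X n,
        supports_orlicz_poincare X n p lam &
        forall eps : R, 0 < eps ->
          ~ supports_orlicz_poincare X n p (lam - eps)].
Proof.
case: n hn hpn => [|[|d]]// _ pd.
have [V [m bm]] := @box_space_exists R d.
have [q dq] := box_dense bm.
have [m' bm' m'E] := box_space_step bm.
have [e [r lv]] := levels_exist lam (ltn0Sn d) hp1 pd.
have [k k0 [muE intE]] := slit_integral e r bm' dq m'E.
exists (restr (slit01 q e r)); split.
- apply: locally_compact_restr; first exact: open_slit.
  exact: box_compact bm'.
- exact: (slit_regular bm k0 muE).
- exact: (slit_poincare bm dq k0 muE intE lv hp1 pd).
- move=> eps eps0; exact: (slit_no_poincare lv bm dq hp1 k0 muE intE eps0).
Qed.
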